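(* Let $A$ be an operator on a Banach space $X$ which admits a $\mathcal B$-calculus $\Phi$. Then $\Phi$ is unique; in fact, for all $f\in\mathcal B$, $x\in X$, $x^*\in X^*$, \[\langle\Phi(f)x,x^*\rangle=f(\infty)\langle x,x^*\rangle-\frac2\pi\int_0^\infty\alpha\int_{\mathbb R}\langle(\alpha-i\beta+A)^{-2}x,x^*\rangle f'(\alpha+i\beta)\,d\beta\,d\alpha.\]
   Context: $\mathbb C_+=\{z:\Re z>0\}$. $\mathcal B$ is the Banach algebra of holomorphic $f$ on $\mathbb C_+$ with $\|f\|_{\mathcal B_0}:=\int_0^\infty\sup_{\beta\in\mathbb R}|f'(\alpha+i\beta)|\,d\alpha<\infty$, with norm $\|f\|_{\mathcal B}=\sup_{\mathbb C_+}|f|+\|f\|_{\mathcal B_0}$; $f(\infty):=\lim_{\Re z\to\infty}f(z)$ exists for $f\in\mathcal B$. For $z\in\mathbb C_+$, $r_z(\lambda)=(z+\lambda)^{-1}$. An operator $A$ on $X$ admits a $\mathcal B$-calculus if $A$ is densely defined, $\sigma(A)\subset\overline{\mathbb C}_+$, and there is a bounded algebra homomorphism $\Phi:\mathcal B\to L(X)$ with $\Phi(r_z)=(z+A)^{-1}$ for all $z\in\mathbb C_+$. (It is known that whenever $\sup_{\alpha>0}\alpha\int_{\mathbb R}|\langle(\alpha+i\beta+A)^{-2}x,x^*\rangle|d\beta<\infty$ for all $x,x^*$, the displayed formula defines such a $\Phi$.) *)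

(* Defs.v *)
From HB Require Import structures.
From mathcomp Require Import all_boot all_order all_algebra.
From mathcomp Require Import all_classical all_reals all_analysis.
From mathcomp Require Import complex.
Import Order.TTheory GRing.Theory Num.Theory.
Import numFieldNormedType.Exports.

Set Implicit Arguments.
Unset Strict Implicit.
Unset Printing Implicit Defensive.

Local Open Scope ring_scope.
Local Open Scope classical_set_scope.

Definition Cplus (R : realType) : set R[i] := [set z | 0 < complex.Re z].
Arguments Cplus R : clear implicits.

(* Complex derivative f'(z) (difference quotients with complex increments). *)
Definition cderiv (R : realType) (f : R[i] -> R[i]) (z : R[i]) : R[i] :=
  let g : R[i]^o -> R[i]^o := f in 'D_1 g z.

Definition cderivable (R : realType) (f : R[i] -> R[i]) (z : R[i]) : Prop :=
  let g : R[i]^o -> R[i]^o := f in derivable g z 1.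

Definition cabs (R : realType) (z : R[i]) : R := Normc.normc z.

Definition supnormB (R : realType) (f : R[i] -> R[i]) : \bar R :=
  ereal_sup [set (cabs (f z))%:E | z in Cplus R].

Definition dsup (R : realType) (f : R[i] -> R[i]) (a : R) : \bar R :=
  ereal_sup [set (cabs (cderiv f (Complex a b)))%:E | b in [set: R]].

Definition B0norm (R : realType) (f : R[i] -> R[i]) : \bar R :=
  (\int[@lebesgue_measure R]_(a in (`]0%R, +oo[ : set R)) dsup f a)%E.

(* f belongs to the algebra B: holomorphic on C_+, bounded, ||f||_{B_0} < oo.
   (Only the values of f on C_+ matter.) *)
Definition inB (R : realType) (f : R[i] -> R[i]) : Prop :=
  [/\ forall z, Cplus R z -> cderivable f z,
      (supnormB f < +oo)%E & (B0norm f < +oo)%E].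

(* ||f||_B = sup |f| + ||f||_{B_0}  (a real number when f is in B) *)
Definition Bnorm (R : realType) (f : R[i] -> R[i]) : R :=
  fine (supnormB f + B0norm f)%E.

Definition Re_to_infty (R : realType) : set_system R[i]^o :=
  [set P | exists M : R, forall z : R[i], M < complex.Re z -> P z].
Arguments Re_to_infty R : clear implicits.

Definition finfty (R : realType) (f : R[i] -> R[i]) : R[i] :=
  lim [set P : set R[i]^o | Re_to_infty R (f @^-1` P)].

Definition rz (R : realType) (z : R[i]) : R[i] -> R[i] := fun l => (z + l)^-1.

Definition cint (R : realType) (D : set R) (h : R -> R[i]) : R[i] :=
  Complex (Rintegral (@lebesgue_measure R) D (fun t => complex.Re (h t)))
          (Rintegral (@lebesgue_measure R) D (fun t => complex.Im (h t))).

Section Ops.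
Context (R : realType) (X : completeNormedModType R[i]).

Definition bdd_linear (T : X -> X) : Prop :=
  (forall (a : R[i]) (x y : X), T (a *: x + y) = a *: T x + T y) /\
  exists M : R, forall x : X, `|T x| <= M%:C%C * `|x|.

Definition in_dual (xs : X -> R[i]^o) : Prop :=
  (forall (a : R[i]) (x y : X), xs (a *: x + y) = a * xs x + xs y) /\
  continuous xs.

Definition linear_operator (D : set X) (A : X -> X) : Prop :=
  D 0 /\
  (forall (a : R[i]) (x y : X), D x -> D y -> D (a *: x + y)) /\
  (forall (a : R[i]) (x y : X), D x -> D y -> A (a *: x + y) = a *: A x + A y).

Definition densely_defined (D : set X) : Prop := closure D = [set: X].

Definition resolvent_set (D : set X) (A : X -> X) (l : R[i]) : Prop :=
  exists T : X -> X, [/\ bdd_linear T, forall y, D (T y),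
     forall y, l *: T y - A (T y) = y &
     forall x, D x -> T (l *: x - A x) = x].

Definition spectrum (D : set X) (A : X -> X) : set R[i] :=
  ~` resolvent_set D A.

Definition is_inverse_shift (D : set X) (A : X -> X) (z : R[i]) (T : X -> X) :=
  [/\ forall y, D (T y),
      forall y, z *: T y + A (T y) = y &
      forall x, D x -> T (z *: x + A x) = x].

(* (z + A)^{-1} (defined as 0 when z + A is not invertible) *)
Definition resolv (D : set X) (A : X -> X) (z : R[i]) : X -> X :=
  match pselect (exists T, is_inverse_shift D A z T) with
  | left h => proj1_sig (cid h)
  | right _ => fun _ => 0
  end.

Definition B_calculus (D : set X) (A : X -> X)
    (Phi : (R[i] -> R[i]) -> X -> X) : Prop :=
  [/\ linear_operator D A, densely_defined D &
      (forall l, spectrum D A l -> 0 <= complex.Re l)] /\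
  [/\ forall f, inB f -> bdd_linear (Phi f),
      forall f g, inB f -> inB g ->
        Phi (fun l => f l + g l) = (fun x => Phi f x + Phi g x),
      forall (c : R[i]) f, inB f -> Phi (fun l => c * f l) = (fun x => c *: Phi f x) &
      forall f g, inB f -> inB g ->
        Phi (fun l => f l * g l) = (fun x => Phi f (Phi g x))] /\
  (exists M : R, forall f, inB f -> forall x, `|Phi f x| <= (M * Bnorm f)%:C%C * `|x|) /\
  (forall z, Cplus R z -> Phi (rz z) = resolv D A z).

End Ops.

(* Main.v *)
Require Import Defs.
From HB Require Import structures.
From mathcomp Require Import all_boot all_order all_algebra.
From mathcomp Require Import all_classical all_reals all_analysis.
From mathcomp Require Import measurable_realfun complex.
From mathcomp Require Import ring lra.
Import Order.TTheory GRing.Theory Num.Theory.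
Import numFieldNormedType.Exports.

Set Implicit Arguments.
Unset Strict Implicit.
Unset Printing Implicit Defensive.

Local Open Scope ring_scope.
Local Open Scope classical_set_scope.

(* The heart of the proof is an approximation statement: if a seminorm on B is
   dominated by the B-norm and vanishes on every r_z, it vanishes on every G in B
   with |G(w)| = O(|1+w|^-2). By Cauchy's formula G(. + 2s) is the integral of
   G(s+it) r_(s-it) / (2 pi) dt, whose Riemann sums converge in B, and
   G(. + 2s) tends to G in B as s tends to 0.

   Uniqueness: apply this to f |-> |Phi(f)x - Psi(f)x| and G = f r_1^2; then
   Phi(f) and Psi(f) agree on the range of (1+A)^-2, which is dense.

   Formula: testing Phi on finite sums of multiples of r_z^2, with the points z one
   in each cell of size alpha on a vertical line, bounds
   alpha * int |<(alpha-i beta+A)^-2 x, x*>| d beta uniformly in alpha, so the right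
   hand side is a bounded functional on B. It agrees with <Phi(.)x, x*> on each r_z
   by a residue computation, hence on (f - f(oo)) (n r_n)^2, and n tends to oo. *)

(** * Complex derivatives and integrals in terms of the real modulus *)

(** Elements of the span of the [r_z] decay along vertical lines, and so do their limits in the
    B-norm, whereas [l |-> e^(-l)] does not. Approximation by resolvent functions therefore reaches
    only decaying functions, and a decaying factor has to be inserted and then removed. For
    uniqueness it is removed in [X], by density of a range. For the formula the factors [(n r_n)^2]
    do not tend to 1 in norm: [f (1 - (n r_n)^2)] keeps the size of [f] at large imaginary parts.
    Convergence is only weak: on the operator side [n (n+A)^-1] tends strongly to the identity, on
    the other side dominated convergence acts on each vertical line and then in [alpha]. The square
    function estimate thus serves twice, as the bound of the functional and as the majorant.

    A simple Cauchy kernel is not absolutely integrable on a line against a bounded function. This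
    is why the Cauchy formulas below carry two poles, the second one being placed where it gives the
    Poisson kernel, a derivative, or a harmless extra factor. *)

Section ComplexModulus.
Context {R : realType}.
Implicit Types (z w : R[i]) (x y : R).

Lemma cabsE z : cabs z = Num.sqrt (complex.Re z ^+ 2 + complex.Im z ^+ 2).
Proof. by case: z. Qed.

Lemma cabs_norm z : `|z| = (cabs z)%:C%C.
Proof. by rewrite /cabs; case: z. Qed.

Lemma cabs_ge0 z : 0 <= cabs z.
Proof. by rewrite cabsE sqrtr_ge0. Qed.

Lemma cabs0 : cabs (0 : R[i]) = 0.
Proof. exact: Normc.normc0. Qed.

Lemma cabs1 : cabs (1 : R[i]) = 1.
Proof. exact: Normc.normc1. Qed.

Lemma cabs_eq0 z : (cabs z == 0) = (z == 0).
Proof.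
apply/eqP/eqP => [|->]; first exact: Normc.eq0_normc.
exact: cabs0.
Qed.

Lemma cabs_gt0 z : (0 < cabs z) = (z != 0).
Proof. by rewrite lt_def cabs_ge0 andbT cabs_eq0. Qed.

Lemma cabsM z w : cabs (z * w) = cabs z * cabs w.
Proof. exact: Normc.normcM. Qed.

Lemma cabsV z : cabs z^-1 = (cabs z)^-1.
Proof. exact: Normc.normcV. Qed.

Lemma cabsX z n : cabs (z ^+ n) = cabs z ^+ n.
Proof. by elim: n => [|n IH]; rewrite ?expr0 ?cabs1// !exprS cabsM IH. Qed.

Lemma cabsN z : cabs (- z) = cabs z.
Proof. exact: normcN. Qed.

Lemma cabsD z w : cabs (z + w) <= cabs z + cabs w.
Proof. exact: le_normcD. Qed.

Lemma cabsBC z w : cabs (z - w) = cabs (w - z).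
Proof. by rewrite -cabsN opprB. Qed.

Lemma cabsB z w : cabs (z - w) <= cabs z + cabs w.
Proof. by rewrite -(cabsN w) cabsD. Qed.

Lemma cabs_triangle z w v : cabs (z - v) <= cabs (z - w) + cabs (w - v).
Proof. by rewrite (le_trans _ (cabsD _ _))// addrA subrK. Qed.

Lemma cabsB_ge z w : cabs z - cabs w <= cabs (z - w).
Proof. by rewrite lerBlDr (le_trans _ (cabsD _ _))// subrK. Qed.

Lemma cabs_Re z : `|complex.Re z| <= cabs z.
Proof. by rewrite -sqrtr_sqr cabsE ler_wsqrtr// lerDl sqr_ge0. Qed.

Lemma cabs_Im z : `|complex.Im z| <= cabs z.
Proof. by rewrite -sqrtr_sqr cabsE ler_wsqrtr// lerDr sqr_ge0. Qed.

Lemma Re_le_cabs z : complex.Re z <= cabs z.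
Proof. exact: le_trans (ler_norm _) (cabs_Re _). Qed.

Lemma cabs_sqr z : cabs z ^+ 2 = complex.Re z ^+ 2 + complex.Im z ^+ 2.
Proof. by rewrite cabsE sqr_sqrtr// addr_ge0// sqr_ge0. Qed.

Lemma cabs_real x : cabs (x%:C%C) = `|x|.
Proof. by rewrite cabsE /= expr0n addr0 sqrtr_sqr. Qed.

Lemma cabs_natr n : cabs (n%:R : R[i]) = n%:R.
Proof. by rewrite -(rmorph_nat (real_complex R)) cabs_real ger0_norm. Qed.

Lemma cabs_complex0 x : cabs (Complex x 0) = `|x|.
Proof. exact: cabs_real. Qed.

Lemma cabs_imag x : cabs (Complex 0 x) = `|x|.
Proof. by rewrite cabsE /= expr0n add0r sqrtr_sqr. Qed.

Lemma cabs_ReIm z : cabs z <= `|complex.Re z| + `|complex.Im z|.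
Proof.
have -> : z = (complex.Re z)%:C%C + Complex 0 (complex.Im z).
  by case: z => a b /=; rewrite /GRing.add/= addr0 add0r.
rewrite (le_trans (cabsD _ _))// cabs_real cabs_imag.
by case: z => a b /=; rewrite add0r addr0.
Qed.

Lemma cReD z w : complex.Re (z + w) = complex.Re z + complex.Re w.
Proof. by case: z w => [a b] [c d]. Qed.
Lemma cImD z w : complex.Im (z + w) = complex.Im z + complex.Im w.
Proof. by case: z w => [a b] [c d]. Qed.
Lemma cReN z : complex.Re (- z) = - complex.Re z. Proof. by case: z. Qed.
Lemma cImN z : complex.Im (- z) = - complex.Im z. Proof. by case: z. Qed.
Lemma cReM z w : complex.Re (z * w) =
  complex.Re z * complex.Re w - complex.Im z * complex.Im w.
Proof. by case: z w => [a b] [c d]. Qed.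
Lemma cImM z w : complex.Im (z * w) =
  complex.Re z * complex.Im w + complex.Im z * complex.Re w.
Proof. by case: z w => [a b] [c d]. Qed.

Definition ReImE := (cReD, cImD, cReN, cImN, cReM, cImM).

Lemma complexP z w : complex.Re z = complex.Re w ->
  complex.Im z = complex.Im w -> z = w.
Proof. by case: z w => [a b] [c d] /= -> ->. Qed.

(** Rotation onto the positive axis reduces bounds on complex integrals and increments to bounds on
    real parts; it also supplies the phases of the cell sums in the square function estimate. *)
Lemma cabs_rotation z : exists2 c : R[i], cabs c = 1 & c * z = (cabs z)%:C%C.
Proof.
have [->|z0] := eqVneq z 0.
  by exists 1; rewrite ?cabs1// mulr0 cabs0.
have az0 : (cabs z)%:C%C != 0 :> R[i].
  by rewrite -cabs_eq0 cabs_real normr_eq0 cabs_eq0.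
exists ((cabs z)%:C%C / z); last by rewrite divfK.
by rewrite cabsM cabsV cabs_real ger0_norm ?cabs_ge0// divff// cabs_eq0.
Qed.

Lemma gt0_complexE (e : R[i]) : 0 < e -> e = (complex.Re e)%:C%C /\ 0 < complex.Re e.
Proof. by rewrite ltcE /= => /andP[/eqP h ->]; split=> //; apply: complexP. Qed.

End ComplexModulus.

(** First-order expansion with real moduli. The product form covers [h = 0] without division. *)
Definition hasD (R : realType) (f : R[i] -> R[i]) (z l : R[i]) : Prop :=
  forall e : R, 0 < e -> exists2 d : R, 0 < d &
    forall h, cabs h < d -> cabs (f (z + h) - f z - l * h) <= e * cabs h.

Definition ccontinuous_at (R : realType) (f : R[i] -> R[i]) (z : R[i]) : Prop :=
  forall e : R, 0 < e -> exists2 d : R, 0 < d &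
    forall w, cabs (w - z) < d -> cabs (f w - f z) < e.

Section ComplexDerivative.
Context {R : realType}.
Implicit Types (f g : R[i] -> R[i]) (z w l : R[i]).

(** The norm of [R[i]] takes its values in [R[i]], but a positive element there is a positive real,
    so both sides quantify over the same radii and tolerances. *)
Lemma hasD_is_derive f z l :
  hasD f z l <-> is_derive (z : R[i]^o) 1 (f : R[i]^o -> R[i]^o) l.
Proof.
split.
- move=> H.
  have cv : (fun h : R[i]^o => h^-1 *: ((f : R[i]^o -> R[i]^o) (h *: 1 + (z : R[i]^o)) - f z))
      @ (0 : R[i]^o)^' --> (l : R[i]^o).
    apply/cvgrPdist_le => /= e /gt0_complexE[eE e0].
    have [d d0 Hd] := H _ e0.
    exists (d%:C%C : R[i]); first by rewrite /= ltcR.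
    move=> h /=; rewrite sub0r normrN cabs_norm ltcR => hd h0.
    have hh : cabs h != 0 by rewrite cabs_eq0.
    rewrite eE cabs_norm lecR.
    have -> : l - h^-1 *: (f (h *: 1 + z) - f z)
        = - ((f (z + h) - f z - l * h) / h).
      by rewrite /GRing.scale/= mulr1 (addrC h z); field.
    rewrite cabsN cabsM cabsV ler_pdivrMr ?cabs_gt0//.
    exact: Hd.
  split; first by apply/cvg_ex; exists l.
  by apply: cvg_lim => //.
- move=> [df <-] e e0.
  have /cvgrPdist_le/(_ (e%:C%C)) := df.
  rewrite ltcR => /(_ e0)[d /= /gt0_complexE[dE d0] Hd].
  exists (complex.Re d) => // h hd.
  have [->|h0] := eqVneq h 0.
    by rewrite addr0 subrr mulr0 subrr cabs0 mulr0.
  have := Hd h; rewrite /= sub0r normrN cabs_norm dE ltcR => /(_ hd h0).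
  rewrite cabs_norm lecR.
  set D := lim _.
  rewrite -/(derive (f : R[i]^o -> R[i]^o) (z : R[i]^o) 1) -/D.
  have hh : cabs h != 0 by rewrite cabs_eq0.
  have -> : D - h^-1 *: (f (h *: 1 + z) - f z)
        = - ((f (z + h) - f z - D * h) / h).
    by rewrite /GRing.scale/= mulr1 (addrC h z); field.
  by rewrite cabsN cabsM cabsV ler_pdivrMr ?cabs_gt0.
Qed.

Lemma hasD_cderivable f z l : hasD f z l -> cderivable f z.
Proof. by move=> /hasD_is_derive[]. Qed.

Lemma hasD_cderiv f z l : hasD f z l -> cderiv f z = l.
Proof. by move=> /hasD_is_derive[]. Qed.

Lemma cderivable_hasD f z : cderivable f z -> hasD f z (cderiv f z).
Proof. by move=> df; apply/hasD_is_derive; exact: DeriveDef. Qed.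

Lemma hasD_cst c z : hasD (fun=> c) z 0.
Proof. by apply/hasD_is_derive; exact: is_derive_cst. Qed.

Lemma hasD_id z : hasD id z 1.
Proof. by apply/hasD_is_derive; exact: is_derive_id. Qed.

Lemma hasDD f g z l l' : hasD f z l -> hasD g z l' ->
  hasD (fun w => f w + g w) z (l + l').
Proof.
move=> /hasD_is_derive df /hasD_is_derive dg.
by apply/hasD_is_derive; exact: is_deriveD.
Qed.

Lemma hasDM f g z l l' : hasD f z l -> hasD g z l' ->
  hasD (fun w => f w * g w) z (f z * l' + g z * l).
Proof.
move=> /hasD_is_derive df /hasD_is_derive dg.
by apply/hasD_is_derive; exact: is_deriveM.
Qed.

Lemma hasDZ c f z l : hasD f z l -> hasD (fun w => c * f w) z (c * l).
Proof.
move=> df; have := hasDM (hasD_cst c z) df.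
by rewrite mulr0 addr0.
Qed.

Lemma hasDN f z l : hasD f z l -> hasD (fun w => - f w) z (- l).
Proof.
move=> /hasD_is_derive df.
by apply/hasD_is_derive; exact: is_deriveN.
Qed.

Lemma hasDB f g z l l' : hasD f z l -> hasD g z l' ->
  hasD (fun w => f w - g w) z (l - l').
Proof. by move=> df /hasDN; exact: hasDD. Qed.

Lemma hasDV f z l : f z != 0 -> hasD f z l ->
  hasD (fun w => (f w)^-1) z (- l / f z ^+ 2).
Proof.
move=> fz /hasD_is_derive[df dE].
apply/hasD_is_derive; split; first exact: (derivableV fz df).
by rewrite deriveV// dE scaleNr mulNr mulrC.
Qed.

Lemma hasD_near f g z l (d : R) : 0 < d ->
  (forall w, cabs (w - z) < d -> f w = g w) -> hasD f z l -> hasD g z l.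
Proof.
move=> d0 fg H e e0; have [d' d'0 Hd] := H e e0.
exists (Num.min d d'); first by rewrite lt_min d0.
move=> h; rewrite lt_min => /andP[hd hd'].
rewrite -!fg; [exact: Hd| by rewrite subrr cabs0 |].
by rewrite addrAC subrr add0r.
Qed.

Lemma hasD_shift f z l c : hasD f (z + c) l -> hasD (fun w => f (w + c)) z l.
Proof.
move=> H e e0; have [d d0 Hd] := H e e0; exists d => // h hd.
by rewrite (addrAC z h c); exact: Hd.
Qed.

Lemma hasD_continuous f z l : hasD f z l -> ccontinuous_at f z.
Proof.
move=> H e e0; have [d d0 Hd] := H 1 ltr01.
pose M := 1 + cabs l.
have M0 : 0 < M by rewrite ltr_pwDl// cabs_ge0.
exists (Num.min d (e / M)); first by rewrite lt_min d0 divr_gt0.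
move=> w; rewrite lt_min => /andP[wd we].
have := Hd _ wd; rewrite (addrC z) subrK mul1r => H1.
rewrite (@le_lt_trans _ _ (M * cabs (w - z)))//; last first.
  by rewrite mulrC -ltr_pdivlMr.
rewrite mulrDl mul1r -cabsM.
have -> : f w - f z = (f w - f z - l * (w - z)) + l * (w - z) by rewrite subrK.
by rewrite (le_trans (cabsD _ _))// lerD2r.
Qed.

End ComplexDerivative.

#[local] Arguments cint : simpl never.

Definition cmeas (R : realType) (D : set R) (h : R -> R[i]) : Prop :=
  measurable_fun D (fun t => complex.Re (h t)) /\
  measurable_fun D (fun t => complex.Im (h t)).

Definition cintegrable (R : realType) (D : set R) (h : R -> R[i]) : Prop :=
  (@lebesgue_measure R).-integrable D (EFin \o (fun t => complex.Re (h t))) /\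
  (@lebesgue_measure R).-integrable D (EFin \o (fun t => complex.Im (h t))).

Definition pcont (R : realType) (h : R -> R[i]) (t : R) : Prop :=
  forall e : R, 0 < e -> exists2 d : R, 0 < d &
    forall s, `|s - t| < d -> cabs (h s - h t) < e.

Section ComplexIntegral.
Context {R : realType}.
Notation mu := (@lebesgue_measure R).
Implicit Types (D : set R) (h k : R -> R[i]) (g : R -> R) (c : R[i]).

Lemma integrable_RD D g1 g2 : measurable D -> mu.-integrable D (EFin \o g1) ->
  mu.-integrable D (EFin \o g2) ->
  mu.-integrable D (EFin \o (fun t => g1 t + g2 t)).
Proof. by move=> mD i1 i2; exact: (@integrableD _ _ _ mu _ mD _ _ i1 i2). Qed.

Lemma integrable_RZ D (r : R) g : measurable D -> mu.-integrable D (EFin \o g) ->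
  mu.-integrable D (EFin \o (fun t => r * g t)).
Proof. by move=> mD ig; exact: (@integrableZl _ _ _ mu _ mD r _ ig). Qed.

Lemma integrable_Rle D g1 g2 : measurable D -> measurable_fun D g1 ->
  mu.-integrable D (EFin \o g2) -> (forall t, D t -> `|g1 t| <= g2 t) ->
  mu.-integrable D (EFin \o g1).
Proof.
move=> mD m1 i2 h; apply: le_integrable i2 => //; first exact/measurable_EFinP.
by move=> t Dt /=; rewrite lee_fin (le_trans (h _ Dt))// ler_norm.
Qed.

Lemma cmeas_cst D c : cmeas D (fun=> c).
Proof. by split; exact: measurable_cst. Qed.

Lemma cmeasD D h k : cmeas D h -> cmeas D k -> cmeas D (fun t => h t + k t).
Proof.
move=> [h1 h2] [k1 k2]; split.
- under eq_fun do rewrite cReD; exact: measurable_funD.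
- under eq_fun do rewrite cImD; exact: measurable_funD.
Qed.

Lemma cmeasM D h k : cmeas D h -> cmeas D k -> cmeas D (fun t => h t * k t).
Proof.
move=> [h1 h2] [k1 k2]; split.
- under eq_fun do rewrite cReM.
  by apply: measurable_funB; exact: measurable_funM.
- under eq_fun do rewrite cImM.
  by apply: measurable_funD; exact: measurable_funM.
Qed.

Lemma cmeasN D h : cmeas D h -> cmeas D (fun t => - h t).
Proof.
move=> [h1 h2]; split.
- by under eq_fun do rewrite cReN; exact: measurableT_comp.
- by under eq_fun do rewrite cImN; exact: measurableT_comp.
Qed.

Lemma cmeasB D h k : cmeas D h -> cmeas D k -> cmeas D (fun t => h t - k t).
Proof. by move=> mh /cmeasN; exact: cmeasD. Qed.

Lemma cmeas_cabs D h : cmeas D h -> measurable_fun D (fun t => cabs (h t)).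
Proof.
move=> [h1 h2]; under eq_fun do rewrite cabsE.
have ms : measurable_fun setT (@Num.sqrt R).
  by apply: continuous_measurable_fun; exact: sqrt_continuous.
apply: (measurableT_comp ms).
by apply: measurable_funD; exact: measurable_funX.
Qed.

Lemma cmeas_of_cintegrable D h : cintegrable D h -> cmeas D h.
Proof.
by move=> [h1 h2]; split; apply/measurable_EFinP;
  [exact: (measurable_int _ h1)|exact: (measurable_int _ h2)].
Qed.

Lemma cmeas_setT D h : measurable D -> cmeas setT h -> cmeas D h.
Proof. by move=> mD [h1 h2]; split; exact: measurable_funTS. Qed.

Lemma pcont_Re h t : pcont h t -> {for t, continuous (fun t => complex.Re (h t))}.
Proof.
move=> H; apply/cvgrPdist_lt => /= e e0.
have [d d0 Hd] := H e e0; exists d => // s /= ts.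
rewrite -cReN -cReD (le_lt_trans (cabs_Re _))// cabsBC; apply: Hd.
by rewrite distrC.
Qed.

Lemma pcont_Im h t : pcont h t -> {for t, continuous (fun t => complex.Im (h t))}.
Proof.
move=> H; apply/cvgrPdist_lt => /= e e0.
have [d d0 Hd] := H e e0; exists d => // s /= ts.
rewrite -cImN -cImD (le_lt_trans (cabs_Im _))// cabsBC; apply: Hd.
by rewrite distrC.
Qed.

Lemma pcont_cabs h t : pcont h t -> {for t, continuous (fun t => cabs (h t))}.
Proof.
move=> H; apply/cvgrPdist_lt => /= e e0.
have [d d0 Hd] := H e e0; exists d => // s /= ts.
have := Hd s; rewrite distrC => /(_ ts); apply: le_lt_trans.
rewrite ler_norml; apply/andP; split.
  by rewrite lerNl opprB; exact: cabsB_ge.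
by rewrite (cabsBC (h s)); exact: cabsB_ge.
Qed.

Lemma pcont_cmeasT h : (forall t, pcont h t) -> cmeas setT h.
Proof.
move=> H; split; apply: continuous_measurable_fun => t.
- exact: pcont_Re.
- exact: pcont_Im.
Qed.

Lemma pcont_cmeas_open (D : set R) h : open D -> (forall t, D t -> pcont h t) ->
  cmeas D h.
Proof.
move=> oD H; split; apply: open_continuous_measurable_fun => // t /set_mem Dt.
- by apply: pcont_Re; exact: H.
- by apply: pcont_Im; exact: H.
Qed.

Lemma ccontinuous_path f (p : R -> R[i]) t :
  (forall s s', cabs (p s - p s') <= `|s - s'|) ->
  ccontinuous_at f (p t) -> pcont (fun s => f (p s)) t.
Proof.
move=> pL H e e0; have [d d0 Hd] := H e e0; exists d => // s sd.
by apply: Hd; rewrite (le_lt_trans (pL _ _)).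
Qed.

Lemma vline_lip (a s s' : R) : cabs (Complex a s - Complex a s') <= `|s - s'|.
Proof.
have -> : Complex a s - Complex a s' = Complex 0 (s - s').
  by apply: complexP; rewrite !ReImE /= ?subrr.
by rewrite cabs_imag.
Qed.

Lemma hline_lip (b s s' : R) : cabs (Complex s b - Complex s' b) <= `|s - s'|.
Proof.
have -> : Complex s b - Complex s' b = Complex (s - s') 0.
  by apply: complexP; rewrite !ReImE /= ?subrr.
by rewrite cabs_complex0.
Qed.

Lemma pcont_vline (f : R[i] -> R[i]) a t : ccontinuous_at f (Complex a t) ->
  pcont (fun s => f (Complex a s)) t.
Proof. by apply: (@ccontinuous_path f (fun s => Complex a s)); exact: vline_lip. Qed.

Lemma pcont_hline (f : R[i] -> R[i]) b t : ccontinuous_at f (Complex t b) ->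
  pcont (fun s => f (Complex s b)) t.
Proof. by apply: (@ccontinuous_path f (fun s => Complex s b)) => s s'; exact: hline_lip. Qed.

Lemma cintegrable_dom D h g : measurable D -> cmeas D h ->
  mu.-integrable D (EFin \o g) -> (forall t, D t -> cabs (h t) <= g t) ->
  cintegrable D h.
Proof.
move=> mD [mh1 mh2] ig hg; split; apply: le_integrable ig => //.
- exact/measurable_EFinP.
- move=> t Dt /=; rewrite lee_fin (le_trans (cabs_Re _))// (le_trans (hg _ Dt))//.
  exact: ler_norm.
- exact/measurable_EFinP.
- move=> t Dt /=; rewrite lee_fin (le_trans (cabs_Im _))// (le_trans (hg _ Dt))//.
  exact: ler_norm.
Qed.

Lemma cintegrable_cabs D h : measurable D -> cintegrable D h ->
  mu.-integrable D (EFin \o (fun t => cabs (h t))).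
Proof.
move=> mD ih; have mh := cmeas_of_cintegrable ih; case: ih => h1 h2.
have i12 := integrable_RD mD (integrable_norm h1) (integrable_norm h2).
apply: integrable_Rle i12 _ => //; first exact: cmeas_cabs.
by move=> t Dt /=; rewrite ger0_norm ?cabs_ge0//; exact: cabs_ReIm.
Qed.

Lemma cintegrableS D E h : measurable E -> measurable D -> D `<=` E ->
  cintegrable E h -> cintegrable D h.
Proof.
by move=> mE mD DE [h1 h2]; split;
  [exact: integrableS h1|exact: integrableS h2].
Qed.

Lemma cintegrableD D h k : measurable D -> cintegrable D h -> cintegrable D k ->
  cintegrable D (fun t => h t + k t).
Proof.
move=> mD [h1 h2] [k1 k2]; split.
- by have := integrable_RD mD h1 k1; apply: eq_integrable => // t _ /=; rewrite cReD.
- by have := integrable_RD mD h2 k2; apply: eq_integrable => // t _ /=; rewrite cImD.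
Qed.

Lemma cintegrableZ D c h : measurable D -> cintegrable D h ->
  cintegrable D (fun t => c * h t).
Proof.
move=> mD ih.
have ic := integrable_RZ (cabs c) mD (cintegrable_cabs mD ih).
apply: (@cintegrable_dom _ _ (fun t => cabs c * cabs (h t))) => //.
- by apply: cmeasM; [exact: cmeas_cst|exact: cmeas_of_cintegrable].
- by move=> t Dt; rewrite cabsM.
Qed.

Lemma cintegrableB D h k : measurable D -> cintegrable D h -> cintegrable D k ->
  cintegrable D (fun t => h t - k t).
Proof.
move=> mD ih ik; apply: cintegrableD => //.
have := @cintegrableZ D (-1) k mD ik.
by under [X in cintegrable _ X]eq_fun do rewrite mulN1r.
Qed.

Lemma eq_cintegrable D h k : (forall t, D t -> h t = k t) -> measurable D ->
  cintegrable D h -> cintegrable D k.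
Proof.
move=> hk mD [h1 h2]; split.
- by apply: eq_integrable h1 => // t /set_mem Dt /=; rewrite hk.
- by apply: eq_integrable h2 => // t /set_mem Dt /=; rewrite hk.
Qed.

Lemma eq_cint D h k : (forall t, D t -> h t = k t) -> cint D h = cint D k.
Proof.
move=> hk; rewrite /cint; congr Complex; apply: eq_Rintegral => t /set_mem Dt;
by rewrite hk.
Qed.

Lemma cintD D h k : measurable D -> cintegrable D h -> cintegrable D k ->
  cint D (fun t => h t + k t) = cint D h + cint D k.
Proof.
move=> mD [h1 h2] [k1 k2]; apply: complexP; rewrite ?cReD ?cImD /=.
- by rewrite -RintegralD//; apply: eq_Rintegral => t _; rewrite cReD.
- by rewrite -RintegralD//; apply: eq_Rintegral => t _; rewrite cImD.
Qed.

Lemma cintZ D c h : measurable D -> cintegrable D h ->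
  cint D (fun t => c * h t) = c * cint D h.
Proof.
move=> mD [h1 h2].
have iZ (r : R) g : mu.-integrable D (EFin \o g) ->
    mu.-integrable D (EFin \o (fun t => r * g t)).
  exact: integrable_RZ.
apply: complexP; rewrite ?cReM ?cImM /=.
- rewrite -!RintegralZl// -RintegralB; try exact: iZ.
  by apply: eq_Rintegral => t _; rewrite cReM.
- exact: mD.
- rewrite -!RintegralZl// -RintegralD; try exact: iZ.
  by apply: eq_Rintegral => t _; rewrite cImM.
  exact: mD.
Qed.

Lemma cintN D h : measurable D -> cintegrable D h ->
  cint D (fun t => - h t) = - cint D h.
Proof.
move=> mD ih; rewrite -mulN1r -cintZ//.
by apply: eq_cint => t _; rewrite mulN1r.
Qed.

Lemma cintegrableN D h : measurable D -> cintegrable D h ->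
  cintegrable D (fun t => - h t).
Proof.
move=> mD /(@cintegrableZ D (-1) _ mD).
by apply: eq_cintegrable => // t _; rewrite mulN1r.
Qed.

Lemma cintB D h k : measurable D -> cintegrable D h -> cintegrable D k ->
  cint D (fun t => h t - k t) = cint D h - cint D k.
Proof.
move=> mD ih ik; rewrite cintD//; last exact: cintegrableN.
by rewrite cintN.
Qed.

(** After a rotation the modulus of the integral is the integral of a real part, which is pointwise
    at most the modulus of the integrand. *)
Lemma cint_le_cabs D h : measurable D -> cintegrable D h ->
  cabs (cint D h) <= Rintegral mu D (fun t => cabs (h t)).
Proof.
move=> mD ih; have [c c1 cE] := cabs_rotation (cint D h).
have -> : cabs (cint D h) = complex.Re (c * cint D h) by rewrite cE.
rewrite -cintZ//=; apply: le_Rintegral => //.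
- by have [] := cintegrableZ c mD ih.
- exact: cintegrable_cabs.
- by move=> t Dt; rewrite (le_trans (Re_le_cabs _))// cabsM c1 mul1r.
Qed.

Lemma cint_le D h g : measurable D -> cintegrable D h ->
  mu.-integrable D (EFin \o g) -> (forall t, D t -> cabs (h t) <= g t) ->
  cabs (cint D h) <= Rintegral mu D g.
Proof.
move=> mD ih ig hg; rewrite (le_trans (cint_le_cabs mD ih))//.
by apply: le_Rintegral => //; exact: cintegrable_cabs.
Qed.

Lemma Rintegral_itv_cst (a b r : R) : a <= b ->
  Rintegral mu `[a, b] (fun=> r) = (b - a) * r.
Proof.
move=> ab; rewrite Rintegral_cst// mulrC; congr (_ * r).
have /= -> := @lebesgue_measure_itv R `[a, b]%R; rewrite lte_fin.
by case: ltgtP ab => [| |->]//=; rewrite subrr.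
Qed.

Lemma cint_cst (a b : R) c : a <= b -> cint `[a, b] (fun=> c) = (b - a)%:C%C * c.
Proof.
move=> ab; apply: complexP; rewrite ?cReM ?cImM /= Rintegral_itv_cst//.
- by rewrite mul0r subr0.
- by rewrite mul0r addr0.
Qed.

Lemma integrable_itv_cst (a b M : R) : mu.-integrable `[a, b] (EFin \o cst M).
Proof.
apply: continuous_compact_integrable; first exact: segment_compact.
by move=> x; exact: cst_continuous.
Qed.

Lemma cint_itv_le (a b M : R) h : a <= b -> cintegrable `[a, b] h ->
  (forall t, a <= t <= b -> cabs (h t) <= M) ->
  cabs (cint `[a, b] h) <= (b - a) * M.
Proof.
move=> ab ih hM.
rewrite -Rintegral_itv_cst//; apply: cint_le => //; first exact: integrable_itv_cst.
Qed.

Lemma cintegrable_itv (a b : R) h : (forall t, a <= t <= b -> pcont h t) ->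
  cintegrable `[a, b] h.
Proof.
move=> H; split; apply: continuous_compact_integrable;
  try exact: segment_compact; apply: continuous_in_subspaceT => t /set_mem;
  rewrite /= in_itv/= => /H.
- exact: pcont_Re.
- exact: pcont_Im.
Qed.

Lemma cint_itv_split (a b c : R) h : a <= b -> b <= c ->
  cintegrable `[a, c] h ->
  cint `[a, c] h = cint `[a, b] h + cint `[b, c] h.
Proof.
move=> ab bc [h1 h2].
have E g : mu.-integrable `[a, c] (EFin \o g) ->
    Rintegral mu `[a, c] g = Rintegral mu `[a, b] g + Rintegral mu `[b, c] g.
  move=> ig; have := @Rintegral_itvB _ g (BLeft a) (BRight c) b ig.
  rewrite !bnd_simp => /(_ ab bc) /eqP; rewrite subr_eq addrC => /eqP ->.
  congr (_ + _); apply: Rintegral_itv_obnd_cbnd.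
  by apply: integrableS ig => //; apply: subset_itvr; rewrite bnd_simp.
by apply: complexP; rewrite ?cReD ?cImD /=; exact: E.
Qed.

Lemma Rintegral_dominated0 D (f_ : nat -> R -> R) g : measurable D ->
  (forall n, measurable_fun D (f_ n)) -> mu.-integrable D (EFin \o g) ->
  (forall n t, D t -> 0 <= f_ n t <= g t) ->
  (forall t, D t -> forall e : R, 0 < e -> exists N, forall n, (N <= n)%N -> f_ n t < e) ->
  forall e : R, 0 < e -> exists N, forall n, (N <= n)%N -> Rintegral mu D (f_ n) < e.
Proof.
move=> mD mf ig fg f0 e e0.
have [] := @dominated_convergence _ _ _ mu D mD (fun n => EFin \o f_ n) (cst 0%E)
  (EFin \o g).
- by move=> n; apply/measurable_EFinP; exact: mf.
- exact: measurable_cst.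
- apply: aeW => t Dt /=; apply: cvg_EFin; first exact: nearW.
  apply/cvgrPdist_lt => r r0; have [N HN] := f0 t Dt r r0.
  exists N => // n /= Nn; rewrite sub0r normrN ger0_norm; first exact: HN.
  by have /andP[] := fg n t Dt.
- exact: ig.
- apply: aeW => t n Dt /=; rewrite lee_fin ger0_norm; by have /andP[] := fg n t Dt.
move=> _ _; rewrite integral0 => /fine_cvgP[_ /cvgrPdist_lt/(_ e e0)[N _ HN]].
exists N => n Nn; have := HN n Nn; rewrite /= sub0r normrN; apply: le_lt_trans.
exact: ler_norm.
Qed.

Lemma cint_dominated D (h_ : nat -> R -> R[i]) h g : measurable D ->
  (forall n, cmeas D (h_ n)) -> cmeas D h -> mu.-integrable D (EFin \o g) ->
  (forall n t, D t -> cabs (h_ n t) <= g t) -> (forall t, D t -> cabs (h t) <= g t) ->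
  (forall t, D t -> forall e : R, 0 < e -> exists N, forall n, (N <= n)%N ->
    cabs (h_ n t - h t) < e) ->
  forall e : R, 0 < e -> exists N, forall n, (N <= n)%N ->
    cabs (cint D (h_ n) - cint D h) < e.
Proof.
move=> mD mh_ mh ig hg_ hg hc e e0.
have ih_ n : cintegrable D (h_ n).
  exact: cintegrable_dom ig (hg_ n).
have ih : cintegrable D h by exact: cintegrable_dom ig hg.
have ig2 : mu.-integrable D (EFin \o (fun t => 2 * g t)) by exact: integrable_RZ.
have [|n t Dt|//|N HN] := @Rintegral_dominated0 D (fun n t => cabs (h_ n t - h t)) _ mD _ ig2 _ _ e e0.
- by move=> n; apply: cmeas_cabs; exact: cmeasB.
- rewrite cabs_ge0 /= (le_trans (cabsB _ _))// mulr_natl mulr2n.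
  by rewrite lerD ?hg_ ?hg.
exists N => n Nn; rewrite -cintB//.
apply: le_lt_trans (HN n Nn); apply: cint_le_cabs => //.
exact: cintegrableB.
Qed.

End ComplexIntegral.

(** * Goursat's theorem *)

Section Goursat.
Context {R : realType}.
Implicit Types (f g : R[i] -> R[i]) (a b c d : R).

(* Boundary integral over [a, b] x [c, d]; opposite sides are grouped so that
   affine functions reduce to constant integrands. *)
Definition rect_int f a b c d : R[i] :=
  cint `[a, b] (fun s => f (Complex s c) - f (Complex s d)) +
  Complex 0 1 * cint `[c, d] (fun t => f (Complex b t) - f (Complex a t)).

Definition rect_cont f a b c d :=
  forall s t, a <= s <= b -> c <= t <= d -> ccontinuous_at f (Complex s t).

Lemma pcontB (h k : R -> R[i]) t : pcont h t -> pcont k t ->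
  pcont (fun s => h s - k s) t.
Proof.
move=> H K e e0; have e2 : 0 < e / 2 by rewrite divr_gt0.
have [d1 d10 H1] := H _ e2; have [d2 d20 H2] := K _ e2.
exists (Num.min d1 d2); first by rewrite lt_min d10.
move=> s; rewrite lt_min => /andP[s1 s2].
have -> : h s - k s - (h t - k t) = (h s - h t) - (k s - k t) by ring.
rewrite (le_lt_trans (cabsB _ _))// [e]splitr.
by rewrite ltrD ?H1 ?H2.
Qed.

Lemma rect_hintegrable f a b c d : rect_cont f a b c d -> c <= d ->
  cintegrable `[a, b] (fun s => f (Complex s c) - f (Complex s d)).
Proof.
move=> H cd; apply: cintegrable_itv => t tab.
by apply: pcontB; apply: pcont_hline; apply: H => //; rewrite lexx ?andbT.
Qed.

Lemma rect_vintegrable f a b c d : rect_cont f a b c d -> a <= b ->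
  cintegrable `[c, d] (fun t => f (Complex b t) - f (Complex a t)).
Proof.
move=> H cd; apply: cintegrable_itv => t tab.
by apply: pcontB; apply: pcont_vline; apply: H => //; rewrite lexx ?andbT.
Qed.

Lemma rect_contS f a b c d a' b' c' d' : a <= a' -> b' <= b -> c <= c' -> d' <= d ->
  rect_cont f a b c d -> rect_cont f a' b' c' d'.
Proof.
move=> aa bb cc dd H s t /andP[s1 s2] /andP[t1 t2].
apply: H; first by rewrite (le_trans aa)//= (le_trans _ bb).
by rewrite (le_trans cc)//= (le_trans _ dd).
Qed.

Lemma rect_int_splitv f a b c d m : a <= m -> m <= b -> c <= d ->
  rect_cont f a b c d ->
  rect_int f a b c d = rect_int f a m c d + rect_int f m b c d.
Proof.
move=> am mb cd H; rewrite /rect_int (cint_itv_split am mb); last exact: rect_hintegrable.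
have -> : cint `[c, d] (fun t => f (Complex b t) - f (Complex a t)) =
    cint `[c, d] (fun t => f (Complex m t) - f (Complex a t)) +
    cint `[c, d] (fun t => f (Complex b t) - f (Complex m t)).
  rewrite -cintD//.
  - by apply: eq_cint => t _; ring.
  - by apply: rect_vintegrable => //; exact: rect_contS H.
  - by apply: rect_vintegrable => //; exact: rect_contS H.
ring.
Qed.

Lemma rect_int_splith f a b c d m : c <= m -> m <= d -> a <= b ->
  rect_cont f a b c d ->
  rect_int f a b c d = rect_int f a b c m + rect_int f a b m d.
Proof.
move=> cm md ab H; rewrite /rect_int (cint_itv_split cm md); last exact: rect_vintegrable.
have -> : cint `[a, b] (fun s => f (Complex s c) - f (Complex s d)) =
    cint `[a, b] (fun s => f (Complex s c) - f (Complex s m)) +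
    cint `[a, b] (fun s => f (Complex s m) - f (Complex s d)).
  rewrite -cintD//.
  - by apply: eq_cint => t _; ring.
  - by apply: rect_hintegrable => //; exact: rect_contS H.
  - by apply: rect_hintegrable => //; exact: rect_contS H.
ring.
Qed.

(** The affine function [u + v * z] has boundary integral zero: its two constant integrands cancel.
    What remains is the remainder of size [M], and grouping opposite sides gives the factor 2. *)
Lemma rect_int_le f a b c d (u v : R[i]) M : a <= b -> c <= d ->
  rect_cont f a b c d ->
  (forall s t, a <= s <= b -> c <= t <= d ->
    cabs (f (Complex s t) - (u + v * Complex s t)) <= M) ->
  cabs (rect_int f a b c d) <= 2 * M * ((b - a) + (d - c)).
Proof.
move=> ab cd H HM.
pose r z := f z - (u + v * z).
pose h1 s := r (Complex s c) - r (Complex s d).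
pose h2 t := r (Complex b t) - r (Complex a t).
have e1 s : f (Complex s c) - f (Complex s d) = h1 s + v * Complex 0 (c - d).
  have -> : Complex 0 (c - d) = Complex s c - Complex s d.
    by apply: complexP; rewrite !ReImE /= ?subrr.
  by rewrite /h1 /r; ring.
have e2 t : f (Complex b t) - f (Complex a t) = h2 t + v * Complex (b - a) 0.
  have -> : Complex (b - a) 0 = Complex b t - Complex a t.
    by apply: complexP; rewrite !ReImE /= ?subrr.
  by rewrite /h2 /r; ring.
have ic (x y : R) (w : R[i]) : cintegrable `[x, y] (fun=> w).
  by apply: cintegrable_itv => t _ e e0; exists 1 => // s _; rewrite subrr cabs0.
have i1 : cintegrable `[a, b] h1.
  apply: eq_cintegrable (cintegrableB (measurable_itv _) (rect_hintegrable H cd)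
    (ic a b (v * Complex 0 (c - d)))) => //.
  by move=> t _; rewrite e1 addrK.
have i2 : cintegrable `[c, d] h2.
  apply: eq_cintegrable (cintegrableB (measurable_itv _) (rect_vintegrable H ab)
    (ic c d (v * Complex (b - a) 0))) => //.
  by move=> t _; rewrite e2 addrK.
have -> : rect_int f a b c d = cint `[a, b] h1 + Complex 0 1 * cint `[c, d] h2.
  rewrite /rect_int (eq_cint (k := fun s => h1 s + v * Complex 0 (c - d))); last by move=> s _.
  rewrite [cint `[c, d] _](eq_cint (k := fun t => h2 t + v * Complex (b - a) 0)); last by move=> s _.
  rewrite (cintD (measurable_itv _) i1 (ic _ _ _)) (cintD (measurable_itv _) i2 (ic _ _ _)).
  rewrite !cint_cst//.
  have -> : Complex 0 (c - d) = - (Complex 0 1 * (d - c)%:C%C).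
    by apply: complexP; rewrite !ReImE /=; ring.
  have -> : Complex (b - a) 0 = (b - a)%:C%C by [].
  ring.
have M2 x y : cabs (r x) <= M -> cabs (r y) <= M -> cabs (r x - r y) <= 2 * M.
  by move=> rx ry; rewrite (le_trans (cabsB _ _))// mulr_natl mulr2n lerD.
rewrite (le_trans (cabsD _ _))// cabsM cabs_imag normr1 mul1r mulrDr.
rewrite lerD// mulrC; apply: cint_itv_le => //.
- by move=> t tab; apply: M2; apply: HM => //; rewrite lexx ?andbT.
- by move=> t tab; apply: M2; apply: HM => //; rewrite lexx ?andbT.
Qed.

Lemma nested_intervals (u v : nat -> R) : (forall n, u n <= u n.+1) ->
  (forall n, v n.+1 <= v n) -> (forall n, u n <= v n) ->
  exists p, forall n, u n <= p <= v n.
Proof.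
move=> uu vv uv.
have um m n : (m <= n)%N -> u m <= u n by exact: (homo_leq (@lexx _ _) (@le_trans _ _)).
have vm m n : (m <= n)%N -> v n <= v m.
  move=> mn; have := @homo_leq _ (fun n => - v n) <=%R (@lexx _ _) (@le_trans _ _).
  move=> /(_ _ m n mn) H; rewrite -lerN2; apply: H => k; by rewrite lerN2.
have ub m n : u m <= v n.
  have [mn|/ltnW mn] := leqP m n; first exact: le_trans (um _ _ mn) (uv n).
  exact: le_trans (uv m) (vm _ _ mn).
exists (sup (range u)) => n; apply/andP; split.
- apply: ub_le_sup; last by exists n.
  by exists (v 0%N) => _ [m _ <-].
- apply: ge_sup; first by exists (u 0%N), 0%N.
  by move=> _ [m _ <-].
Qed.

#[local] Arguments rect_int : simpl never.

Section Bisection.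
Variables (f : R[i] -> R[i]) (a0 b0 l k e : R).
Hypotheses (l0 : 0 <= l) (k0 : 0 <= k) (e0 : 0 < e).
Hypothesis cf : rect_cont f a0 (a0 + l) b0 (b0 + k).

(** The threshold shrinks like the area of the rectangle, by a factor 4 at each bisection of both
    sides. *)
Let bad n (p : R * R) := e / 4 ^+ n <
  cabs (rect_int f p.1 (p.1 + l / 2 ^+ n) p.2 (p.2 + k / 2 ^+ n)).

Let inside n (p : R * R) :=
  [/\ a0 <= p.1, p.1 + l / 2 ^+ n <= a0 + l, b0 <= p.2 & p.2 + k / 2 ^+ n <= b0 + k].

Let nxt n (p : R * R) : R * R :=
  let x := p.1 + l / 2 ^+ n.+1 in let y := p.2 + k / 2 ^+ n.+1 in
  if bad n.+1 p then p else if bad n.+1 (x, p.2) then (x, p.2)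
  else if bad n.+1 (p.1, y) then (p.1, y) else (x, y).

Let half (r : R) n : r / 2 ^+ n = r / 2 ^+ n.+1 + r / 2 ^+ n.+1.
Proof. by rewrite exprS; field; rewrite expf_neq0. Qed.

Let pos (r : R) n : 0 <= r -> 0 <= r / 2 ^+ n.
Proof. by move=> r0; rewrite divr_ge0// exprn_ge0. Qed.

(** The integrals over the four quarters add up to the integral over the rectangle, so they cannot
    all be at most [e / 4 ^+ n.+1]. When the first three are not bad the fourth, the default of
    [nxt], must be. *)
Let nxt_bad n p : bad n p -> inside n p -> bad n.+1 (nxt n p).
Proof.
move=> bp [h1 h2 h3 h4]; rewrite /nxt.
case: ifP => // /negbT b1; case: ifP => // /negbT b2; case: ifP => // /negbT b3.
apply: contraTT bp => b4.
rewrite /bad -leNgt.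
have lp := pos n.+1 l0; have kp := pos n.+1 k0.
have hl := half l n; have hk := half k n.
have C1 : rect_cont f p.1 (p.1 + l / 2 ^+ n) p.2 (p.2 + k / 2 ^+ n).
  exact: rect_contS cf.
rewrite (@rect_int_splitv _ _ _ _ _ (p.1 + l / 2 ^+ n.+1))//; last 3 first.
- by lra.
- by lra.
- by lra.
rewrite (@rect_int_splith _ _ (p.1 + l / 2 ^+ n.+1) _ _ (p.2 + k / 2 ^+ n.+1)); last 4 first.
- by lra.
- by lra.
- by lra.
- by apply: rect_contS C1 => //; lra.
rewrite (@rect_int_splith _ (p.1 + l / 2 ^+ n.+1) _ _ _ (p.2 + k / 2 ^+ n.+1)); last 4 first.
- by lra.
- by lra.
- by lra.
- by apply: rect_contS C1 => //; lra.
move: b1 b2 b3 b4; rewrite /bad -!leNgt {}/fst {}/snd => b1 b2 b3 b4.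
rewrite (half l n) (half k n) (addrA p.1) (addrA p.2).
have -> : e / 4 ^+ n = e / 4 ^+ n.+1 + e / 4 ^+ n.+1 + (e / 4 ^+ n.+1 + e / 4 ^+ n.+1).
  by rewrite exprS; field; rewrite expf_neq0.
apply: le_trans (cabsD _ _) _; apply: lerD; apply: le_trans (cabsD _ _) _;
  exact: lerD.
Qed.

Let nxt1 n p : p.1 <= (nxt n p).1 /\ (nxt n p).1 + l / 2 ^+ n.+1 <= p.1 + l / 2 ^+ n.
Proof.
have lp := pos n.+1 l0.
by rewrite /nxt; repeat case: ifP => _ /=; rewrite (half l n); split; lra.
Qed.

Let nxt2 n p : p.2 <= (nxt n p).2 /\ (nxt n p).2 + k / 2 ^+ n.+1 <= p.2 + k / 2 ^+ n.
Proof.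
have kp := pos n.+1 k0.
by rewrite /nxt; repeat case: ifP => _ /=; rewrite (half k n); split; lra.
Qed.

Let nxt_inside n p : inside n p -> inside n.+1 (nxt n p).
Proof.
move=> [h1 h2 h3 h4]; have [x1 x2] := nxt1 n p; have [y1 y2] := nxt2 n p.
split; [exact: le_trans x1|exact: le_trans h2|exact: le_trans y1|exact: le_trans h4].
Qed.

Hypothesis df : forall s t, a0 <= s <= a0 + l -> b0 <= t <= b0 + k ->
  exists m, hasD f (Complex s t) m.

Lemma rect_int_small : cabs (rect_int f a0 (a0 + l) b0 (b0 + k)) <= e.
Proof.
rewrite leNgt; apply/negP => E.
pose p := fix F n := if n is n'.+1 then nxt n' (F n') else (a0, b0).
have I n : inside n (p n).
  elim: n => [|n IH] /=; last exact: nxt_inside.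
  by split => //=; rewrite expr0 divr1.
have B n : bad n (p n).
  elim: n => [|n IH] /=; last exact: nxt_bad.
  by rewrite /bad /= !expr0 !divr1.
have [x Hx] := @nested_intervals (fun n => (p n).1) (fun n => (p n).1 + l / 2 ^+ n)
  (fun n => (nxt1 n (p n)).1) (fun n => (nxt1 n (p n)).2)
  (fun n => ltac:(rewrite lerDl; exact: pos)).
have [y Hy] := @nested_intervals (fun n => (p n).2) (fun n => (p n).2 + k / 2 ^+ n)
  (fun n => (nxt2 n (p n)).1) (fun n => (nxt2 n (p n)).2)
  (fun n => ltac:(rewrite lerDl; exact: pos)).
have [||m Hm] := @df x y.
- by have := Hx 0%N; rewrite /= expr0 divr1.
- by have := Hy 0%N; rewrite /= expr0 divr1.
(* With slope error [e / q], [rect_int_le] bounds the n-th integral by [2 (e / q) (l + k)^2 / 4^n],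
   below the threshold for bad. The summand 1 keeps [q] positive for a degenerate rectangle. *)
pose q := 2 * (l + k) ^+ 2 + 1.
have q0 : 0 < q by rewrite /q ltr_wpDl// mulr_ge0// sqr_ge0.
have [d d0 Hd] := Hm (e / q) (divr_gt0 e0 q0).
have [n Hn] : exists n, (l + k) / 2 ^+ n < d.
  have [n nd] : exists n, (l + k) / d < n%:R.
    exists (Num.bound ((l + k) / d)).
    by rewrite archi_boundP// divr_ge0// ?addr_ge0// ltW.
  exists n; rewrite ltr_pdivrMr ?exprn_gt0// mulrC -ltr_pdivrMr//.
  by rewrite (lt_trans nd)// -natrX ltr_nat ltn_expl.
have := B n; rewrite /bad ltNge => /negP; apply.
have [h1 h2 h3 h4] := I n.
have sm (s t : R) : (p n).1 <= s <= (p n).1 + l / 2 ^+ n ->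
    (p n).2 <= t <= (p n).2 + k / 2 ^+ n ->
    cabs (Complex s t - Complex x y) <= (l + k) / 2 ^+ n.
  move=> /andP[s1 s2] /andP[t1 t2].
  have /andP[x1 x2] := Hx n; have /andP[y1 y2] := Hy n.
  rewrite (le_trans (cabs_ReIm _))// !ReImE /= mulrDl.
  by rewrite lerD// ler_norml; apply/andP; split; lra.
have M s t : (p n).1 <= s <= (p n).1 + l / 2 ^+ n ->
    (p n).2 <= t <= (p n).2 + k / 2 ^+ n ->
    cabs (f (Complex s t) - ((f (Complex x y) - m * Complex x y) + m * Complex s t))
      <= e / q * ((l + k) / 2 ^+ n).
  move=> Hs Ht; have H := sm s t Hs Ht.
  have := Hd _ (le_lt_trans H Hn); rewrite (addrC (Complex x y)) subrK.
  have -> : f (Complex s t) - (f (Complex x y) - m * Complex x y + m * Complex s t) =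
    f (Complex s t) - f (Complex x y) - m * (Complex s t - Complex x y) by ring.
  move=> H'; rewrite (le_trans H')// ler_wpM2l// ltW// divr_gt0//.
have C1 : rect_cont f (p n).1 ((p n).1 + l / 2 ^+ n) (p n).2 ((p n).2 + k / 2 ^+ n).
  exact: rect_contS cf.
have := rect_int_le _ _ C1 M; rewrite !lerDl !pos// => /(_ isT isT) H.
apply: le_trans H _.
rewrite -!addrA [X in _ * X](_ : _ = (l + k) / 2 ^+ n); last by ring.
have -> : (4 : R) ^+ n = 2 ^+ n * 2 ^+ n by rewrite -exprMn; congr (_ ^+ _); ring.
have -> : 2 * (e / q * ((l + k) / 2 ^+ n)) * ((l + k) / 2 ^+ n) =
  e / (2 ^+ n * 2 ^+ n) * ((2 * (l + k) ^+ 2) / q).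
  by field; rewrite expf_neq0// gt_eqF.
rewrite ler_piMr//; first by rewrite divr_ge0 ?ltW// mulr_gt0// exprn_gt0.
by rewrite ler_pdivrMr// mul1r /q lerDl.
Qed.

End Bisection.

Theorem Goursat f a b c d : a <= b -> c <= d ->
  (forall s t, a <= s <= b -> c <= t <= d -> exists m, hasD f (Complex s t) m) ->
  rect_int f a b c d = 0.
Proof.
move=> ab cd H; apply/eqP; rewrite -cabs_eq0 eq_le cabs_ge0 andbT.
apply/ler_addgt0Pl => e e0; rewrite addr0.
have bE : b = a + (b - a) by rewrite addrC subrK.
have dE : d = c + (d - c) by rewrite addrC subrK.
rewrite bE dE; apply: rect_int_small; rewrite ?subr_ge0// -?bE -?dE//.
by move=> s t Hs Ht; have [m /hasD_continuous] := H s t Hs Ht.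
Qed.

End Goursat.

(** * Cauchy and Poisson formulas on vertical lines *)

(** The Poisson kernel of a half-plane at distance [d] from its boundary, without the factor
    [1 / pi]: its total mass is [pi]. *)
Definition pker (R : realType) (d b : R) : R := d / (d ^+ 2 + b ^+ 2).

(** Integration is against [db], so this is the contour integral divided by [i]; constants [2 pi]
    appear below in place of [2 pi i]. *)
Definition vint (R : realType) (a : R) (G : R[i] -> R[i]) : R[i] :=
  cint [set: R] (fun b => G (Complex a b)).

Section Kernels.
Context {R : realType}.
Notation mu := (@lebesgue_measure R).
Notation Rpos := (`]0%R, +oo[ : set R).

Lemma integralT_oneDsqr : (\int[mu]_x ((1 + x ^+ 2)^-1)%:E = pi%:E)%E.
Proof.
rewrite (@ge0_symfun_integralT R (fun x => (1 + x ^+ 2)^-1)).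
- have -> : [set x : R | 0 <= x] = `[0, +oo[ by rewrite set_itvE.
  have /= -> := @integral0y_oneDsqr R.
  by rewrite -EFinM; congr (_%:E); rewrite mulrCA divff// mulr1.
- by move=> x; rewrite invr_ge0 addr_ge0// sqr_ge0.
- by move=> x; exact: continuous_oneDsqrV.
- by move=> x /=; rewrite sqrrN.
Qed.

Lemma pker_ge0 (d b : R) : 0 <= d -> 0 <= pker d b.
Proof. by move=> d0; rewrite /pker divr_ge0// addr_ge0// sqr_ge0. Qed.

Lemma is_derive_affine (d y x : R) : is_derive x 1 (fun b => (b - y) / d) d^-1.
Proof.
have -> : (fun b : R => (b - y) / d) = d^-1 \*: (fun b => b - y).
  by apply/funext => b; rewrite /GRing.scale/= mulrC.
apply: (is_derive_eq (is_deriveZ _ (is_deriveB (is_derive_id _ _) (is_derive_cst _ _ _)))).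
by rewrite subr0 /GRing.scale/= mulr1.
Qed.

Lemma integral_pker (d y : R) : 0 < d ->
  (\int[mu]_b (pker d (b - y))%:E = pi%:E)%E.
Proof.
move=> d0; rewrite -integralT_oneDsqr.
pose F := fun b : R => (b - y) / d.
have F1 : F^`() = cst d^-1.
  by apply/funext => x; rewrite derive1E; apply: derive_val; exact: is_derive_affine.
rewrite (@increasing_ge0_integration_by_substitutionT R F (fun x => (1 + x ^+ 2)^-1)).
- apply: eq_integral => b _; rewrite F1 /= /pker /F; congr (_%:E).
  rewrite -[RHS]/((1 + ((b - y) / d) ^+ 2)^-1 * d^-1).
  have d2 : d ^+ 2 + (b - y) ^+ 2 != 0.
    by rewrite gt_eqF// ltr_pwDl// ?exprn_gt0// sqr_ge0.
  by field; rewrite gt_eqF//= d2.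
- by move=> u v uv; rewrite /F ltr_pM2r ?invr_gt0// ltrD2r.
- by rewrite F1 => x; exact: cst_continuous.
- by rewrite F1; exact: is_cvg_cst.
- by rewrite F1; exact: is_cvg_cst.
- by move=> x; case: (is_derive_affine d y x).
- apply/cvgrNyPle => A; exists (A * d + y); split; first exact: num_real.
  by move=> x xA; rewrite /F ler_pdivrMr// lerBlDr ltW.
- apply/cvgryPge => A; exists (A * d + y); split; first exact: num_real.
  by move=> x xA; rewrite /F ler_pdivlMr// lerBrDr ltW.
- by move=> x; exact: continuous_oneDsqrV.
- by move=> x; rewrite invr_ge0 addr_ge0// sqr_ge0.
Qed.

Lemma measurable_pker (d y : R) : 0 < d -> measurable_fun setT (fun b : R => pker d (b - y)).
Proof.
move=> d0; apply: continuous_measurable_fun => x; rewrite /pker.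
apply: cvgM; first exact: cvg_cst.
apply: cvgV; first by rewrite gt_eqF// ltr_pwDl ?exprn_gt0// sqr_ge0.
apply: cvgD; first exact: cvg_cst.
by apply: cvgM; (apply: cvgB; [exact: cvg_id|exact: cvg_cst]).
Qed.

Lemma integrable_pker (d y : R) : 0 < d ->
  mu.-integrable setT (EFin \o (fun b => pker d (b - y))).
Proof.
move=> d0; apply/integrableP; split.
  by apply/measurable_EFinP; exact: measurable_pker.
under eq_integral => b _.
  rewrite /= ger0_norm; last by rewrite pker_ge0// ltW.
  over.
by rewrite integral_pker// ltry.
Qed.

Lemma Rintegral_pker (d y : R) : 0 < d ->
  Rintegral mu setT (fun b => pker d (b - y)) = pi.
Proof. by move=> d0; rewrite /Rintegral integral_pker. Qed.

(** A kernel of mass one on the positive half-line. The derivative of [r_z] is [- r_z^2], so with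
    [c = Re z] this is the shape of all bounds on derivatives of resolvent functions. *)
Definition hker (c s : R) : R := c / (c + s) ^+ 2.

Lemma hker_ge0 c s : 0 <= c -> 0 <= hker c s.
Proof. by move=> c0; rewrite /hker divr_ge0// sqr_ge0. Qed.

Lemma hker_continuous c s : 0 < c + s -> {for s, continuous (hker c)}.
Proof.
move=> cs; rewrite /hker; apply: cvgM; first exact: cvg_cst.
apply: cvgV; first by rewrite gt_eqF// exprn_gt0.
by apply: cvgM; (apply: cvgD; [exact: cvg_cst|exact: cvg_id]).
Qed.

Lemma integral_hker (c : R) : 0 < c ->
  (\int[mu]_(s in Rpos) (hker c s)%:E = 1%:E)%E.
Proof.
move=> c0.
have mh : measurable_fun Rpos (EFin \o hker c).
  apply/measurable_EFinP; apply: open_continuous_measurable_fun => //.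
  move=> s; rewrite inE/= in_itv/= andbT => s0.
  by apply: hker_continuous; rewrite addr_gt0.
rewrite integral_itv_obnd_cbnd//.
have dF (s : R) : 0 < c + s -> is_derive s 1 (fun s => - c / (c + s)) (hker c s).
  move=> cs.
  have E : is_derive s 1 (fun s : R => c + s) 1.
    apply: (is_derive_eq (is_deriveD (is_derive_cst _ _ _) (is_derive_id _ _))).
    by rewrite add0r.
  have csn : c + s != 0 by rewrite gt_eqF.
  split.
    by apply: derivableM; [exact: derivable_cst|apply: derivableV => //; case: E].
  rewrite deriveM; [|exact: derivable_cst|by apply: derivableV => //; case: E].
  rewrite derive_cst scaler0 addr0 deriveV//.
  case: E => _ ->; rewrite /GRing.scale/= /hker; by field.
rewrite (@ge0_continuous_FTC2y R (hker c) (fun s => - c / (c + s)) 0 0).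
- by rewrite addr0 mulNr divff ?gt_eqF// -EFinB opprK add0r.
- by move=> s _; rewrite hker_ge0// ltW.
- apply: continuous_in_subspaceT => s /set_mem /=; rewrite in_itv/= andbT => s0.
  by apply: hker_continuous; rewrite ltr_wpDr.
- rewrite -(mulr0 (- c)); apply: cvgM; first exact: cvg_cst.
  apply/cvgrPdist_lt => e e0; exists e^-1; split; first exact: num_real.
  move=> x xe; have x0 : 0 < x by rewrite (lt_trans _ xe)// invr_gt0.
  rewrite sub0r normrN gtr0_norm ?invr_gt0 ?addr_gt0//.
  by rewrite invf_plt ?posrE ?addr_gt0// (lt_trans xe)// ltrDr.
- by move=> s s0; case: (dF s); rewrite // addr_gt0.
- have : {for 0, continuous (fun s : R => - c / (c + s))}.
    apply: differentiable_continuous; apply/derivable1_diffP.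
    by case: (dF 0); rewrite // addr0.
  by move=> /cvg_at_right_filter.
- move=> s; rewrite in_itv/= andbT => s0.
  by rewrite derive1E; apply: derive_val; apply: dF; rewrite addr_gt0.
Qed.

Lemma measurable_hker (c : R) : 0 < c -> measurable_fun Rpos (hker c).
Proof.
move=> c0; apply: open_continuous_measurable_fun => //.
move=> s; rewrite inE/= in_itv/= andbT => s0.
by apply: hker_continuous; rewrite addr_gt0.
Qed.

Lemma integrable_hker c : 0 < c -> mu.-integrable Rpos (EFin \o hker c).
Proof.
move=> c0; apply/integrableP; split.
  by apply/measurable_EFinP; exact: measurable_hker.
under eq_integral => b _.
  rewrite /= ger0_norm; last by rewrite hker_ge0// ltW.
  over.
by rewrite integral_hker// ltry.
Qed.

Lemma Rintegral_hker c : 0 < c -> Rintegral mu Rpos (hker c) = 1.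
Proof. by move=> c0; rewrite /Rintegral integral_hker. Qed.

Lemma cint_mkcond (D : set R) h :
  cint D h = cint setT (fun t => if t \in D then h t else 0).
Proof.
rewrite /cint; congr Complex; rewrite Rintegral_mkcond;
  by apply: eq_Rintegral => t _; rewrite patchE; case: ifP.
Qed.

Lemma cmeas_restrict (D : set R) h : measurable D -> cmeas D h ->
  cmeas setT (fun t => if t \in D then h t else 0).
Proof.
move=> mD [h1 h2]; split.
- have -> : (fun t => complex.Re (if t \in D then h t else 0)) =
      (fun t => complex.Re (h t)) \_ D.
    by apply/funext => t; rewrite patchE; case: ifP.
  exact/(measurable_restrictT _ mD).
- have -> : (fun t => complex.Im (if t \in D then h t else 0)) =
      (fun t => complex.Im (h t)) \_ D.
    by apply/funext => t; rewrite patchE; case: ifP.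
  exact/(measurable_restrictT _ mD).
Qed.

Lemma cint_trunc (h : R -> R[i]) : cintegrable setT h -> forall e : R, 0 < e ->
  exists N, forall n, (N <= n)%N ->
    cabs (cint `[- n%:R, n%:R] h - cint setT h) < e.
Proof.
move=> ih e e0.
have mh := cmeas_of_cintegrable ih.
have [||||||N HN] := @cint_dominated R setT
  (fun n t => if t \in (`[- n%:R, n%:R] : set R) then h t else 0) h
  (fun t => cabs (h t)) _ _ mh (cintegrable_cabs _ ih) _ _ _ e e0 => //.
- by move=> n; apply: cmeas_restrict => //; exact: cmeas_setT.
- by move=> n t _; case: ifP => // _; rewrite cabs0 cabs_ge0.
- move=> t _ r r0; exists (Num.bound `|t|) => n tn.
  rewrite ifT ?subrr ?cabs0// inE /= in_itv/= -ler_norml.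
  by rewrite (le_trans (ltW (archi_boundP (normr_ge0 t))))// ler_nat.
by exists N => n Nn; rewrite cint_mkcond; exact: HN.
Qed.

End Kernels.

(** * Contour shifting between vertical lines, with one exceptional point *)

Section VerticalLine.
Context {R : realType}.
Variables (G : R[i] -> R[i]) (a C : R) (q zeta : R[i]).
Hypothesis qa : complex.Re q < a.
Hypothesis C0 : 0 <= C.
Hypothesis Gc : forall w, a <= complex.Re w -> ccontinuous_at G w.
Hypothesis Gd : forall w, a <= complex.Re w -> w <> zeta -> exists m, hasD G w m.
Hypothesis Gb : forall w, a <= complex.Re w -> cabs (G w) <= C / cabs (w - q) ^+ 2.

Notation mu := (@lebesgue_measure R).

Let dist_gt0 s : a <= s -> 0 < s - complex.Re q.
Proof. by move=> h; rewrite subr_gt0 (lt_le_trans qa). Qed.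

Let bound0 s0 s b : a <= s0 -> s0 <= s -> cabs (G (Complex s b)) <=
  C / (s0 - complex.Re q) * pker (s0 - complex.Re q) (b - complex.Im q).
Proof.
move=> as0 s0s; have d0 := dist_gt0 as0.
rewrite (le_trans (Gb _))//=; first exact: le_trans s0s.
rewrite cabs_sqr !ReImE /= /pker mulrA divfK ?gt_eqF//.
rewrite ler_wpM2l// lef_pV2 ?posrE; last 2 first.
- by rewrite ltr_pwDl ?sqr_ge0// exprn_gt0// dist_gt0// (le_trans as0).
- by rewrite ltr_pwDl ?sqr_ge0// exprn_gt0.
by rewrite lerD2r lerXn2r ?nnegrE ?lerD2r// ltW// dist_gt0// (le_trans as0).
Qed.

Let meas0 s : a <= s -> cmeas setT (fun b => G (Complex s b)).
Proof. by move=> as0; apply: pcont_cmeasT => t; apply: pcont_vline; exact: Gc. Qed.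

Let ikernel s : a <= s -> mu.-integrable setT (EFin \o (fun b =>
  C / (s - complex.Re q) * pker (s - complex.Re q) (b - complex.Im q))).
Proof.
by move=> as0; apply: integrable_RZ => //; apply: integrable_pker; exact: dist_gt0.
Qed.

Let int0 s : a <= s -> cintegrable setT (fun b => G (Complex s b)).
Proof.
move=> as0; apply: (cintegrable_dom _ (meas0 as0) (ikernel (lexx a))) => //.
by move=> b _; exact: bound0.
Qed.

Lemma vint_le s : a <= s -> cabs (vint s G) <= C * pi / (s - complex.Re q).
Proof.
move=> as0; rewrite (le_trans (cint_le _ (int0 as0) (ikernel as0) _))//.
- by move=> b _; exact: bound0.
- rewrite RintegralZl//; last by apply: integrable_pker; exact: dist_gt0.
  by rewrite Rintegral_pker ?dist_gt0// mulrAC.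
Qed.

(** Goursat on tall rectangles: the vertical sides tend to the two integrals and the horizontal
    sides vanish by the quadratic decay. *)
Lemma vint_const s1 s2 : a <= s1 -> s1 <= s2 ->
  (forall w, s1 <= complex.Re w <= s2 -> exists m, hasD G w m) ->
  vint s2 G = vint s1 G.
Proof.
move=> as1 s12 Hd; apply/eqP; rewrite -subr_eq0 -cabs_eq0 eq_le cabs_ge0 andbT.
have as2 := le_trans as1 s12.
apply/ler_addgt0Pl => e e0; rewrite addr0.
pose h b := G (Complex s2 b) - G (Complex s1 b).
have ih : cintegrable setT h by apply: cintegrableB => //; exact: int0.
have hE : vint s2 G - vint s1 G = cint setT h by rewrite cintB//; exact: int0.
have e2 : 0 < e / 2 by rewrite divr_gt0.
have [N HN] := cint_trunc ih e2.
pose q2 : R := `|complex.Im q|.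
(* At height [n] the distance to [q] is at least [1 + M], so the two horizontal sides together
   contribute at most [(s2 - s1) (C + C) / (1 + M)], which this choice makes at most [e / 2]. *)
pose M := (s2 - s1) * (C + C) / (e / 2).
have M0 : 0 <= M.
  by apply: divr_ge0; [rewrite mulr_ge0 ?subr_ge0// addr_ge0|exact: ltW].
pose n := maxn N (Num.bound (q2 + 1 + M)).
have nM : q2 + 1 + M < n%:R.
  rewrite (lt_le_trans (archi_boundP _))//; first by rewrite addr_ge0// addr_ge0// /q2.
  by rewrite ler_nat leq_maxr.
have nn : - n%:R <= n%:R :> R by rewrite lerNl -subr_ge0 opprK addr_ge0.
have dn : 1 + M <= n%:R - q2 by lra.
have Gn s t : s1 <= s <= s2 -> n%:R <= `|t| -> cabs (G (Complex s t)) <= C / (1 + M).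
  move=> /andP[h1 h2] nt; rewrite (le_trans (Gb _))//=; first exact: le_trans h1.
  rewrite ler_wpM2l// lef_pV2 ?posrE ?ltr_pwDl//; last first.
    rewrite exprn_gt0// cabs_gt0 subr_eq0; apply/eqP => E.
    by have := dist_gt0 (le_trans as1 h1); rewrite -E /= subrr ltxx.
  have H : 1 + M <= cabs (Complex s t - q).
    apply: le_trans (cabs_Im _); rewrite !ReImE /=.
    apply: le_trans dn _; apply: le_trans (lerB_dist _ _); rewrite /q2; lra.
  by rewrite (le_trans H)// expr2 ler_peMr ?cabs_ge0// (le_trans _ H)// lerDl.
have E := @Goursat R G s1 s2 (- n%:R) n%:R s12 nn.
have {E} E : rect_int G s1 s2 (- n%:R) n%:R = 0.
  by apply: E => s t /= Hs Ht; exact: Hd.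
have R1 : cabs (cint `[- n%:R, n%:R] h) <= e / 2.
  have -> : cabs (cint `[- n%:R, n%:R] h) =
      cabs (cint `[s1, s2] (fun s => G (Complex s (- n%:R)) - G (Complex s n%:R))).
    move/eqP: E; rewrite /rect_int addr_eq0 => /eqP ->.
    by rewrite cabsN cabsM cabs_imag normr1 mul1r.
  rewrite (le_trans (cint_itv_le (M := (C + C) / (1 + M)) _ _ _))//.
  - apply: rect_hintegrable => // s t /andP[h1 h2] Ht.
    by apply: Gc; exact: le_trans h1.
  - move=> s Hs; rewrite (le_trans (cabsB _ _))// mulrDl lerD//.
      by apply: Gn => //; rewrite normrN ger0_norm.
    by apply: Gn => //; rewrite ger0_norm.
  - rewrite mulrA ler_pdivrMr ?ltr_pwDl//.
    have -> : (s2 - s1) * (C + C) = M * (e / 2) by rewrite divfK// gt_eqF.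
    by rewrite mulrC ler_wpM2l ?lerDr// ltW.
rewrite hE.
have -> : cint setT h = cint `[- n%:R, n%:R] h - (cint `[- n%:R, n%:R] h - cint setT h).
  by rewrite opprB addrC subrK.
rewrite (le_trans (cabsB _ _))// [e]splitr lerD// ltW// HN//.
exact: leq_maxl.
Qed.

Lemma vint_cvg (s_ : nat -> R) s : a <= s -> (forall n, a <= s_ n) ->
  (forall e : R, 0 < e -> exists N, forall n, (N <= n)%N -> `|s_ n - s| < e) ->
  forall e : R, 0 < e -> exists N, forall n, (N <= n)%N ->
    cabs (vint (s_ n) G - vint s G) < e.
Proof.
move=> as0 asn sn; apply: (cint_dominated _ _ _ (ikernel (lexx a))) => //.
- by move=> n; exact: meas0.
- exact: meas0.
- by move=> n t _; apply: bound0.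
- by move=> t _; apply: bound0.
- move=> t _ e e0.
  have [d d0 Hd] := pcont_hline (Gc (w := Complex s t) as0) e0.
  have [N HN] := sn d d0; exists N => n Nn.
  by apply: Hd; exact: HN.
Qed.

Let inv_small (r : R) : 0 < r -> forall e : R, 0 < e -> exists N, forall n, (N <= n)%N ->
  r / n.+1%:R < e.
Proof.
move=> r0 e e0; exists (Num.bound (r / e)) => n Nn.
rewrite ltr_pdivrMr// mulrC -ltr_pdivrMr//.
rewrite (lt_le_trans (archi_boundP _))//; first by rewrite divr_ge0 ?ltW.
by rewrite ler_nat (leq_trans Nn).
Qed.

Let right0 s : a <= s -> complex.Re zeta < s -> vint s G = 0.
Proof.
move=> as0 zs; apply/eqP; rewrite -cabs_eq0 eq_le cabs_ge0 andbT.
apply/ler_addgt0Pl => e e0; rewrite addr0.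
pose s' := s + C * pi / e.
have ss' : s <= s' by rewrite lerDl; apply: divr_ge0; [rewrite mulr_ge0// pi_ge0|exact: ltW].
rewrite -(@vint_const s s')//; last first.
  move=> w /andP[sw _]; apply: Gd; first exact: le_trans sw.
  by move=> E; move: zs; rewrite ltNge -E sw.
rewrite (le_trans (vint_le _))//; first exact: le_trans ss'.
rewrite ler_pdivrMr ?dist_gt0//; last exact: le_trans ss'.
rewrite [leRHS]mulrC -ler_pdivrMr// /s'; have := dist_gt0 as0; lra.
Qed.

Let limit0 s (s_ : nat -> R) : a <= s -> (forall n, a <= s_ n) ->
  (forall e : R, 0 < e -> exists N, forall n, (N <= n)%N -> `|s_ n - s| < e) ->
  forall v, (forall n, vint (s_ n) G = v) -> vint s G = v.
Proof.
move=> as0 asn sn v Hv; apply/eqP; rewrite eq_sym -subr_eq0 -cabs_eq0 eq_le cabs_ge0 andbT.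
apply/ler_addgt0Pl => e e0; rewrite addr0.
have [N HN] := vint_cvg as0 asn sn e0.
by rewrite -(Hv N) ltW// HN.
Qed.

(** To the right of [zeta] the integral is constant and tends to 0, so it vanishes. Dominated
    convergence carries the value 0 to the line through [zeta], and from there to the lines on its
    left, where the integral is again constant. Only continuity is available at [zeta]: this is the
    place of a difference quotient extended by its limit. *)
Lemma vint_eq0 : vint a G = 0.
Proof.
have sz : a <= complex.Re zeta -> vint (complex.Re zeta) G = 0.
  move=> az; apply: (limit0 (s_ := fun n => complex.Re zeta + 1 / n.+1%:R)) => //.
  - by move=> n; rewrite (le_trans az)// lerDl.
  - move=> e /(inv_small ltr01)[N HN]; exists N => n Nn.
    by rewrite addrAC subrr add0r ger0_norm// HN.
  - move=> n; apply: right0; first by rewrite (le_trans az)// lerDl.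
    by rewrite ltrDl.
have [az|az] := ltP a (complex.Re zeta); last first.
  by move: az; rewrite le_eqVlt => /orP[/eqP az|/right0]; [rewrite -az sz ?az|exact].
rewrite -sz ?ltW//; apply/esym.
pose d := complex.Re zeta - a.
have d0 : 0 < d by rewrite subr_gt0.
have dn n : d / n.+1%:R <= d by rewrite ler_piMr ?(ltW d0)// invf_le1// ler1n.
have an n : a <= complex.Re zeta - d / n.+1%:R by rewrite lerBrDr addrC -lerBrDr.
apply: (limit0 (s_ := fun n => complex.Re zeta - d / n.+1%:R)) => //; first exact: ltW.
- move=> e /(inv_small d0)[N HN]; exists N => n Nn.
  by rewrite addrAC subrr add0r normrN ger0_norm ?HN// divr_ge0 ?ltW.
- move=> n; apply: vint_const => //.
  move=> w /andP[aw ws]; apply: Gd => // E.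
  have P : 0 < d / n.+1%:R by rewrite divr_gt0.
  by move: ws; rewrite E lerBrDr gerDl leNgt P.
Qed.

End VerticalLine.

Section ComplexContinuity.
Context {R : realType}.
Implicit Types (f g : R[i] -> R[i]) (z : R[i]).

Lemma ccontinuousM f g z : ccontinuous_at f z -> ccontinuous_at g z ->
  ccontinuous_at (fun w => f w * g w) z.
Proof.
move=> cf cg e e0.
pose A := 1 + cabs (g z); pose B := 1 + cabs (f z).
have A0 : 0 < A by rewrite ltr_pwDl// cabs_ge0.
have B0 : 0 < B by rewrite ltr_pwDl// cabs_ge0.
have e2 : 0 < e / 2 by rewrite divr_gt0.
have [d1 d10 H1] := cf (e / 2 / A) (divr_gt0 e2 A0).
have [d2 d20 H2] := cg (e / 2 / B) (divr_gt0 e2 B0).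
have [d3 d30 H3] := cg 1 ltr01.
exists (Num.min d1 (Num.min d2 d3)); first by rewrite !lt_min d10 d20.
move=> w; rewrite !lt_min => /and3P[/H1 w1 /H2 w2 /H3 w3].
have -> : f w * g w - f z * g z = (f w - f z) * g w + f z * (g w - g z) by ring.
rewrite (le_lt_trans (cabsD _ _))// !cabsM [e]splitr.
have gA : cabs (g w) <= A.
  have -> : g w = (g w - g z) + g z by rewrite subrK.
  by rewrite (le_trans (cabsD _ _))// lerD2r ltW.
apply: ltr_leD.
  apply: (@le_lt_trans _ _ (cabs (f w - f z) * A)).
    by rewrite ler_wpM2l// cabs_ge0.
  by rewrite -ltr_pdivlMr.
apply: (@le_trans _ _ (B * cabs (g w - g z))).
  by rewrite ler_wpM2r ?cabs_ge0// lerDr.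
by rewrite mulrC -ler_pdivlMr// ltW.
Qed.

Lemma hasD_affine (q z : R[i]) : hasD (fun w => w - q) z 1.
Proof. by have := hasDB (hasD_id z) (hasD_cst q z); rewrite subr0. Qed.

Lemma hasD_inv2 (u v w : R[i]) : (w - u) * (w - v) != 0 ->
  exists m, hasD (fun w => ((w - u) * (w - v))^-1) w m.
Proof.
move=> n0; have := @hasDV _ (fun w => (w - u) * (w - v)) w _ n0
  (hasDM (hasD_affine u w) (hasD_affine v w)).
by eexists; eassumption.
Qed.

Lemma Re_dist_le (w q : R[i]) : `|complex.Re w - complex.Re q| <= cabs (w - q).
Proof. by rewrite -cReN -cReD; exact: cabs_Re. Qed.

End ComplexContinuity.

Section CauchyFormulas.
Context {R : realType}.
Notation mu := (@lebesgue_measure R).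
Variables (F : R[i] -> R[i]) (a K : R).
Hypothesis Fd : forall w, a <= complex.Re w -> exists m, hasD F w m.
Hypothesis FK : forall w, a <= complex.Re w -> cabs (F w) <= K.

Let K0 : 0 <= K.
Proof. by apply: le_trans (FK (w := Complex a 0) _); rewrite ?cabs_ge0/=. Qed.

Definition lineker (u : R[i]) (b : R) : R := (cabs (Complex a b - u) ^+ 2)^-1.

Lemma linekerE u b : complex.Re u <> a -> lineker u b =
  `|a - complex.Re u|^-1 * pker `|a - complex.Re u| (b - complex.Im u).
Proof.
move=> ua; have d0 : `|a - complex.Re u| != 0.
  by rewrite normr_eq0 subr_eq0; apply: contra_notN ua => /eqP ->.
rewrite /lineker cabs_sqr !ReImE /= /pker mulrA mulVf// mul1r.
by rewrite real_normK ?num_real.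
Qed.

Lemma integrable_lineker u : complex.Re u <> a ->
  mu.-integrable setT (EFin \o lineker u).
Proof.
move=> ua; have d0 : 0 < `|a - complex.Re u|.
  by rewrite normr_gt0 subr_eq0; apply: contra_notN ua => /eqP ->.
have := integrable_RZ (`|a - complex.Re u|^-1) (@measurableT _ _)
  (integrable_pker (complex.Im u) d0).
by apply: eq_integrable => // b _ /=; rewrite linekerE.
Qed.

Lemma Rintegral_lineker u : complex.Re u <> a ->
  Rintegral mu setT (lineker u) = pi / `|a - complex.Re u|.
Proof.
move=> ua; have d0 : 0 < `|a - complex.Re u|.
  by rewrite normr_gt0 subr_eq0; apply: contra_notN ua => /eqP ->.
have -> : Rintegral mu setT (lineker u) = Rintegral mu setT (fun b =>
    `|a - complex.Re u|^-1 * pker `|a - complex.Re u| (b - complex.Im u)).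
  by apply: eq_Rintegral => b _; exact: linekerE.
rewrite RintegralZl//; last exact: integrable_pker.
by rewrite Rintegral_pker// mulrC.
Qed.

(** Two poles give quadratic decay, so that boundedness of [F] is enough for absolute convergence.
    The case [u = v] is the kernel of the derivative. *)
Definition kernel2 u v (w : R[i]) : R[i] := F w / ((w - u) * (w - v)).

Lemma kernel2_hasD u v w : a <= complex.Re w -> w != u -> w != v ->
  exists m, hasD (kernel2 u v) w m.
Proof.
move=> aw wu wv; have [m Hm] := Fd aw.
have n0 : (w - u) * (w - v) != 0 by rewrite mulf_neq0// subr_eq0.
have [k Hk] := hasD_inv2 n0.
by have H := hasDM Hm Hk; eexists; exact: H.
Qed.

Lemma lineP u b : complex.Re u <> a -> Complex a b != u.
Proof. by move=> ua; apply: contra_notN ua => /eqP <-. Qed.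

Lemma kernel2_meas u v : complex.Re u <> a -> complex.Re v <> a ->
  cmeas setT (fun b => kernel2 u v (Complex a b)).
Proof.
move=> ua va; apply: pcont_cmeasT => b; apply: pcont_vline.
by have [||//|m /hasD_continuous] := @kernel2_hasD u v (Complex a b); rewrite ?lineP/=.
Qed.

(* AM-GM reduces the product of two simple poles to two Poisson kernels. *)
Lemma kernel2_le u v b : complex.Re u <> a -> complex.Re v <> a ->
  cabs (kernel2 u v (Complex a b)) <= K * (lineker u b + lineker v b).
Proof.
move=> ua va; rewrite /kernel2 cabsM cabsV cabsM /lineker.
have := FK (w := Complex a b) (lexx _).
have := cabs_ge0 (F (Complex a b)).
have x0 : 0 < cabs (Complex a b - u) by rewrite cabs_gt0 subr_eq0 lineP.
have y0 : 0 < cabs (Complex a b - v) by rewrite cabs_gt0 subr_eq0 lineP.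
move: (cabs (F _)) (cabs (_ - u)) (cabs (_ - v)) x0 y0 => k x y x0 y0 k0 kK.
apply: ler_pM => //; first by rewrite invr_ge0 mulr_ge0// ltW.
rewrite invfM -!exprVn; set x' := x^-1; set y' := y^-1.
have : 0 <= x' by rewrite invr_ge0 ltW.
have : 0 <= y' by rewrite invr_ge0 ltW.
by have := sqr_ge0 (x' - y'); nra.
Qed.

Lemma kernel2_integrable u v : complex.Re u <> a -> complex.Re v <> a ->
  cintegrable setT (fun b => kernel2 u v (Complex a b)).
Proof.
move=> ua va.
apply: (@cintegrable_dom _ _ _ (fun b => K * (lineker u b + lineker v b))) => //.
- exact: kernel2_meas.
- apply: integrable_RZ => //.
  by apply: integrable_RD => //; exact: integrable_lineker.
- by move=> b _; exact: kernel2_le.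
Qed.

Lemma cauchy_left u v : complex.Re u < a -> complex.Re v < a ->
  vint a (kernel2 u v) = 0.
Proof.
move=> ua va; pose d := a - complex.Re v.
have d0 : 0 < d by rewrite subr_gt0.
have neq w q : a <= complex.Re w -> complex.Re q < a -> w != q.
  by move=> aw qa; apply: contraTneq qa => <-; rewrite -leNgt.
(* The constant turns the product of two distances into a square: on [Re w >= a] one has
   [|w - u| / |w - v| <= 1 + |u - v| / d]. *)
apply: (@vint_eq0 R _ a (K * (1 + cabs (u - v) / d)) u u) => //.
- by rewrite mulr_ge0// addr_ge0// divr_ge0 ?cabs_ge0// ltW.
- by move=> w aw; have [||//|m /hasD_continuous] := @kernel2_hasD u v w; rewrite ?neq.
- by move=> w aw _; apply: kernel2_hasD; rewrite ?neq.
- move=> w aw; rewrite /kernel2 cabsM cabsV cabsM -mulrA.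
  have x0 : 0 < cabs (w - u) by rewrite cabs_gt0 subr_eq0 neq.
  have y0 : 0 < cabs (w - v) by rewrite cabs_gt0 subr_eq0 neq.
  apply: ler_pM; rewrite ?cabs_ge0 ?FK// ?invr_ge0 ?mulr_ge0 ?cabs_ge0//.
  rewrite ler_pdivlMr ?exprn_gt0//.
  have -> : (cabs (w - u) * cabs (w - v))^-1 * cabs (w - u) ^+ 2 =
      cabs (w - u) / cabs (w - v) by field; rewrite !gt_eqF.
  rewrite ler_pdivrMr// mulrDl mul1r.
  have dw : d <= cabs (w - v).
    by apply: le_trans (Re_dist_le _ _); rewrite (le_trans _ (ler_norm _))// lerD2r.
  apply: (@le_trans _ _ (cabs (w - v) + cabs (u - v))).
    by rewrite (cabsBC u v) (le_trans (cabs_triangle w v u)).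
  by rewrite lerD2l mulrAC ler_pdivlMr// ler_wpM2l// cabs_ge0.
Qed.

Section Pole.
Variables (z l q : R[i]).
Hypotheses (az : a < complex.Re z) (Dz : hasD F z l) (qa : complex.Re q < a).

(** The removable singularity at [z] is filled with the derivative. Continuity there suffices, since
    [z] is taken as the exceptional point of [vint_eq0]. *)
Let quot w : R[i] := if w == z then l else (F w - F z) / (w - z).

Let quot_cont : ccontinuous_at quot z.
Proof.
move=> e e0; have [d d0 Hd] := Dz (e := e / 2) (divr_gt0 e0 (ltr0Sn _ 1)).
exists d => // w wd; rewrite /quot eqxx; case: ifPn => [_|wz].
  by rewrite subrr cabs0.
have wz0 : w - z != 0 by rewrite subr_eq0.
have -> : (F w - F z) / (w - z) - l = (F w - F z - l * (w - z)) / (w - z) by field.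
rewrite cabsM cabsV ltr_pdivrMr ?cabs_gt0//.
have := Hd _ wd; rewrite (addrC z) subrK => /le_lt_trans; apply.
by rewrite ltr_pM2r ?cabs_gt0// ltr_pdivrMr// ltr_pMr// ltr1n.
Qed.

Let qneq w : a <= complex.Re w -> w - q != 0.
Proof.
move=> aw; rewrite subr_eq0; apply: contraTneq qa => <-.
by rewrite -leNgt.
Qed.

Lemma cauchy_pole :
  vint a (fun w => (F w - F z) / ((w - z) * (w - q))) = 0.
Proof.
pose G w := quot w * (w - q)^-1.
have GE w : w != z -> G w = (F w - F z) / ((w - z) * (w - q)).
  by move=> wz; rewrite /G /quot (negPf wz) invfM mulrA.
have -> : vint a (fun w => (F w - F z) / ((w - z) * (w - q))) = vint a G.
  apply: eq_cint => b _; rewrite GE//.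
  by apply: contraTneq az => <-; rewrite /= ltxx.
have Gd w : a <= complex.Re w -> w <> z -> exists m, hasD G w m.
  move=> aw /eqP wz; have [m Hm] := Fd aw.
  have wz0 : w - z != 0 by rewrite subr_eq0.
  have n0 : (w - z) * (w - q) != 0 by rewrite mulf_neq0// qneq.
  have [k Hk] := hasD_inv2 n0.
  have H := hasDM (hasDB Hm (hasD_cst (F z) w)) Hk.
  eexists; apply: (hasD_near (d := cabs (w - z))) H; first by rewrite cabs_gt0.
  move=> v vw; rewrite GE//; apply: contraTneq vw => ->.
  by rewrite cabsBC ltxx.
have [d d0 Hd] := Dz (e := 1) ltr01.
have d1 := cabs_ge0 (z - q).
(* [C1] serves within distance [d] of [z], where the quotient is at most [1 + |l|]; [C2] serves
   farther out, where it is at most [2 K / |w - z|]. *)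
pose C1 := (1 + cabs l) * (d + cabs (z - q)).
pose C2 := (K + K) * (1 + cabs (z - q) / d).
have C10 : 0 <= C1 by rewrite mulr_ge0// addr_ge0// ?cabs_ge0// ltW.
have C20 : 0 <= C2 by rewrite mulr_ge0 ?addr_ge0// divr_ge0// ltW.
apply: (@vint_eq0 R _ a (C1 + C2) q z) => //.
- exact: addr_ge0.
- move=> w aw; have [->|/eqP wz] := eqVneq w z; last first.
    by have [m /hasD_continuous] := Gd w aw wz.
  apply: ccontinuousM => //.
  by apply: (hasD_continuous (hasDV _ (hasD_affine q z))); rewrite qneq// ltW.
- move=> w aw.
  have y0 : 0 < cabs (w - q) by rewrite cabs_gt0 qneq.
  have tri : cabs (w - q) <= cabs (w - z) + cabs (z - q) by exact: cabs_triangle.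
  rewrite ler_pdivlMr ?exprn_gt0// /G cabsM cabsV expr2 mulrA mulfVK ?gt_eqF//.
  have [wd|wd] := ltP (cabs (w - z)) d.
    apply: (@le_trans _ _ C1); last by rewrite lerDl.
    apply: ler_pM; rewrite ?cabs_ge0//; last by rewrite (le_trans tri)// lerD2r ltW.
    rewrite /quot; case: ifPn => [_|wz]; first by rewrite lerDr.
    rewrite cabsM cabsV ler_pdivrMr ?cabs_gt0 ?subr_eq0//.
    have := Hd _ wd; rewrite (addrC z) subrK mul1r mulrDl mul1r -cabsM => H.
    have -> : F w - F z = (F w - F z - l * (w - z)) + l * (w - z) by rewrite subrK.
    by rewrite (le_trans (cabsD _ _))// lerD2r.
  apply: (@le_trans _ _ C2); last by rewrite lerDr.
  have wz0 : 0 < cabs (w - z) by exact: lt_le_trans wd.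
  have wz : w != z by rewrite -subr_eq0 -cabs_gt0.
  rewrite /quot (negPf wz) cabsM cabsV mulrAC -mulrA.
  apply: ler_pM; rewrite ?cabs_ge0 ?divr_ge0 ?cabs_ge0//.
    by rewrite (le_trans (cabsB _ _))// lerD// FK// ltW.
  rewrite ler_pdivrMr// (le_trans tri)// mulrDl mul1r lerD2l.
  by rewrite mulrAC ler_pdivlMr// ler_wpM2l// cabs_ge0.
Qed.

End Pole.

(** [cauchy_pole] with [q] the mirror image of [z] in the line: there the product of the two linear
    factors is [- (d^2 + (b - Im z)^2)], so the kernel is real, of one sign and of known mass. *)
Lemma poisson_formula z : a < complex.Re z ->
  pi%:C%C * F z = cint setT (fun b =>
    (pker (complex.Re z - a) (b - complex.Im z))%:C%C * F (Complex a b)).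
Proof.
move=> az; have [l Dz] := Fd (ltW az).
pose s := complex.Re z; pose d := s - a.
have d0 : 0 < d by rewrite subr_gt0.
have := @cauchy_pole z l (Complex (a - d) (complex.Im z)) az Dz.
rewrite /= ltrBlDr ltrDl => /(_ d0) H.
have E b : (F (Complex a b) - F z) /
   ((Complex a b - z) * (Complex a b - Complex (a - d) (complex.Im z))) =
   (- d^-1)%:C%C * ((pker d (b - complex.Im z))%:C%C * F (Complex a b) -
     (pker d (b - complex.Im z))%:C%C * F z).
  have p0 : d ^+ 2 + (b - complex.Im z) ^+ 2 != 0.
    by rewrite gt_eqF// ltr_pwDl ?exprn_gt0// sqr_ge0.
  have -> : (Complex a b - z) * (Complex a b - Complex (a - d) (complex.Im z))
      = (- (d ^+ 2 + (b - complex.Im z) ^+ 2))%:C%C.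
    apply: complexP; rewrite !ReImE /= /d /s; ring.
  rewrite -mulrBr mulrA [RHS]mulrC; congr (_ * _).
  rewrite -rmorphM -fmorphV; congr (_%:C%C); rewrite /pker.
  by field; rewrite p0 gt_eqF.
have ik := integrable_pker (complex.Im z) d0.
have mk : cmeas setT (fun b => (pker d (b - complex.Im z))%:C%C).
  by split => /=; [exact: measurable_pker|exact: measurable_cst].
have i1 : cintegrable setT (fun b => (pker d (b - complex.Im z))%:C%C * F (Complex a b)).
  apply: (@cintegrable_dom _ _ _ (fun b => K * pker d (b - complex.Im z))) => //.
  - apply: cmeasM => //; apply: pcont_cmeasT => b; apply: pcont_vline.
    by have [//|m /hasD_continuous] := Fd (w := Complex a b).
  - exact: integrable_RZ.
  - move=> b _; rewrite cabsM cabs_real ger0_norm ?pker_ge0 ?(ltW d0)// mulrC.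
    by rewrite ler_wpM2r ?pker_ge0 ?(ltW d0)// FK/=.
have ick : cintegrable setT (fun b => (pker d (b - complex.Im z))%:C%C).
  by split => //=; exact: integrable0.
have i2 : cintegrable setT (fun b => (pker d (b - complex.Im z))%:C%C * F z).
  apply: eq_cintegrable (cintegrableZ (F z) measurableT ick) => // b _.
  by rewrite mulrC.
move: H; rewrite /vint.
rewrite (eq_cint (k := fun b => (- d^-1)%:C%C * ((pker d (b - complex.Im z))%:C%C * F (Complex a b) -
     (pker d (b - complex.Im z))%:C%C * F z))); last by move=> b _; exact: E.
rewrite cintZ//; last exact: cintegrableB.
rewrite cintB// => /eqP; rewrite mulf_eq0 => /orP[/eqP/(congr1 (@complex.Re R))/=/eqP|].
  by rewrite oppr_eq0 invr_eq0 gt_eqF.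
rewrite subr_eq0 => /eqP ->.
have -> : cint setT (fun b => (pker d (b - complex.Im z))%:C%C * F z) =
    F z * cint setT (fun b => (pker d (b - complex.Im z))%:C%C).
  by rewrite -cintZ//; apply: eq_cint => b _; rewrite mulrC.
rewrite mulrC; congr (_ * _); apply: complexP => /=.
- by rewrite Rintegral_pker.
- by rewrite /Rintegral integral0.
Qed.

(** The maximum principle for bounded functions on a half-plane: the Poisson kernel is positive and
    has mass [pi]. *)
Lemma poisson_bound z M : a < complex.Re z ->
  (forall b, cabs (F (Complex a b)) <= M) -> cabs (F z) <= M.
Proof.
move=> az HM; pose d := complex.Re z - a.
have d0 : 0 < d by rewrite subr_gt0.
have ik := integrable_pker (complex.Im z) d0.
rewrite -(@ler_pM2l _ pi) ?pi_gt0//.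
have -> : pi * cabs (F z) = cabs (pi%:C%C * F z).
  by rewrite cabsM cabs_real ger0_norm// pi_ge0.
rewrite poisson_formula//.
have -> : pi * M = Rintegral mu setT (fun b => M * pker d (b - complex.Im z)).
  by rewrite RintegralZl// Rintegral_pker// mulrC.
have B b : cabs ((pker d (b - complex.Im z))%:C%C * F (Complex a b)) <=
    M * pker d (b - complex.Im z).
  rewrite cabsM cabs_real ger0_norm ?pker_ge0 ?(ltW d0)// mulrC.
  by rewrite ler_wpM2r ?pker_ge0 ?(ltW d0).
have iM := integrable_RZ M measurableT ik.
apply: cint_le => //.
apply: (cintegrable_dom _ _ iM) => //; apply: cmeasM.
- by split => /=; [exact: measurable_pker|exact: measurable_cst].
- apply: pcont_cmeasT => b; apply: pcont_vline.
  by have [//|m /hasD_continuous] := Fd (w := Complex a b).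
Qed.

Let right_neq z : a < complex.Re z -> complex.Re z <> a.
Proof. by move=> az E; rewrite E ltxx in az. Qed.

Let left_neq z : complex.Re z < a -> complex.Re z <> a.
Proof. by move=> az E; rewrite E ltxx in az. Qed.

Lemma cauchy_reflected z : a < complex.Re z ->
  let zs := Complex (a - (complex.Re z - a)) (complex.Im z) in
  (z - zs) * vint a (kernel2 z zs) = - (2 * pi)%:C%C * F z.
Proof.
move=> az zs; pose d := complex.Re z - a.
have d0 : 0 < d by rewrite subr_gt0.
have E b : kernel2 z zs (Complex a b) = (- d^-1)%:C%C *
    ((pker d (b - complex.Im z))%:C%C * F (Complex a b)).
  have p0 : d ^+ 2 + (b - complex.Im z) ^+ 2 != 0.
    by rewrite gt_eqF// ltr_pwDl ?exprn_gt0// sqr_ge0.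
  have -> : kernel2 z zs (Complex a b) = F (Complex a b) /
      (- (d ^+ 2 + (b - complex.Im z) ^+ 2))%:C%C.
    rewrite /kernel2; congr (_ / _); apply: complexP; rewrite !ReImE /= /d; ring.
  rewrite mulrA [RHS]mulrC; congr (_ * _).
  rewrite -rmorphM -fmorphV; congr (_%:C%C); rewrite /pker.
  by field; rewrite p0 gt_eqF.
rewrite /vint (eq_cint (k := fun b => (- d^-1)%:C%C *
    ((pker d (b - complex.Im z))%:C%C * F (Complex a b)))); last by move=> b _.
rewrite cintZ//; last first.
  apply: (@cintegrable_dom _ _ _ (fun b => K * pker d (b - complex.Im z))) => //.
  - apply: cmeasM => //.
      by split => /=; [exact: measurable_pker|exact: measurable_cst].
    apply: pcont_cmeasT => b; apply: pcont_vline.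
    by have [//|m /hasD_continuous] := Fd (w := Complex a b).
  - by apply: integrable_RZ => //; exact: integrable_pker.
  - move=> b _; rewrite cabsM cabs_real ger0_norm ?pker_ge0 ?(ltW d0)// mulrC.
    by rewrite ler_wpM2r ?pker_ge0 ?(ltW d0)// FK/=.
rewrite -poisson_formula//.
have -> : z - zs = (2 * d)%:C%C.
  by apply: complexP; rewrite !ReImE /= /d; ring.
rewrite !mulrA -!rmorphM -rmorphN; congr (_%:C%C * _).
by field; rewrite gt_eqF.
Qed.

(** By partial fractions, replacing the mirror image by another [q] on the left changes the weighted
    kernel by one whose two poles are both on the left, and [cauchy_left] kills that one. *)
Lemma cauchy_two z q : a < complex.Re z -> complex.Re q < a ->
  (z - q) * vint a (kernel2 z q) = - (2 * pi)%:C%C * F z.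
Proof.
move=> az qa; rewrite -cauchy_reflected//=.
set zs := Complex _ _.
have zsa : complex.Re zs < a by rewrite /= ltrBlDr ltrDl subr_gt0.
have iz q' : complex.Re q' < a -> cintegrable setT (fun b => kernel2 z q' (Complex a b)).
  by move=> q'a; apply: kernel2_integrable; [exact: right_neq|exact: left_neq].
apply/eqP; rewrite -subr_eq0; apply/eqP; rewrite /vint -!cintZ//; [|exact: iz..].
rewrite -cintB//; [|by apply: cintegrableZ => //; exact: iz..].
rewrite (eq_cint (k := fun b => (zs - q) * kernel2 zs q (Complex a b))); last first.
  move=> b _; rewrite /kernel2.
  have h1 : Complex a b - z != 0 by rewrite subr_eq0 lineP//; exact: right_neq.
  have h2 : Complex a b - q != 0 by rewrite subr_eq0 lineP//; exact: left_neq.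
  have h3 : Complex a b - zs != 0 by rewrite subr_eq0 lineP//; exact: left_neq.
  by move: (Complex a b) h1 h2 h3 => w h1 h2 h3; field; rewrite h1 h2 h3.
rewrite cintZ//; last by apply: kernel2_integrable; exact: left_neq.
by have := cauchy_left zsa qa; rewrite /vint => ->; rewrite mulr0.
Qed.

(** Subtracting two instances of [cauchy_two] with a common auxiliary pole [q] cancels that pole. *)
Lemma cauchy_diff z z' : a < complex.Re z -> a < complex.Re z' ->
  (z - z') * vint a (kernel2 z z') = - (2 * pi)%:C%C * (F z - F z').
Proof.
move=> az az'; pose q : R[i] := Complex (a - 1) 0.
have qa : complex.Re q < a by rewrite /= ltrBlDr ltrDl.
have iz u : a < complex.Re u -> cintegrable setT (fun b => kernel2 u q (Complex a b)).
  by move=> q'a; apply: kernel2_integrable; [exact: right_neq|exact: left_neq].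
rewrite mulrBr -(cauchy_two az qa) -(cauchy_two az' qa) /vint.
rewrite -!cintZ//; [|exact: iz..|]; last by apply: kernel2_integrable; exact: right_neq.
rewrite -cintB//; [|by apply: cintegrableZ => //; exact: iz..].
apply: eq_cint => b _; rewrite /kernel2.
have h1 : Complex a b - z != 0 by rewrite subr_eq0 lineP//; exact: right_neq.
have h2 : Complex a b - q != 0 by rewrite subr_eq0 lineP//; exact: left_neq.
have h3 : Complex a b - z' != 0 by rewrite subr_eq0 lineP//; exact: right_neq.
by move: (Complex a b) h1 h2 h3 => w h1 h2 h3; field; rewrite h1 h2 h3.
Qed.

(** The difference of the kernels has the extra factor [(z - z') / (w - z')], of modulus at most
    [|z - z'| / d] on the line. *)
Lemma vint_kernel2_diff z z' d : 0 < d -> a + d <= complex.Re z ->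
  a + d <= complex.Re z' ->
  cabs (vint a (kernel2 z z) - vint a (kernel2 z z')) <=
    K * cabs (z - z') * pi / d ^+ 2.
Proof.
move=> d0 zd zd'.
have az : a < complex.Re z by rewrite (lt_le_trans _ zd)// ltrDl.
have az' : a < complex.Re z' by rewrite (lt_le_trans _ zd')// ltrDl.
have i1 : cintegrable setT (fun b => kernel2 z z (Complex a b)).
  by apply: kernel2_integrable; exact: right_neq.
have i2 : cintegrable setT (fun b => kernel2 z z' (Complex a b)).
  by apply: kernel2_integrable; exact: right_neq.
rewrite /vint -cintB//.
have ik := integrable_lineker (right_neq az).
apply: (@le_trans _ _ (Rintegral mu setT (fun b => K * cabs (z - z') / d * lineker z b))).
  apply: cint_le => //; first exact: cintegrableB.
    exact: integrable_RZ.
  move=> b _; rewrite /kernel2 /lineker.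
  have h1 : Complex a b - z != 0 by rewrite subr_eq0 lineP//; exact: right_neq.
  have h3 : Complex a b - z' != 0 by rewrite subr_eq0 lineP//; exact: right_neq.
  have -> : F (Complex a b) / ((Complex a b - z) * (Complex a b - z)) -
      F (Complex a b) / ((Complex a b - z) * (Complex a b - z')) =
      F (Complex a b) * (z - z') / (Complex a b - z') / (Complex a b - z) ^+ 2.
    by move: (Complex a b) h1 h3 => w h1 h3; field; rewrite h1 h3.
  rewrite !(cabsM, cabsV, cabsX) ler_wpM2r ?invr_ge0 ?sqr_ge0//.
  apply: ler_pM; rewrite ?mulr_ge0 ?cabs_ge0 ?invr_ge0 ?cabs_ge0//.
    by rewrite ler_wpM2r ?cabs_ge0// FK/=.
  rewrite lef_pV2 ?posrE ?cabs_gt0//.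
  apply: le_trans (Re_dist_le _ _); rewrite distrC (le_trans _ (ler_norm _))//=.
  by rewrite lerBrDr addrC.
rewrite RintegralZl// Rintegral_lineker; last exact: right_neq.
have -> : K * cabs (z - z') * pi / d ^+ 2 = K * cabs (z - z') / d * (pi / d).
  by field; rewrite gt_eqF.
apply: ler_wpM2l; first by rewrite !mulr_ge0 ?cabs_ge0// invr_ge0 ltW.
apply: ler_wpM2l; first exact: pi_ge0.
have dz : d <= `|a - complex.Re z|.
  by rewrite distrC (le_trans _ (ler_norm _))// lerBrDr addrC.
by rewrite lef_pV2 ?posrE// (lt_le_trans d0).
Qed.

(** The limit of [cauchy_diff], divided by [z - z'], along horizontal increments: the right side
    becomes the derivative, and the left side converges by [vint_kernel2_diff]. *)
Lemma cauchy_deriv z l : a < complex.Re z -> hasD F z l ->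
  vint a (kernel2 z z) = - (2 * pi)%:C%C * l.
Proof.
move=> az Dz; apply/eqP; rewrite -subr_eq0 -cabs_eq0 eq_le cabs_ge0 andbT.
apply/ler_addgt0Pl => e e0; rewrite addr0.
pose d := complex.Re z - a.
have d0 : 0 < d by rewrite subr_gt0.
have pi0 := pi_gt0 R.
(* Multiplied by the [2 * pi] of the Cauchy formula this tolerance becomes [e / 2]; the other half
   is spent on moving the pole. *)
have e1 : 0 < e / (4 * pi) by rewrite divr_gt0// mulr_gt0.
have [r r0 Hr] := Dz _ e1.
pose B := K * pi / d ^+ 2 + 1.
have KB : 0 <= K * pi / d ^+ 2 by rewrite divr_ge0 ?sqr_ge0// mulr_ge0// ltW.
have B0 : 0 < B by rewrite ltr_wpDl.
pose h := Num.min (r / 2) (e / 2 / B).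
have h0 : 0 < h by rewrite lt_min !divr_gt0.
have hr : h < r by rewrite (@le_lt_trans _ _ (r / 2)) ?ge_min ?lexx// ltr_pdivrMr// ltr_pMr// ltr1n.
have he : h <= e / 2 / B by rewrite ge_min lexx orbT.
have hc : cabs (h%:C%C : R[i]) = h by rewrite cabs_real ger0_norm// ltW.
have hn : (h%:C%C : R[i]) != 0 by rewrite -cabs_gt0 hc.
pose z' := z + h%:C%C.
have z'E : complex.Re z' = complex.Re z + h by rewrite cReD.
have az' : a < complex.Re z' by rewrite z'E (lt_trans az)// ltrDl.
have H1 : cabs (vint a (kernel2 z z) - vint a (kernel2 z z')) <= e / 2.
  rewrite (le_trans (vint_kernel2_diff (d := d) _ _ _))//.
  - by rewrite /d addrC subrK.
  - by rewrite z'E /d addrC subrK lerDl ltW.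
  - rewrite /z' opprD addrA subrr add0r cabsN hc.
    have -> : K * h * pi / d ^+ 2 = h * (K * pi / d ^+ 2) by ring.
    rewrite (@le_trans _ _ (h * B))//; first by rewrite ler_wpM2l ?(ltW h0)// lerDl.
    by rewrite -ler_pdivlMr.
have H2 : cabs (vint a (kernel2 z z') - - (2 * pi)%:C%C * l) <= e / 2.
  have E : vint a (kernel2 z z') = - (2 * pi)%:C%C * ((F z' - F z) / h%:C%C).
    have := cauchy_diff az az'.
    have -> : z - z' = - h%:C%C by rewrite /z' opprD addrA subrr add0r.
    move=> H; apply: (mulfI (x := - h%:C%C)); first by rewrite oppr_eq0.
    rewrite H; by field.
  rewrite E -mulrBr cabsM cabsN cabs_real ger0_norm ?mulr_ge0 ?(ltW pi0)//.
  have := Hr h%:C%C; rewrite hc => /(_ hr) H.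
  have -> : (F z' - F z) / h%:C%C - l = (F (z + h%:C%C) - F z - l * h%:C%C) / h%:C%C.
    by rewrite /z'; field.
  rewrite cabsM cabsV hc mulrA ler_pdivrMr// mulrC.
  rewrite (le_trans (ler_wpM2r _ H))//; first by rewrite mulr_ge0// ltW.
  have -> : e / (4 * pi) * h * (2 * pi) = e / 2 * h.
    by move: (pi : R) pi0 => p p0; field; rewrite gt_eqF.
  exact: lexx.
by rewrite (le_trans (cabs_triangle _ (vint a (kernel2 z z')) _))// [e]splitr lerD.
Qed.

Lemma cauchy_deriv_le z l : a < complex.Re z -> hasD F z l ->
  cabs l <= K / (2 * (complex.Re z - a)).
Proof.
move=> az Dz; have pi0 := pi_gt0 R.
have d0 : 0 < complex.Re z - a by rewrite subr_gt0.
have : cabs (vint a (kernel2 z z)) <= K * (pi / (complex.Re z - a)).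
  have -> : K * (pi / (complex.Re z - a)) = Rintegral mu setT (fun b => K * lineker z b).
    rewrite RintegralZl//; last exact: integrable_lineker (right_neq az).
    rewrite Rintegral_lineker; last exact: right_neq.
    by rewrite distrC gtr0_norm.
  apply: cint_le => //.
  - by apply: kernel2_integrable; exact: right_neq.
  - by apply: integrable_RZ => //; exact: integrable_lineker (right_neq az).
  - move=> b _; rewrite /kernel2 /lineker cabsM cabsV cabsM -expr2.
    by rewrite ler_wpM2r ?invr_ge0 ?sqr_ge0// FK/=.
rewrite (cauchy_deriv az Dz) cabsM cabsN cabs_real gtr0_norm ?mulr_gt0// => H.
rewrite -(@ler_pM2l _ (2 * pi)) ?mulr_gt0// (le_trans H)//.
rewrite le_eqVlt; apply/orP; left; apply/eqP.
by move: (pi : R) pi0 => p p0; field; rewrite gt_eqF.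
Qed.

Lemma cauchy_deriv_lip z z' l l' d : 0 < d -> a + d <= complex.Re z ->
  a + d <= complex.Re z' -> hasD F z l -> hasD F z' l' ->
  cabs (l - l') <= K / d ^+ 2 * cabs (z - z').
Proof.
move=> d0 zd zd' Dz Dz'; have pi0 := pi_gt0 R.
have az : a < complex.Re z by rewrite (lt_le_trans _ zd)// ltrDl.
have az' : a < complex.Re z' by rewrite (lt_le_trans _ zd')// ltrDl.
have H1 := vint_kernel2_diff d0 zd zd'.
have H2 := vint_kernel2_diff d0 zd' zd.
have E : vint a (kernel2 z' z) = vint a (kernel2 z z').
  by apply: eq_cint => b _; rewrite /kernel2 (mulrC (_ - z')).
rewrite E (cabsBC z') in H2.
have := cabs_triangle (vint a (kernel2 z z)) (vint a (kernel2 z z')) (vint a (kernel2 z' z')).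
rewrite (cabsBC (vint a (kernel2 z z')) (vint a (kernel2 z' z'))).
move=> /le_trans/(_ (lerD H1 H2)).
rewrite (cauchy_deriv az Dz) (cauchy_deriv az' Dz') -mulrBr cabsM cabsN cabs_real.
rewrite gtr0_norm ?mulr_gt0// => H.
rewrite -(@ler_pM2l _ (2 * pi)) ?mulr_gt0// (le_trans H)//.
rewrite le_eqVlt; apply/orP; left; apply/eqP.
by move: (pi : R) pi0 => p p0; field; rewrite gt_eqF.
Qed.

End CauchyFormulas.

(** * Bounded holomorphic functions on the half-plane *)

Section PathDerivative.
Context {R : realType}.
Notation mu := (@lebesgue_measure R).

Lemma is_derive_eps (u : R -> R) (t l : R) :
  (forall e : R, 0 < e -> exists2 d : R, 0 < d &
     forall h, `|h| < d -> `|u (t + h) - u t - l * h| <= e * `|h|) ->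
  is_derive t 1 u l.
Proof.
move=> H.
have cv : (fun h : R => h^-1 *: (u (h *: 1 + t) - u t)) @ 0^' --> l.
  apply/cvgrPdist_le => /= e e0; have [d d0 Hd] := H _ e0.
  exists d => // h /=; rewrite sub0r normrN => hd h0.
  have -> : l - h^-1 *: (u (h *: 1 + t) - u t) = - ((u (t + h) - u t - l * h) / h).
    by rewrite /GRing.scale/= mulr1 (addrC h t); field.
  rewrite normrN normrM normfV ler_pdivrMr ?normr_gt0//.
  exact: Hd.
split; first by apply/cvg_ex; exists l.
exact: cvg_lim.
Qed.

Lemma is_derive_path f (p v c l : R[i]) (t : R) : hasD f (p + t%:C%C * v) l ->
  is_derive t 1 (fun t => complex.Re (c * f (p + t%:C%C * v))) (complex.Re (c * (l * v))).
Proof.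
move=> Df; apply: is_derive_eps => e e0.
pose B := (1 + cabs c) * (1 + cabs v).
have c1 : 0 < 1 + cabs c by rewrite ltr_pwDl// cabs_ge0.
have v1 : 0 < 1 + cabs v by rewrite ltr_pwDl// cabs_ge0.
have B0 : 0 < B by rewrite mulr_gt0.
have [d d0 Hd] := Df _ (divr_gt0 e0 B0).
exists (d / (1 + cabs v)); first by rewrite divr_gt0.
move=> h; rewrite ltr_pdivlMr// => hd.
have -> : complex.Re (c * f (p + (t + h)%:C%C * v)) - complex.Re (c * f (p + t%:C%C * v)) -
    complex.Re (c * (l * v)) * h =
    complex.Re (c * (f (p + t%:C%C * v + h%:C%C * v) - f (p + t%:C%C * v) - l * (h%:C%C * v))).
  rewrite rmorphD/= mulrDl addrA.
  move: (f _) (f _) => x y.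
  by rewrite !ReImE /=; ring.
rewrite (le_trans (cabs_Re _))// cabsM.
have hv : cabs (h%:C%C * v) <= `|h| * (1 + cabs v).
  by rewrite cabsM cabs_real ler_wpM2l// lerDr.
have := Hd _ (le_lt_trans hv hd) => H.
apply: (@le_trans _ _ ((1 + cabs c) * (e / B * (`|h| * (1 + cabs v))))).
  apply: ler_pM; rewrite ?cabs_ge0 ?lerDr// (le_trans H)// ler_wpM2l//.
  by rewrite divr_ge0// ltW.
rewrite le_eqVlt; apply/orP; left; apply/eqP; rewrite /B; field.
by rewrite !gt_eqF.
Qed.

Lemma is_derive_pathcont (u : R -> R) (t l : R) : is_derive t 1 u l -> {for t, continuous u}.
Proof.
move=> [du _]; apply: differentiable_continuous; exact/derivable1_diffP.
Qed.

(** The mean value theorem is real: the rotation [c] that makes the increment positive is fixed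
    first, and the theorem is applied to the real part of [c * f]. *)
Lemma path_mvt f (p v : R[i]) (d : R -> R[i]) (T M : R) : 0 <= T ->
  (forall t, 0 <= t <= T -> hasD f (p + t%:C%C * v) (d t)) ->
  (forall t, 0 <= t <= T -> cabs (d t * v) <= M) ->
  cabs (f (p + T%:C%C * v) - f p) <= M * T.
Proof.
move=> T0 Hd HM; have [c c1 cE] := cabs_rotation (f (p + T%:C%C * v) - f p).
pose u t := complex.Re (c * f (p + t%:C%C * v)).
have du t : 0 <= t <= T -> is_derive t 1 u (complex.Re (c * (d t * v))).
  by move=> /Hd; exact: is_derive_path.
have [||t] := @MVT_segment R u (fun t => complex.Re (c * (d t * v))) 0 T T0.
- move=> t; rewrite in_itv/= => /andP[t0 tT]; apply: du.
  by rewrite !ltW.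
- apply: continuous_in_subspaceT => t /set_mem /=; rewrite in_itv/= => tT.
  exact: is_derive_pathcont (du _ tT).
rewrite in_itv/= => tT uE.
have -> : cabs (f (p + T%:C%C * v) - f p) = u T - u 0.
  by rewrite /u -cReN -cReD -mulrBr mul0r addr0 cE.
rewrite uE subr0 ler_wpM2r// (le_trans (Re_le_cabs _))// cabsM c1 mul1r.
exact: HM.
Qed.

(** The fundamental theorem for the real functions [Re (c * f)]; [c = 1] and [c = - i] give the two
    components. *)
Lemma path_cint f (p v : R[i]) (d : R -> R[i]) (t0 T : R) : t0 <= T ->
  (forall t, t0 <= t <= T -> hasD f (p + t%:C%C * v) (d t)) ->
  (forall t, t0 <= t <= T -> pcont d t) ->
  cint `[t0, T] (fun t => d t * v) = f (p + T%:C%C * v) - f (p + t0%:C%C * v).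
Proof.
rewrite le_eqVlt => /orP[/eqP <- _ _|tT Hd Hc].
  by rewrite subrr; apply: complexP; rewrite /= set_itv1 Rintegral_set1.
have FTC c : Rintegral mu `[t0, T] (fun t => complex.Re (c * (d t * v))) =
    complex.Re (c * (f (p + T%:C%C * v) - f (p + t0%:C%C * v))).
  pose u t := complex.Re (c * f (p + t%:C%C * v)).
  pose du t := complex.Re (c * (d t * v)).
  have Hu t : t0 <= t <= T -> is_derive t 1 u (du t).
    by move=> /Hd H; exact: is_derive_path.
  have Hcu t : t0 <= t <= T -> {for t, continuous du}.
    move=> tt; apply: (@pcont_Re R (fun t => c * (d t * v))) => e e0.
    have k0 : 0 < cabs (c * v) + 1 by rewrite ltr_wpDl ?cabs_ge0.
    have [r r0 Hr] := Hc _ tt _ (divr_gt0 e0 k0); exists r => // s sr.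
    rewrite (_ : _ - _ = (c * v) * (d s - d t)); last by ring.
    rewrite cabsM; have := Hr _ sr; rewrite ltr_pdivlMr// mulrC; apply: le_lt_trans.
    by rewrite ler_wpM2r ?cabs_ge0// lerDl.
  have FTC : (\int[mu]_(t in `[t0, T]) (du t)%:E = (u T)%:E - (u t0)%:E)%E.
    apply: continuous_FTC2 => //.
    - apply: continuous_in_subspaceT => t /set_mem /=; rewrite in_itv/= => tt.
      exact: Hcu.
    - split.
      + move=> t; rewrite in_itv/= => /andP[h1 h2].
        by have [] := Hu t; rewrite ?ltW.
      + apply: cvg_at_right_filter; apply: is_derive_pathcont (Hu t0 _).
        by rewrite lexx ltW.
      + apply: cvg_at_left_filter; apply: is_derive_pathcont (Hu T _).
        by rewrite lexx ltW.
    - move=> t; rewrite in_itv/= => /andP[h1 h2]; rewrite derive1E; apply: derive_val.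
      by apply: Hu; rewrite !ltW.
  by rewrite mulrBr cReD cReN -/(u T) -/(u t0) /Rintegral FTC.
apply: complexP.
  have := FTC 1; rewrite mul1r => <-.
  by rewrite /=; apply: eq_Rintegral => t _; rewrite mul1r.
have I (w : R[i]) : complex.Im w = complex.Re (Complex 0 (-1) * w).
  by rewrite cReM /= mul0r sub0r mulN1r opprK.
rewrite [RHS]I -FTC /=; apply: eq_Rintegral => t _; exact: I.
Qed.

Lemma path_ftc f (p : R[i]) (d : R -> R[i]) (t0 T : R) (g : R -> R) : t0 <= T ->
  (forall t, t0 <= t <= T -> hasD f (p + t%:C%C) (d t)) ->
  (forall t, t0 <= t <= T -> pcont d t) ->
  mu.-integrable `[t0, T] (EFin \o g) ->
  (forall t, t0 <= t <= T -> cabs (d t) <= g t) ->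
  cabs (f (p + T%:C%C) - f (p + t0%:C%C)) <= Rintegral mu `[t0, T] g.
Proof.
move=> tT Hd Hc ig dg.
have := @path_cint f p 1 d t0 T tT; rewrite !mulr1 => <- //; last first.
  by move=> t tt; rewrite mulr1; exact: Hd.
apply: cint_le => //.
  apply: cintegrable_itv => t tt; have -> : (fun t => d t * 1) = d.
    by apply/funext => s; rewrite mulr1.
  exact: Hc.
by move=> t; rewrite /= in_itv /= mulr1; exact: dg.
Qed.

End PathDerivative.

Definition holo (R : realType) (f : R[i] -> R[i]) : Prop :=
  forall z, Cplus R z -> cderivable f z.

Definition bdd_by (R : realType) (f : R[i] -> R[i]) (K : R) : Prop :=
  forall z, Cplus R z -> cabs (f z) <= K.

(** For bounded holomorphic [f] and [s > 0] the supremum is finite by Cauchy's estimate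
    ([dsup_fin]), so [fine] loses nothing there. *)
Definition dm (R : realType) (f : R[i] -> R[i]) (s : R) : R := fine (dsup f s).

Section BoundedHolomorphic.
Context {R : realType}.
Notation mu := (@lebesgue_measure R).
Notation Rpos := (`]0%R, +oo[ : set R).
Variables (f : R[i] -> R[i]) (K : R).
Hypotheses (hf : holo f) (fK : bdd_by f K).

Let K0 : 0 <= K.
Proof. by apply: le_trans (fK (z := Complex 1 0) _); rewrite ?cabs_ge0// /Cplus/=. Qed.

Lemma holo_hasD z : 0 < complex.Re z -> hasD f z (cderiv f z).
Proof. by move=> z0; apply: cderivable_hasD; exact: hf. Qed.

Let hD (a : R) : 0 < a -> forall w, a <= complex.Re w -> exists m, hasD f w m.
Proof. by move=> a0 w aw; eexists; apply: holo_hasD; exact: lt_le_trans aw. Qed.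

Let hK (a : R) : 0 < a -> forall w, a <= complex.Re w -> cabs (f w) <= K.
Proof. by move=> a0 w aw; apply: fK; exact: lt_le_trans aw. Qed.

Lemma holo_deriv_le z : 0 < complex.Re z -> cabs (cderiv f z) <= K / complex.Re z.
Proof.
move=> z0; have a0 : 0 < complex.Re z / 2 by rewrite divr_gt0.
have az : complex.Re z / 2 < complex.Re z by rewrite ltr_pdivrMr// ltr_pMr// ltr1n.
rewrite (le_trans (cauchy_deriv_le (hD a0) (hK a0) az (holo_hasD z0)))//.
rewrite le_eqVlt; apply/orP; left; apply/eqP; field.
by rewrite gt_eqF//= (_ : complex.Re z * 2 - complex.Re z = complex.Re z) ?gt_eqF//; ring.
Qed.

Lemma holo_deriv_lip s z w : 0 < s -> s <= complex.Re z -> s <= complex.Re w ->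
  cabs (cderiv f z - cderiv f w) <= 4 * K / s ^+ 2 * cabs (z - w).
Proof.
move=> s0 sz sw; have a0 : 0 < s / 2 by rewrite divr_gt0.
have z0 := lt_le_trans s0 sz; have w0 := lt_le_trans s0 sw.
have := cauchy_deriv_lip (hD a0) (hK a0) a0 _ _ (holo_hasD z0) (holo_hasD w0).
rewrite -splitr sz sw => /(_ isT isT) /le_trans; apply.
rewrite le_eqVlt; apply/orP; left; apply/eqP; field.
by rewrite gt_eqF.
Qed.

Lemma cderiv_hcont s b : 0 < s -> pcont (fun s => cderiv f (Complex s b)) s.
Proof.
move=> s0 e e0; pose L := 4 * K / (s / 2) ^+ 2 + 1.
have K1 : 0 <= 4 * K / (s / 2) ^+ 2 by rewrite divr_ge0 ?sqr_ge0// mulr_ge0.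
have L0 : 0 < L by rewrite ltr_wpDl.
have s2 : 0 < s / 2 by rewrite divr_gt0.
exists (Num.min (s / 2) (e / L)); first by rewrite lt_min s2 divr_gt0.
move=> s'; rewrite lt_min => /andP[ss1 ss2].
have s's : s / 2 <= s'.
  by move: ss1; rewrite ltr_norml => /andP[]; lra.
rewrite (le_lt_trans (holo_deriv_lip s2 _ _))//=; first by lra.
rewrite (@le_lt_trans _ _ (L * `|s' - s|))//; last by rewrite mulrC -ltr_pdivlMr.
by apply: ler_pM; rewrite ?cabs_ge0 ?hline_lip// lerDl.
Qed.

Lemma dsup_fin s : 0 < s -> dsup f s = (dm f s)%:E.
Proof.
move=> s0; rewrite /dm fineK// ge0_fin_numE.
- apply: (@le_lt_trans _ _ (K / s)%:E); last exact: ltry.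
  apply: ge_ereal_sup => _ [b _ <-]; rewrite lee_fin.
  exact: (holo_deriv_le (z := Complex s b)).
- apply: (@le_trans _ _ (cabs (cderiv f (Complex s 0)))%:E).
    by rewrite lee_fin cabs_ge0.
  by apply: ereal_sup_ubound; exists 0.
Qed.

Lemma dm_ub s b : 0 < s -> cabs (cderiv f (Complex s b)) <= dm f s.
Proof.
by move=> s0; rewrite -lee_fin -dsup_fin//; apply: ereal_sup_ubound; exists b.
Qed.

Lemma dm_le s M : 0 < s -> (forall b, cabs (cderiv f (Complex s b)) <= M) ->
  dm f s <= M.
Proof.
move=> s0 HM; rewrite -lee_fin -dsup_fin//; apply: ge_ereal_sup => _ [b _ <-].
by rewrite lee_fin.
Qed.

Lemma dm_ge0 s : 0 < s -> 0 <= dm f s.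
Proof. by move=> s0; apply: le_trans (dm_ub 0 s0); exact: cabs_ge0. Qed.

(** A Lipschitz bound uniform in [b] passes to the supremum over [b]. The continuity so obtained is
    what makes this uncountable supremum measurable. *)
Lemma dm_lip s0 s s' : 0 < s0 -> s0 <= s -> s0 <= s' ->
  `|dm f s - dm f s'| <= 4 * K / s0 ^+ 2 * `|s - s'|.
Proof.
move=> h0 h1 h2.
have L0 : 0 <= 4 * K / s0 ^+ 2 by rewrite divr_ge0 ?sqr_ge0// mulr_ge0.
have H x y : s0 <= x -> s0 <= y -> dm f x - dm f y <= 4 * K / s0 ^+ 2 * `|x - y|.
  move=> hx hy; rewrite lerBlDr; apply: dm_le; first exact: lt_le_trans hx.
  move=> b; rewrite addrC.
  have -> : cderiv f (Complex x b) = cderiv f (Complex y b) +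
      (cderiv f (Complex x b) - cderiv f (Complex y b)) by rewrite addrC subrK.
  rewrite (le_trans (cabsD _ _))// lerD//; first by apply: dm_ub; exact: lt_le_trans hy.
  rewrite (le_trans (holo_deriv_lip h0 _ _))//=.
  by rewrite ler_wpM2l// hline_lip.
rewrite ler_norml lerNl opprB; apply/andP; split; last exact: H.
by rewrite distrC; exact: H.
Qed.

Lemma dm_continuous s : 0 < s -> {for s, continuous (dm f)}.
Proof.
move=> s0; have s2 : 0 < s / 2 by rewrite divr_gt0.
apply/cvgrPdist_lt => e e0; pose L := 4 * K / (s / 2) ^+ 2 + 1.
have L0 : 0 < L by rewrite ltr_wpDl// divr_ge0 ?sqr_ge0// mulr_ge0.
exists (Num.min (s / 2) (e / L)); first by rewrite /= lt_min s2 divr_gt0.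
move=> t /=; rewrite lt_min => /andP[t1 t2].
have ts : s / 2 <= t by move: t1; rewrite ltr_norml => /andP[]; lra.
rewrite (le_lt_trans (dm_lip s2 _ ts))//; first by lra.
rewrite (@le_lt_trans _ _ (L * `|s - t|))//; last by rewrite mulrC -ltr_pdivlMr.
by rewrite ler_wpM2r// lerDl.
Qed.

Lemma measurable_dm : measurable_fun Rpos (dm f).
Proof.
apply: open_continuous_measurable_fun => // s.
by rewrite inE/= in_itv/= andbT; exact: dm_continuous.
Qed.

(** The maximum principle for the derivative. It is applied to the vertical increments
    [f (w + i y) - f w], which are holomorphic because [f] is, and which are at most [dm f s * y] on
    the line [Re w = s]; letting [y] tend to 0 gives the derivative on [Re w = t]. *)
Lemma dm_nonincreasing s t : 0 < s -> s <= t -> dm f t <= dm f s.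
Proof.
move=> s0; rewrite le_eqVlt => /orP[/eqP ->//|st].
have t0 := lt_trans s0 st.
apply: dm_le => // b; apply/ler_addgt0Pl => e e0.
have [r r0 Hr] := holo_hasD (z := Complex t b) t0 e0.
pose y := r / 2.
have y0 : 0 < y by rewrite divr_gt0.
have yr : y < r by rewrite /y ltr_pdivrMr// ltr_pMr// ltr1n.
pose F w := f (w + Complex 0 y) - f w.
have FD w : s <= complex.Re w -> exists m, hasD F w m.
  move=> sw; have w0 := lt_le_trans s0 sw.
  have h1 : hasD f (w + Complex 0 y) (cderiv f (w + Complex 0 y)).
    by apply: holo_hasD; rewrite cReD /= addr0.
  by have := hasDB (hasD_shift h1) (holo_hasD w0); eexists; eassumption.
have FK w : s <= complex.Re w -> cabs (F w) <= K + K.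
  move=> sw; have w0 := lt_le_trans s0 sw.
  by rewrite (le_trans (cabsB _ _))// lerD// fK// /Cplus/= cReD /= addr0.
have line b' : cabs (F (Complex s b')) <= dm f s * y.
  have E x : Complex s b' + x%:C%C * Complex 0 1 = Complex s (b' + x).
    by apply: complexP; rewrite !ReImE /=; ring.
  have := @path_mvt R f (Complex s b') (Complex 0 1)
    (fun x => cderiv f (Complex s (b' + x))) y (dm f s) (ltW y0).
  rewrite E => H; rewrite /F.
  have -> : Complex s b' + Complex 0 y = Complex s (b' + y).
    by apply: complexP; rewrite !ReImE /=; ring.
  apply: H => x _; first by rewrite E; exact: holo_hasD.
  by rewrite cabsM cabs_imag normr1 mulr1; exact: dm_ub.
have := poisson_bound FD FK (z := Complex t b) st line => H.
have := Hr (Complex 0 y); rewrite cabs_imag gtr0_norm// => /(_ yr) H2.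
rewrite -(ler_pM2r y0) mulrDl.
have -> : cabs (cderiv f (Complex t b)) * y = cabs (cderiv f (Complex t b) * Complex 0 y).
  by rewrite cabsM cabs_imag gtr0_norm.
have -> : cderiv f (Complex t b) * Complex 0 y = F (Complex t b) -
    (f (Complex t b + Complex 0 y) - f (Complex t b) - cderiv f (Complex t b) * Complex 0 y).
  by rewrite /F opprB addrC subrK.
by rewrite (le_trans (cabsB _ _))// addrC lerD.
Qed.

End BoundedHolomorphic.

Local Opaque cderiv dm dsup.

(** * The algebra B *)

Section BesovAlgebra.
Context {R : realType}.
Notation mu := (@lebesgue_measure R).
Notation Rpos := (`]0%R, +oo[ : set R).
Implicit Types (f g : R[i] -> R[i]).

Definition snorm f : R := fine (supnormB f).

Lemma Rpos_gt0 (s : R) : Rpos s -> 0 < s.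
Proof. by rewrite /= in_itv/= andbT. Qed.

Lemma inB_holo f : inB f -> holo f.
Proof. by case. Qed.

Lemma supnormB_fin f : (supnormB f < +oo)%E -> supnormB f = (snorm f)%:E.
Proof.
move=> h; rewrite /snorm fineK// ge0_fin_numE//.
apply: (@le_trans _ _ (cabs (f (Complex 1 0)))%:E).
  by rewrite lee_fin cabs_ge0.
by apply: ereal_sup_ubound; exists (Complex 1 0) => //; rewrite /Cplus/=.
Qed.

Lemma inB_bdd f : inB f -> bdd_by f (snorm f).
Proof.
case=> _ h _ z z0; rewrite -lee_fin -supnormB_fin//.
by apply: ereal_sup_ubound; exists z.
Qed.

Lemma snorm_le f K : inB f -> bdd_by f K -> snorm f <= K.
Proof.
case=> _ h _ fK; rewrite -lee_fin -supnormB_fin//.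
by apply: ge_ereal_sup => _ [z z0 <-]; rewrite lee_fin; exact: fK.
Qed.

Lemma B0norm_dm f K : holo f -> bdd_by f K ->
  B0norm f = (\int[mu]_(s in Rpos) (dm f s)%:E)%E.
Proof.
move=> hf fK; apply: eq_integral => s /set_mem /Rpos_gt0 s0.
exact: dsup_fin hf fK s s0.
Qed.

Lemma inB_integrable f : inB f -> mu.-integrable Rpos (EFin \o dm f).
Proof.
move=> fB; have hf := inB_holo fB; have fK := inB_bdd fB.
apply/integrableP; split.
  by apply/measurable_EFinP; exact: measurable_dm hf fK.
have [_ _ +] := fB; rewrite (B0norm_dm hf fK); apply: le_lt_trans.
rewrite le_eqVlt; apply/orP; left; apply/eqP; apply: eq_integral => s.
move=> /set_mem /Rpos_gt0 s0.
by rewrite /= ger0_norm//; exact: dm_ge0 hf fK s s0.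
Qed.

Lemma BnormE f : inB f -> Bnorm f = snorm f + Rintegral mu Rpos (dm f).
Proof.
move=> fB; rewrite /Bnorm (B0norm_dm (inB_holo fB) (inB_bdd fB)).
have [_ h _] := fB; rewrite (supnormB_fin h) fineD//.
exact: integrable_fin_num (inB_integrable fB).
Qed.

Lemma inB_intro f K (k : R -> R) : holo f -> bdd_by f K ->
  mu.-integrable Rpos (EFin \o k) ->
  (forall s b, 0 < s -> cabs (cderiv f (Complex s b)) <= k s) ->
  inB f /\ Bnorm f <= K + Rintegral mu Rpos k.
Proof.
move=> hf fK ik fk.
have dk s : 0 < s -> dm f s <= k s by move=> s0; apply: (dm_le hf fK) => // b; exact: fk.
have id : mu.-integrable Rpos (EFin \o dm f).
  apply: integrable_Rle ik _ => //; first exact: measurable_dm hf fK.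
  move=> s /Rpos_gt0 s0; rewrite ger0_norm; first exact: dk.
  exact: dm_ge0 hf fK s s0.
have fB : inB f.
  split => //.
  - apply: (@le_lt_trans _ _ K%:E); last exact: ltry.
    by apply: ge_ereal_sup => _ [z z0 <-]; rewrite lee_fin; exact: fK.
  - rewrite (B0norm_dm hf fK).
    rewrite -ge0_fin_numE; first exact: integrable_fin_num.
    apply: integral_ge0 => s /Rpos_gt0 s0; rewrite lee_fin.
    exact: dm_ge0 hf fK s s0.
split => //; rewrite BnormE// lerD//; first exact: snorm_le.
by apply: le_Rintegral => // s /Rpos_gt0; exact: dk.
Qed.

Lemma snorm_ge0 f : inB f -> 0 <= snorm f.
Proof.
move=> fB; apply: le_trans (inB_bdd fB (z := Complex 1 0) _); first exact: cabs_ge0.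
by rewrite /Cplus/=.
Qed.

Lemma Rintegral_dm_ge0 f : inB f -> 0 <= Rintegral mu Rpos (dm f).
Proof.
move=> fB; apply: Rintegral_ge0 => s /Rpos_gt0 s0.
exact: dm_ge0 (inB_holo fB) (inB_bdd fB) s s0.
Qed.

Lemma Rintegral_dm_le f : inB f -> Rintegral mu Rpos (dm f) <= Bnorm f.
Proof. by move=> fB; rewrite BnormE// lerDr snorm_ge0. Qed.

Lemma Bnorm_ge0 f : inB f -> 0 <= Bnorm f.
Proof. by move=> fB; rewrite BnormE// addr_ge0 ?snorm_ge0 ?Rintegral_dm_ge0. Qed.

Lemma inB_ub f s b : inB f -> 0 < s -> cabs (cderiv f (Complex s b)) <= dm f s.
Proof. by move=> fB; exact: dm_ub (inB_holo fB) (inB_bdd fB) s b. Qed.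

Lemma inB_hasD f z : inB f -> 0 < complex.Re z -> hasD f z (cderiv f z).
Proof. by move=> /inB_holo hf; exact: holo_hasD. Qed.

Lemma holo_intro f (d : R[i] -> R[i]) : (forall z, 0 < complex.Re z -> hasD f z (d z)) ->
  holo f.
Proof. by move=> H z z0; apply: hasD_cderivable (H z z0). Qed.

Lemma inBD f g : inB f -> inB g -> inB (fun l => f l + g l).
Proof.
move=> fB gB.
have H z : 0 < complex.Re z -> hasD (fun l => f l + g l) z (cderiv f z + cderiv g z).
  by move=> z0; apply: hasDD; exact: inB_hasD.
have [] // := @inB_intro (fun l => f l + g l) (snorm f + snorm g) (fun s => dm f s + dm g s).
- exact: holo_intro H.
- by move=> z z0; rewrite (le_trans (cabsD _ _))// lerD// inB_bdd.
- by apply: integrable_RD => //; exact: inB_integrable.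
- move=> s b s0; rewrite (hasD_cderiv (H (Complex s b) s0)).
  by rewrite (le_trans (cabsD _ _))// lerD// inB_ub.
Qed.

Lemma inBM f g : inB f -> inB g -> inB (fun l => f l * g l).
Proof.
move=> fB gB.
have H z : 0 < complex.Re z ->
    hasD (fun l => f l * g l) z (f z * cderiv g z + g z * cderiv f z).
  by move=> z0; apply: hasDM; exact: inB_hasD.
have [] // := @inB_intro (fun l => f l * g l) (snorm f * snorm g)
  (fun s => snorm f * dm g s + snorm g * dm f s).
- exact: holo_intro H.
- by move=> z z0; rewrite cabsM ler_pM ?cabs_ge0// inB_bdd.
- by apply: integrable_RD => //; apply: integrable_RZ => //; exact: inB_integrable.
- move=> s b s0; rewrite (hasD_cderiv (H (Complex s b) s0)).
  apply: le_trans (cabsD _ _) _; apply: lerD; rewrite cabsM.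
    apply: ler_pM; [exact: cabs_ge0|exact: cabs_ge0| |exact: inB_ub].
    exact: (inB_bdd fB (z := Complex s b) s0).
  apply: ler_pM; [exact: cabs_ge0|exact: cabs_ge0| |exact: inB_ub].
  exact: (inB_bdd gB (z := Complex s b) s0).
Qed.

Lemma inB_cst c : inB (fun=> c : R[i]).
Proof.
have [] // := @inB_intro (fun=> c) (cabs c) (fun s => 0 * hker 1 s).
- by move=> z _; apply: hasD_cderivable (hasD_cst c z).
- by apply: integrable_RZ => //; exact: integrable_hker.
- by move=> s b s0; rewrite (hasD_cderiv (hasD_cst c _)) cabs0 mul0r.
Qed.

Lemma inBZ c f : inB f -> inB (fun l => c * f l).
Proof. by move=> fB; exact: (@inBM (fun=> c) f (inB_cst c) fB). Qed.

Lemma inBN f : inB f -> inB (fun l => - f l).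
Proof.
move=> fB; have -> : (fun l => - f l) = (fun l => -1 * f l).
  by apply/funext => l; rewrite mulN1r.
exact: (@inBZ (-1) f fB).
Qed.

Lemma inBB f g : inB f -> inB g -> inB (fun l => f l - g l).
Proof. by move=> fB gB; exact: (@inBD f (fun l => - g l) fB (inBN gB)). Qed.

Lemma cderiv_ext f g z : 0 < complex.Re z ->
  (forall w, 0 < complex.Re w -> f w = g w) -> cderivable f z ->
  hasD g z (cderiv f z).
Proof.
move=> z0 fg /cderivable_hasD; apply: (hasD_near (d := complex.Re z)) => // w wz.
apply: fg.
have : `|complex.Re w - complex.Re z| < complex.Re z by apply: le_lt_trans (Re_dist_le _ _) wz.
rewrite ltr_norml => /andP[]; lra.
Qed.

Lemma inB_ext f g : (forall w, 0 < complex.Re w -> f w = g w) -> inB f -> inB g.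
Proof.
move=> fg fB.
have H z : 0 < complex.Re z -> hasD g z (cderiv f z).
  by move=> z0; apply: cderiv_ext => //; exact: inB_holo fB _ z0.
have [] // := @inB_intro g (snorm f) (dm f).
- exact: holo_intro H.
- by move=> z z0; rewrite -fg// inB_bdd.
- exact: inB_integrable.
- by move=> s b s0; rewrite (hasD_cderiv (H (Complex s b) s0)) inB_ub.
Qed.

Lemma inB_shift f (e : R) : 0 < e -> inB f -> inB (fun l => f (l + e%:C%C)).
Proof.
move=> e0 fB.
have H z : 0 < complex.Re z -> hasD (fun l => f (l + e%:C%C)) z (cderiv f (z + e%:C%C)).
  by move=> z0; apply: hasD_shift; apply: inB_hasD => //; rewrite cReD addr_gt0.
have [] // := @inB_intro (fun l => f (l + e%:C%C)) (snorm f) (dm f).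
- exact: holo_intro H.
- by move=> z z0; rewrite inB_bdd// /Cplus/= cReD addr_gt0.
- exact: inB_integrable.
- move=> s b s0; rewrite (hasD_cderiv (H (Complex s b) s0)).
  have -> : Complex s b + e%:C%C = Complex (s + e) b.
    by apply: complexP; rewrite !ReImE /= ?addr0.
  apply: le_trans (inB_ub _ fB (addr_gt0 s0 e0)) _.
  by apply: (dm_nonincreasing (inB_holo fB) (inB_bdd fB)) => //; rewrite lerDl ltW.
Qed.

Lemma rz_hasD (z w : R[i]) : z + w != 0 -> hasD (rz z) w (- (z + w) ^- 2).
Proof.
move=> n0; have H : hasD (fun w => z + w) w (0 + 1) by apply: hasDD; [exact: hasD_cst|exact: hasD_id].
by have := hasDV n0 H; rewrite add0r mulN1r.
Qed.

Lemma rz_lower (z w : R[i]) : 0 < complex.Re z -> 0 < complex.Re w ->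
  complex.Re z + complex.Re w <= cabs (z + w).
Proof. by move=> _ _; rewrite -cReD; exact: Re_le_cabs. Qed.

Lemma rz_neq0 (z w : R[i]) : 0 < complex.Re z -> 0 < complex.Re w -> z + w != 0.
Proof.
move=> z0 w0; rewrite -cabs_gt0 (lt_le_trans _ (rz_lower z0 w0))//.
exact: addr_gt0.
Qed.

Lemma inB_rz (z : R[i]) : 0 < complex.Re z ->
  inB (rz z) /\ Bnorm (rz z) <= 2 / complex.Re z.
Proof.
move=> z0; set x := complex.Re z.
have H w : 0 < complex.Re w -> hasD (rz z) w (- (z + w) ^- 2).
  by move=> w0; apply: rz_hasD; exact: rz_neq0.
have [||||] := @inB_intro (rz z) x^-1 (fun s => x^-1 * hker x s).
- exact: holo_intro H.
- move=> w w0; rewrite /rz cabsV lef_pV2 ?posrE ?cabs_gt0 ?rz_neq0//.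
  by rewrite (le_trans _ (rz_lower z0 w0))// lerDl ltW.
- by apply: integrable_RZ => //; exact: integrable_hker.
- move=> s b s0; rewrite (hasD_cderiv (H (Complex s b) s0)).
  rewrite cabsN cabsV cabsX /hker mulrA mulVf ?gt_eqF// mul1r.
  rewrite lef_pV2 ?posrE ?exprn_gt0 ?cabs_gt0 ?rz_neq0 ?addr_gt0//.
  by rewrite lerXn2r ?nnegrE ?cabs_ge0 ?(rz_lower z0 (w := Complex s b))// ltW// addr_gt0.
- move=> rB /le_trans H2; split => //; apply: H2.
  rewrite RintegralZl//; last exact: integrable_hker.
  by rewrite Rintegral_hker// mulr1 mulrDl mul1r.
Qed.

End BesovAlgebra.

(** * The limit at infinity and the tail of the derivative *)

Section ValueAtInfinity.
Context {R : realType}.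
Notation mu := (@lebesgue_measure R).
Notation Rpos := (`]0%R, +oo[ : set R).
Implicit Types (f g : R[i] -> R[i]).

Instance Re_to_infty_proper : ProperFilter (Re_to_infty R).
Proof.
apply: Build_ProperFilter.
- by move=> [M HM]; have := HM (Complex (M + 1) 0); rewrite /= ltrDl => /(_ ltr01).
- split.
  + by exists 0.
  + move=> P Q [M HM] [N HN]; exists (Num.max M N) => z.
    by rewrite gt_max => /andP[/HM ? /HN ?].
  + by move=> P Q PQ [M HM]; exists M => z /HM; exact: PQ.
Qed.

Lemma finfty_unique f (L : R[i]) :
  (forall e : R, 0 < e -> exists M, forall z, M < complex.Re z -> cabs (f z - L) < e) ->
  finfty f = L.
Proof.
move=> H; rewrite /finfty.
have -> : [set P : set R[i]^o | Re_to_infty R (f @^-1` P)] =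
  (f : R[i]^o -> R[i]^o) @ Re_to_infty R by [].
apply: (@cvg_lim R[i]^o) => //; apply/cvgrPdist_lt => /= e /gt0_complexE[eE e0].
have [M HM] := H _ e0; exists M => z /HM.
by rewrite eE cabs_norm ltcR cabsBC.
Qed.

(** The tail of the [B_0] integral beyond [s]; it controls the oscillation of [f] on [Re z >= s].
    The truncation sits in the integrand so that all tails live on one domain, ready for dominated
    convergence. *)
Definition om f (s : R) : R := Rintegral mu Rpos (fun t => if s <= t then dm f t else 0).

Let tail_meas f (s : R) : inB f ->
  measurable_fun Rpos (fun t => if s <= t then dm f t else 0).
Proof.
move=> fB; apply: measurable_fun_if => //.
- exact: measurable_fun_ler.
- by apply: measurable_funS (measurable_dm (inB_holo fB) (inB_bdd fB)).
Qed.

Let tail_bound f s t : inB f -> 0 < t ->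
  0 <= (if s <= t then dm f t else 0) <= dm f t.
Proof.
move=> fB t0; have d0 := dm_ge0 (inB_holo fB) (inB_bdd fB) t0.
by case: ifP => _; rewrite lexx ?d0.
Qed.

Let tail_integrable f s : inB f ->
  mu.-integrable Rpos (EFin \o (fun t => if s <= t then dm f t else 0)).
Proof.
move=> fB; apply: integrable_Rle (inB_integrable fB) _ => //; first exact: tail_meas.
move=> t /Rpos_gt0 t0; have /andP[h1 h2] := tail_bound s fB t0.
by rewrite ger0_norm.
Qed.

Lemma om_le f s : inB f -> om f s <= Rintegral mu Rpos (dm f).
Proof.
move=> fB; apply: le_Rintegral => //; [exact: tail_integrable|exact: inB_integrable|].
by move=> t /Rpos_gt0 t0; have /andP[] := tail_bound s fB t0.
Qed.

Lemma om_nonincreasing f s s' : inB f -> s <= s' -> om f s' <= om f s.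
Proof.
move=> fB ss; apply: le_Rintegral => //; [exact: tail_integrable..|].
move=> t /Rpos_gt0 t0; case: (leP s' t) => [st|_].
  by rewrite (le_trans ss st).
by have /andP[] := tail_bound s fB t0.
Qed.

Lemma om_small f (e : R) : inB f -> 0 < e -> exists N : nat,
  forall s, N%:R <= s -> om f s < e.
Proof.
move=> fB e0.
have [|n t /Rpos_gt0|t /Rpos_gt0 t0 r r0|N HN] := @Rintegral_dominated0 R Rpos
  (fun n t => if n%:R <= t then dm f t else 0) (dm f) (measurable_itv _) _
  (inB_integrable fB) _ _ e e0.
- by move=> n; exact: tail_meas.
- exact: tail_bound.
- exists (Num.bound t) => n tn; rewrite ifF//; apply/negbTE; rewrite -ltNge.
  by rewrite (lt_le_trans (archi_boundP (ltW t0)))// ler_nat.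
exists N => s Ns; apply: le_lt_trans (HN N (leqnn N)).
exact: om_nonincreasing.
Qed.

Lemma inB_horizontal f s s' b : inB f -> 0 < s -> s <= s' ->
  cabs (f (Complex s' b) - f (Complex s b)) <= om f s.
Proof.
move=> fB s0 ss.
have E (t : R) : Complex 0 b + t%:C%C = Complex t b.
  by apply: complexP; rewrite !ReImE /= ?add0r ?addr0.
have hf := inB_holo fB; have fK := inB_bdd fB.
have sub : `[s, s'] `<=` Rpos.
  by move=> t /=; rewrite !in_itv/= andbT => /andP[st _]; exact: lt_le_trans st.
have ids : mu.-integrable `[s, s'] (EFin \o dm f).
  by apply: integrableS (inB_integrable fB).
have := @path_ftc R f (Complex 0 b) (fun t => cderiv f (Complex t b)) s s' (dm f) ss.
rewrite !E => H; apply: le_trans (H _ _ ids _) _.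
- by move=> t /andP[st _]; rewrite E; apply: inB_hasD => //; exact: lt_le_trans st.
- move=> t /andP[st _]; apply: (cderiv_hcont hf fK); exact: lt_le_trans st.
- by move=> t /andP[st _]; apply: inB_ub => //; exact: lt_le_trans st.
have -> : Rintegral mu `[s, s'] (dm f) =
    Rintegral mu Rpos (fun t => if s <= t <= s' then dm f t else 0).
  have -> : `[s, s'] = Rpos `&` `[s, s'] by rewrite setIC; apply/esym/setIidPl.
  rewrite Rintegral_mkcondr; apply: eq_Rintegral => t _; rewrite patchE.
  case: ifPn => [/set_mem|]; first by rewrite /= in_itv/= => ->.
  by rewrite notin_setE /= in_itv/= => /negP/negbTE ->.
apply: le_Rintegral => //; last 2 first.
- exact: tail_integrable.
- move=> t /Rpos_gt0 t0; case: (leP s t) => //= _; case: ifP => // _.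
  exact: dm_ge0 hf fK t t0.
apply: (@integrable_Rle _ _ _ (dm f)) => //; last first.
- move=> t /Rpos_gt0 t0; have d0 := dm_ge0 hf fK t0.
  by case: ifP => _; rewrite ?normr0 ?ger0_norm.
- exact: inB_integrable.
apply: measurable_fun_if => //.
- by apply: measurable_and; apply: measurable_fun_ler.
- by apply: measurable_funS (measurable_dm hf fK) => // t [].
Qed.

Lemma inB_vertical f s b b' : inB f -> 0 < s -> b <= b' ->
  cabs (f (Complex s b') - f (Complex s b)) <= snorm f / s * (b' - b).
Proof.
move=> fB s0 bb.
have E x : Complex s b + x%:C%C * Complex 0 1 = Complex s (b + x).
  by apply: complexP; rewrite !ReImE /=; ring.
have := @path_mvt R f (Complex s b) (Complex 0 1)
  (fun x => cderiv f (Complex s (b + x))) (b' - b) (snorm f / s).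
rewrite E (addrC b) subrK; apply.
- by rewrite subr_ge0.
- by move=> t _; rewrite E; exact: inB_hasD.
- move=> t _; rewrite cabsM cabs_imag normr1 mulr1.
  exact: (holo_deriv_le (inB_holo fB) (inB_bdd fB) (z := Complex s (b + t))).
Qed.

(** The values at positive integers form a Cauchy sequence because the tails vanish. From [z] one
    moves horizontally to abscissa [n.+1], at cost [om f (Re z)], and then vertically to the real
    axis, at cost [snorm f * |Im z| / n.+1], which tends to 0. *)
Lemma inB_limit f : inB f -> exists L, forall z, 0 < complex.Re z ->
  cabs (f z - L) <= om f (complex.Re z).
Proof.
move=> fB.
have cau (u : R[i] -> R) : (forall z w, `|u z - u w| <= cabs (z - w)) ->
    cvg ((fun n : nat => u (f (Complex n.+1%:R 0))) @ \oo).
  move=> uL; apply: R_complete; apply: cauchy_exP => e e0.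
  have [N HN] := om_small fB e0.
  exists (u (f (Complex N.+1%:R 0))); exists N => // n /= Nn.
  rewrite /ball /=; apply: le_lt_trans (uL _ _) _; rewrite cabsBC.
  apply: le_lt_trans (inB_horizontal 0 fB _ _) _ => //.
    by rewrite ler_nat.
  by apply: HN; rewrite ler_nat.
have uRe z w : `|complex.Re z - complex.Re w| <= cabs (z - w) :> R.
  by rewrite -cReN -cReD cabs_Re.
have uIm z w : `|complex.Im z - complex.Im w| <= cabs (z - w) :> R.
  by rewrite -cImN -cImD cabs_Im.
pose L := Complex (lim ((fun n : nat => complex.Re (f (Complex n.+1%:R 0))) @ \oo))
  (lim ((fun n : nat => complex.Im (f (Complex n.+1%:R 0))) @ \oo)).
have HL (e : R) : 0 < e -> exists N, forall n, (N <= n)%N -> cabs (f (Complex n.+1%:R 0) - L) < e.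
  move=> e0; have e2 : 0 < e / 2 by rewrite divr_gt0.
  have /cvgrPdist_lt/(_ _ e2)[N1 _ H1] := cau _ uRe.
  have /cvgrPdist_lt/(_ _ e2)[N2 _ H2] := cau _ uIm.
  exists (maxn N1 N2) => n; rewrite geq_max => /andP[n1 n2].
  rewrite (le_lt_trans (cabs_ReIm _))// !ReImE [e]splitr ltrD//.
    by rewrite distrC; exact: H1.
  by rewrite distrC; exact: H2.
exists L => z z0; apply/ler_addgt0Pl => e e0.
have e2 : 0 < e / 2 by rewrite divr_gt0.
have [N HN] := HL _ e2.
pose B := snorm f * `|complex.Im z|.
have B0 : 0 <= B by rewrite mulr_ge0// snorm_ge0.
pose n := maxn N (maxn (Num.bound (complex.Re z)) (Num.bound (B / (e / 2)))).
have nN : (N <= n)%N by rewrite leq_maxl.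
have nz : complex.Re z <= n.+1%:R.
  apply: (@le_trans _ _ (Num.bound (complex.Re z))%:R).
    by rewrite ltW// archi_boundP// ltW.
  by rewrite ler_nat (leq_trans _ (leqnSn _))// /n !leq_max leqnn !orbT.
have nB : B / (e / 2) <= n.+1%:R.
  apply: (@le_trans _ _ (Num.bound (B / (e / 2)))%:R).
    by rewrite ltW// archi_boundP// divr_ge0// ltW.
  by rewrite ler_nat (leq_trans _ (leqnSn _))// /n !leq_max leqnn !orbT.
have zE : z = Complex (complex.Re z) (complex.Im z) by case: (z).
have H1 := inB_horizontal (complex.Im z) fB z0 nz.
have H2 : cabs (f (Complex n.+1%:R (complex.Im z)) - f (Complex n.+1%:R 0)) <= e / 2.
  apply: (@le_trans _ _ (B / n.+1%:R)); last first.
    by rewrite ler_pdivrMr// mulrC -ler_pdivrMr.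
  have [i0|i0] := leP 0 (complex.Im z).
    apply: le_trans (inB_vertical fB _ i0) _ => //.
    by rewrite subr0 /B ger0_norm// mulrAC.
  rewrite cabsBC; apply: le_trans (inB_vertical fB _ (ltW i0)) _ => //.
  by rewrite sub0r /B ltr0_norm// mulrAC.
rewrite -zE cabsBC in H1.
apply: le_trans (cabs_triangle _ (f (Complex n.+1%:R (complex.Im z))) _) _.
rewrite addrC lerD//.
apply: le_trans (cabs_triangle _ (f (Complex n.+1%:R 0)) _) _.
by rewrite [e]splitr lerD// ltW// HN.
Qed.

Lemma finfty_le f z : inB f -> 0 < complex.Re z ->
  cabs (f z - finfty f) <= om f (complex.Re z).
Proof.
move=> fB z0; have [L HL] := inB_limit fB.
suff -> : finfty f = L by exact: HL.
apply: finfty_unique => e e0; have [N HN] := om_small fB e0.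
exists N%:R => w Nw; apply: le_lt_trans (HL _ _) _.
  by apply: le_lt_trans Nw.
by apply: HN; exact: ltW.
Qed.

Lemma finfty_lim f : inB f -> forall e : R, 0 < e ->
  exists M, forall z, M < complex.Re z -> cabs (f z - finfty f) < e.
Proof.
move=> fB e e0; have [N HN] := om_small fB e0.
exists N%:R => w Nw; apply: le_lt_trans (finfty_le fB _) _.
  by apply: le_lt_trans Nw.
by apply: HN; exact: ltW.
Qed.

Lemma inB_sup_le f : inB f -> finfty f = 0 -> Bnorm f <= 2 * Rintegral mu Rpos (dm f).
Proof.
move=> fB f0; rewrite BnormE// mulr_natl mulr2n lerD2r; apply: snorm_le => // z z0.
have := finfty_le fB z0; rewrite f0 subr0 => /le_trans; apply.
exact: om_le.
Qed.

End ValueAtInfinity.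

(** * Approximation by superpositions of resolvent functions *)

Section Superposition.
Context {R : realType}.
Notation mu := (@lebesgue_measure R).
Notation Rpos := (`]0%R, +oo[ : set R).
Variables (sigma : R).
Hypothesis sigma0 : 0 < sigma.

(** The sign comes from Cauchy's formula on [Re w = sigma]:
    [l + 2 sigma - (sigma + i t) = pole t + l]. *)
Definition pole (t : R) : R[i] := Complex sigma (- t).

Definition superpos (D : set R) (c : R -> R[i]) (l : R[i]) : R[i] :=
  cint D (fun t => c t * rz (pole t) l).

Let pole_lower t l : 0 < complex.Re l -> sigma + complex.Re l <= cabs (pole t + l).
Proof. by move=> l0; exact: (rz_lower (z := pole t) sigma0 l0). Qed.

Let pole_neq0 t l : 0 < complex.Re l -> pole t + l != 0.
Proof. by move=> l0; exact: (rz_neq0 (z := pole t) sigma0 l0). Qed.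

Lemma rz_pole_le t l : 0 < complex.Re l ->
  cabs (rz (pole t) l) <= (sigma + complex.Re l)^-1.
Proof.
move=> l0; rewrite /rz cabsV lef_pV2 ?posrE ?cabs_gt0 ?pole_neq0 ?pole_lower//.
exact: addr_gt0.
Qed.

Lemma rz_pole_lip t u l : 0 < complex.Re l ->
  cabs (rz (pole t) l - rz (pole u) l) <= `|t - u| / (sigma + complex.Re l) ^+ 2.
Proof.
move=> l0; have a0 : 0 < sigma + complex.Re l by exact: addr_gt0.
have n1 := pole_neq0 t l0; have n2 := pole_neq0 u l0.
have -> : rz (pole t) l - rz (pole u) l = (pole u - pole t) * (rz (pole t) l * rz (pole u) l).
  by rewrite /rz; field; rewrite n1 n2.
rewrite cabsM; apply: ler_pM; rewrite ?cabs_ge0//.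
  by apply: le_trans (vline_lip _ _ _) _; rewrite opprK addrC.
rewrite cabsM expr2 invfM; apply: ler_pM; rewrite ?cabs_ge0 ?rz_pole_le//.
Qed.

Lemma rz_pole_meas D l : measurable D -> 0 < complex.Re l ->
  cmeas D (fun t => rz (pole t) l).
Proof.
move=> mD l0; apply: cmeas_setT => //; apply: pcont_cmeasT => t e e0.
have a0 : 0 < (sigma + complex.Re l) ^+ 2 by rewrite exprn_gt0// addr_gt0.
exists (e * (sigma + complex.Re l) ^+ 2); first exact: mulr_gt0.
by move=> s st; apply: le_lt_trans (rz_pole_lip _ _ l0) _; rewrite ltr_pdivrMr.
Qed.

Section Coefficient.
Variables (D : set R) (c : R -> R[i]).
Hypotheses (mD : measurable D) (ic : cintegrable D c).

Let C := Rintegral mu D (fun t => cabs (c t)).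
Let ica := cintegrable_cabs mD ic.
Let mc := cmeas_of_cintegrable ic.

Let C0 : 0 <= C.
Proof. by apply: Rintegral_ge0 => t _; exact: cabs_ge0. Qed.

Lemma superpos_le_gen (k : R -> R[i]) B : cmeas D k -> 0 <= B ->
  (forall t, D t -> cabs (k t) <= B) ->
  cintegrable D (fun t => c t * k t) /\
  cabs (cint D (fun t => c t * k t)) <= B * C.
Proof.
move=> mk B0 kB.
have iB := integrable_RZ B mD ica.
have bd t : D t -> cabs (c t * k t) <= B * cabs (c t).
  by move=> Dt; rewrite cabsM mulrC ler_wpM2r ?cabs_ge0// kB.
have ick : cintegrable D (fun t => c t * k t).
  by apply: cintegrable_dom iB bd => //; exact: cmeasM.
split => //; rewrite /C -RintegralZl//.
exact: cint_le.
Qed.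

Lemma superpos_integrable l : 0 < complex.Re l ->
  cintegrable D (fun t => c t * rz (pole t) l).
Proof.
move=> l0; have [|||] // := @superpos_le_gen (fun t => rz (pole t) l) (sigma + complex.Re l)^-1.
- exact: rz_pole_meas.
- by rewrite invr_ge0 ltW// addr_gt0.
- by move=> t _; exact: rz_pole_le.
Qed.

Definition superpos' l : R[i] := cint D (fun t => c t * - rz (pole t) l ^+ 2).

Let sqr_meas l : 0 < complex.Re l -> cmeas D (fun t => - rz (pole t) l ^+ 2).
Proof.
by move=> l0; apply: cmeasN; apply: cmeasM; exact: rz_pole_meas.
Qed.

Let sqr_le t l : 0 < complex.Re l ->
  cabs (- rz (pole t) l ^+ 2) <= ((sigma + complex.Re l) ^+ 2)^-1.
Proof.
move=> l0; rewrite cabsN cabsX -exprVn lerXn2r ?nnegrE ?cabs_ge0 ?rz_pole_le//.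
by rewrite invr_ge0 ltW// addr_gt0.
Qed.

Lemma superpos'_integrable l : 0 < complex.Re l ->
  cintegrable D (fun t => c t * - rz (pole t) l ^+ 2).
Proof.
move=> l0; have [//||//] := @superpos_le_gen (fun t => - rz (pole t) l ^+ 2)
  ((sigma + complex.Re l) ^+ 2)^-1 (sqr_meas l0).
- by rewrite invr_ge0 sqr_ge0.
- by move=> t _; exact: sqr_le.
Qed.

(** The remainder of [r_z] is explicit: [r_z(l + h) - r_z(l) + h r_z(l)^2 = h^2 r_z(l)^2 r_z(l +
    h)]. It is at most [|h|^2 / sigma^3] uniformly in the pole, so integration against [c] keeps it
    quadratic in [h]. *)
Lemma superpos_hasD l : 0 < complex.Re l -> hasD (superpos D c) l (superpos' l).
Proof.
move=> l0 e e0.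
pose B := C / sigma ^+ 3 + 1.
have B0 : 0 < B by rewrite ltr_wpDl// divr_ge0// exprn_ge0// ltW.
exists (Num.min (complex.Re l) (e / B)); first by rewrite lt_min l0 divr_gt0.
move=> h; rewrite lt_min => /andP[hl he].
have lh0 : 0 < complex.Re (l + h).
  rewrite cReD; have := le_lt_trans (cabs_Re h) hl; rewrite ltr_norml => /andP[].
  lra.
pose k t := h ^+ 2 * (rz (pole t) l ^+ 2 * rz (pole t) (l + h)).
have E t : c t * rz (pole t) (l + h) - c t * rz (pole t) l -
    h * (c t * - rz (pole t) l ^+ 2) = c t * k t.
  rewrite /k /rz; have n1 := pole_neq0 t l0; have n2 := pole_neq0 t lh0.
  rewrite addrA in n2 *.
  by field; rewrite n1 n2.
have mk : cmeas D k.
  apply: cmeasM; first exact: cmeas_cst.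
  apply: cmeasM; last exact: rz_pole_meas.
  by apply: cmeasM; exact: rz_pole_meas.
have kB t : D t -> cabs (k t) <= cabs h ^+ 2 / sigma ^+ 3.
  move=> _; rewrite /k cabsM cabsX ler_wpM2l ?sqr_ge0// cabsM cabsX.
  have -> : (sigma ^+ 3)^-1 = sigma^-1 ^+ 2 * sigma^-1 by rewrite exprSr invfM exprVn.
  have s1 l' : 0 < complex.Re l' -> cabs (rz (pole t) l') <= sigma^-1.
    move=> l'0; apply: le_trans (rz_pole_le t l'0) _.
    by rewrite lef_pV2 ?posrE ?addr_gt0// lerDl ltW.
  apply: ler_pM; rewrite ?sqr_ge0 ?cabs_ge0 ?s1//.
  by rewrite lerXn2r ?nnegrE ?cabs_ge0 ?s1// invr_ge0 ltW.
have [ik H] := superpos_le_gen mk (divr_ge0 (sqr_ge0 _) (exprn_ge0 3 (ltW sigma0))) kB.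
have -> : superpos D c (l + h) - superpos D c l - superpos' l * h = cint D (fun t => c t * k t).
  rewrite (mulrC _ h) /superpos /superpos' -cintZ//; last exact: superpos'_integrable.
  rewrite -cintB//; [|exact: superpos_integrable..].
  rewrite -cintB//; last 2 first.
  - by apply: cintegrableB => //; exact: superpos_integrable.
  - by apply: cintegrableZ => //; exact: superpos'_integrable.
  by apply: eq_cint => t _; exact: E.
apply: le_trans H _.
have -> : cabs h ^+ 2 / sigma ^+ 3 * C = cabs h * (C / sigma ^+ 3) * cabs h by ring.
rewrite ler_wpM2r ?cabs_ge0//.
apply: (@le_trans _ _ (cabs h * B)); first by rewrite ler_wpM2l ?cabs_ge0// lerDl.
by rewrite -ler_pdivlMr// ltW.
Qed.

Lemma inB_superpos : inB (superpos D c) /\ Bnorm (superpos D c) <= 2 / sigma * C.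
Proof.
have [||||iB H] := @inB_intro R (superpos D c) (C / sigma) (fun s => C / sigma * hker sigma s).
- exact: holo_intro superpos_hasD.
- move=> z z0.
  have [||_ H] := @superpos_le_gen (fun t => rz (pole t) z) sigma^-1 (rz_pole_meas mD z0).
  + by rewrite invr_ge0 ltW.
  + move=> t _; apply: le_trans (rz_pole_le t z0) _.
    by rewrite lef_pV2 ?posrE ?addr_gt0// lerDl ltW.
  + by rewrite mulrC.
- by apply: integrable_RZ => //; exact: integrable_hker.
- move=> s b s0; rewrite (hasD_cderiv (superpos_hasD (l := Complex s b) s0)).
  have [||_ H] := @superpos_le_gen (fun t => - rz (pole t) (Complex s b) ^+ 2)
    ((sigma + s) ^+ 2)^-1 (sqr_meas (l := Complex s b) s0).
  + by rewrite invr_ge0 sqr_ge0.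
  + by move=> t _; exact: (sqr_le t (l := Complex s b) s0).
  + apply: le_trans H _; rewrite /hker le_eqVlt; apply/orP; left; apply/eqP.
    have n1 : sigma + s != 0 by rewrite gt_eqF// addr_gt0.
    have n2 : sigma != 0 by rewrite gt_eqF.
    by move: (C) => C1; field; rewrite n1 n2.
split => //; apply: le_trans H _.
rewrite RintegralZl//; last exact: integrable_hker.
rewrite Rintegral_hker// mulr1 (_ : 2 / sigma * C = C / sigma + C / sigma) ?lexx//.
by move: (C) => C1; ring.
Qed.

End Coefficient.

(** The error of one Riemann cell is quadratic in its length: one factor from integrating, one from
    the Lipschitz dependence on [t] of [c] and of the pole. In the constant, [L / sigma] comes once
    from the supremum and once from the derivative, and [M / sigma ^+ 2] once from the supremum and
    twice from the derivative of the square. *)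
Lemma superpos_cell (c : R -> R[i]) (a b L M : R) : a <= b -> 0 <= L -> 0 <= M ->
  (forall t u, cabs (c t - c u) <= L * `|t - u|) -> (forall t, cabs (c t) <= M) ->
  let e := fun l => superpos `[a, b] c l - ((b - a)%:C%C * c a) * rz (pole a) l in
  inB e /\ Bnorm e <= (2 * L / sigma + 3 * M / sigma ^+ 2) * (b - a) ^+ 2.
Proof.
move=> ab L0 M0 cL cM e; pose d := b - a.
have d0 : 0 <= d by rewrite subr_ge0.
have mD : measurable (`[a, b] : set R) by exact: measurable_itv.
have cc t : pcont c t.
  move=> r r0; exists (r / (L + 1)); first by rewrite divr_gt0// ltr_wpDl.
  move=> s; rewrite ltr_pdivlMr ?ltr_wpDl// => sr; apply: le_lt_trans (cL _ _) _.
  apply: le_lt_trans sr; rewrite mulrC ler_wpM2l// lerDl//.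
have ic : cintegrable `[a, b] c by apply: cintegrable_itv => t _; exact: cc.
have icst (w : R[i]) : cintegrable `[a, b] (fun=> w).
  by apply: cintegrable_itv => t _ r r0; exists 1 => // s _; rewrite subrr cabs0.
have He l : 0 < complex.Re l -> hasD e l (superpos' `[a, b] c l -
    ((b - a)%:C%C * c a) * - rz (pole a) l ^+ 2).
  move=> l0; apply: hasDB; first exact: superpos_hasD.
  apply: hasDZ; have := rz_hasD (pole_neq0 a l0).
  by rewrite /rz exprVn.
pose A l := sigma + complex.Re l.
have A0 l : 0 < complex.Re l -> 0 < A l by move=> l0; exact: addr_gt0.
have tab t : a <= t <= b -> `|t - a| <= d.
  by move=> /andP[h1 h2]; rewrite ger0_norm ?subr_ge0// lerD2r.
have [||||iB H] := @inB_intro R e ((L / sigma + M / sigma ^+ 2) * d ^+ 2)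
  (fun s => (L / sigma + 2 * M / sigma ^+ 2) * d ^+ 2 * hker sigma s).
- exact: holo_intro He.
- move=> l l0.
  have -> : e l = cint `[a, b] (fun t => c t * rz (pole t) l - c a * rz (pole a) l).
    rewrite cintB//; last exact: superpos_integrable.
    by rewrite cint_cst// /e mulrA.
  rewrite (_ : _ * d ^+ 2 = d * ((L / sigma + M / sigma ^+ 2) * d)); last by ring.
  apply: cint_itv_le => //.
    by apply: cintegrableB => //; exact: superpos_integrable.
  move=> t /tab td.
  have -> : c t * rz (pole t) l - c a * rz (pole a) l =
    (c t - c a) * rz (pole t) l + c a * (rz (pole t) l - rz (pole a) l) by ring.
  apply: le_trans (cabsD _ _) _; rewrite !cabsM mulrDl; apply: lerD.
    have -> : L / sigma * d = L * d * sigma^-1 by ring.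
    apply: ler_pM; rewrite ?cabs_ge0//.
      by apply: le_trans (cL _ _) _; rewrite ler_wpM2l.
    apply: le_trans (rz_pole_le t l0) _.
    by rewrite lef_pV2 ?posrE ?A0// lerDl ltW.
  have -> : M / sigma ^+ 2 * d = M * (d / sigma ^+ 2) by ring.
  apply: ler_pM; rewrite ?cabs_ge0//.
  apply: le_trans (rz_pole_lip _ _ l0) _.
  apply: ler_pM; rewrite ?normr_ge0 ?invr_ge0 ?sqr_ge0//.
  rewrite lef_pV2 ?posrE ?exprn_gt0 ?A0//.
  by rewrite lerXn2r ?nnegrE ?(ltW sigma0) ?(ltW (A0 _ l0))// lerDl ltW.
- by apply: integrable_RZ => //; exact: integrable_hker.
- move=> s y s0; set l := Complex s y.
  have l0 : 0 < complex.Re l by [].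
  have As0 : 0 < sigma + s by exact: addr_gt0.
  rewrite (hasD_cderiv (He l l0)).
  have -> : superpos' `[a, b] c l - (b - a)%:C%C * c a * - rz (pole a) l ^+ 2 =
      cint `[a, b] (fun t => c t * - rz (pole t) l ^+ 2 - c a * - rz (pole a) l ^+ 2).
    rewrite cintB//; last exact: superpos'_integrable.
    by rewrite cint_cst// mulrA.
  rewrite (_ : _ * hker sigma s =
    d * ((L * d) / (sigma + s) ^+ 2 + 2 * M / sigma * d / (sigma + s) ^+ 2)); last first.
    by rewrite /hker; field; rewrite !gt_eqF.
  apply: cint_itv_le => //.
    by apply: cintegrableB => //; exact: superpos'_integrable.
  move=> t /tab td.
  have -> : c t * - rz (pole t) l ^+ 2 - c a * - rz (pole a) l ^+ 2 =
    - ((c t - c a) * rz (pole t) l ^+ 2 +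
       c a * ((rz (pole t) l - rz (pole a) l) * (rz (pole t) l + rz (pole a) l))) by ring.
  rewrite cabsN; apply: le_trans (cabsD _ _) _; rewrite !cabsM; apply: lerD.
    apply: ler_pM; rewrite ?mulr_ge0 ?cabs_ge0//.
      by apply: le_trans (cL _ _) _; rewrite ler_wpM2l.
    rewrite -expr2 -exprVn lerXn2r ?nnegrE ?cabs_ge0 ?invr_ge0 ?(ltW As0)//.
    exact: (rz_pole_le t l0).
  have -> : 2 * M / sigma * d / (sigma + s) ^+ 2 = M * (d / (sigma + s) ^+ 2 * (2 / sigma)).
    by field; rewrite !gt_eqF.
  apply: ler_pM; rewrite ?cabs_ge0 ?mulr_ge0 ?cabs_ge0//.
  apply: ler_pM; rewrite ?cabs_ge0//.
    apply: le_trans (rz_pole_lip _ _ l0) _.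
    by rewrite ler_wpM2r// invr_ge0 sqr_ge0.
  apply: le_trans (cabsD _ _) _; rewrite mulrDl mul1r; apply: lerD.
    apply: le_trans (rz_pole_le t l0) _.
    by rewrite lef_pV2 ?posrE// lerDl ltW.
  apply: le_trans (rz_pole_le a l0) _.
  by rewrite lef_pV2 ?posrE// lerDl ltW.
split => //; apply: le_trans H _.
rewrite RintegralZl//; last exact: integrable_hker.
rewrite Rintegral_hker// mulr1 le_eqVlt; apply/orP; left; apply/eqP.
by rewrite /d; field; rewrite gt_eqF.
Qed.

End Superposition.

Local Opaque inB Bnorm.

(** Common form of the two defects to be shown zero: the distance between two calculi at a vector,
    and the distance between the two sides of the formula. *)
Definition Bseminorm (R : realType) (p : (R[i] -> R[i]) -> R) (K : R) : Prop :=
  [/\ forall f g, inB f -> inB g -> p (fun l => f l + g l) <= p f + p g,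
      forall c f, inB f -> p (fun l => c * f l) <= cabs c * p f,
      0 <= K & forall f, inB f -> p f <= K * Bnorm f].

Section Approximation.
Context {R : realType}.
Notation mu := (@lebesgue_measure R).
Notation Rpos := (`]0%R, +oo[ : set R).
Variables (p : (R[i] -> R[i]) -> R) (K : R).
Hypothesis pK : Bseminorm p K.
Hypothesis pr : forall z, Cplus R z -> p (rz z) = 0.

Let pD f g : inB f -> inB g -> p (fun l => f l + g l) <= p f + p g.
Proof. by case: pK => h _ _ _; exact: h. Qed.

Let pZ c f : inB f -> p (fun l => c * f l) <= cabs c * p f.
Proof. by case: pK => _ h _ _; exact: h. Qed.

Let K0 : 0 <= K.
Proof. by case: pK. Qed.

Let pB f : inB f -> p f <= K * Bnorm f.
Proof. by case: pK => _ _ _ h; exact: h. Qed.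

Lemma Bnorm_null (f : R[i] -> R[i]) : (forall w, 0 < complex.Re w -> f w = 0) -> inB f /\ Bnorm f <= 0.
Proof.
move=> f0.
have fB : inB f by apply: (@inB_ext R (fun=> 0)); [move=> w /f0 ->|exact: inB_cst].
have H z : 0 < complex.Re z -> hasD f z 0.
  move=> z0; rewrite -(hasD_cderiv (hasD_cst 0 z)).
  apply: cderiv_ext => //; first by move=> w /f0 ->.
  exact: hasD_cderivable (hasD_cst 0 z).
have [||||_ +] := @inB_intro R f 0 (fun s => 0 * hker 1 s).
- exact: holo_intro H.
- by move=> z z0; rewrite f0// cabs0.
- by apply: integrable_RZ => //; exact: integrable_hker.
- by move=> s b s0; rewrite (hasD_cderiv (H (Complex s b) s0)) cabs0 mul0r.
- by rewrite RintegralZl ?mul0r ?add0r//; exact: integrable_hker.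
Qed.

Lemma p_le_diff f g : inB f -> inB g ->
  p f <= p g + K * Bnorm (fun l => f l - g l).
Proof.
move=> fB gB; have dB := inBB fB gB.
have E : f = (fun l => g l + (f l - g l)) by apply/funext => l; rewrite addrC subrK.
rewrite {1}E; apply: le_trans (pD gB dB) _.
by rewrite lerD2l; exact: pB.
Qed.

(** Members of [inB] carry arbitrary values outside the half-plane and [p] receives the whole
    function. The difference of [f] and [g] has B-norm at most 0, so the bound on [p] makes those
    values irrelevant. *)
Lemma p_le_ext f g : inB f -> (forall w, 0 < complex.Re w -> f w = g w) -> p f <= p g.
Proof.
move=> fB fg; have gB := inB_ext fg fB.
apply: le_trans (p_le_diff fB gB) _; rewrite gerDl.
have N w : 0 < complex.Re w -> f w - g w = 0 by move=> w0; rewrite fg// subrr.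
have [_ H] := @Bnorm_null (fun l => f l - g l) N.
by rewrite mulr_ge0_le0.
Qed.

Section Coefficients.
Variables (sigma : R) (c : R -> R[i]) (L M : R).
Hypotheses (sigma0 : 0 < sigma) (L0 : 0 <= L) (M0 : 0 <= M).
Hypothesis cL : forall t u, cabs (c t - c u) <= L * `|t - u|.
Hypothesis cM : forall t, cabs (c t) <= M.

Let ic a b : cintegrable `[a, b] c.
Proof.
apply: cintegrable_itv => t _ r r0; exists (r / (L + 1)); first by rewrite divr_gt0// ltr_wpDl.
move=> s; rewrite ltr_pdivlMr ?ltr_wpDl// => sr; apply: le_lt_trans (cL _ _) _.
by apply: le_lt_trans sr; rewrite mulrC ler_wpM2l// lerDl.
Qed.

Let C1 := 2 * L / sigma + 3 * M / sigma ^+ 2.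

Let cell a b : a <= b -> p (superpos sigma `[a, b] c) <= K * C1 * (b - a) ^+ 2.
Proof.
move=> ab; have /= [eB eN] := superpos_cell sigma0 ab L0 M0 cL cM.
have [rB _] := inB_rz (z := pole sigma a) sigma0.
set k := (b - a)%:C%C * c a in eB eN.
have E : superpos sigma `[a, b] c =
   (fun l => (superpos sigma `[a, b] c l - k * rz (pole sigma a) l) + k * rz (pole sigma a) l).
  by apply/funext => l; rewrite subrK.
rewrite E; apply: le_trans (pD eB (inBZ k rB)) _.
have H1 : p (fun l => k * rz (pole sigma a) l) <= 0.
  by apply: le_trans (pZ k rB) _; rewrite pr ?mulr0.
rewrite -[leRHS]addr0; apply: lerD => //.
by apply: le_trans (pB eB) _; rewrite -mulrA ler_wpM2l.
Qed.

Let cells a d n : 0 <= d -> p (superpos sigma `[a, a + n%:R * d] c) <= n%:R * (K * C1 * d ^+ 2).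
Proof.
move=> d0; elim: n => [|n IH].
  rewrite !mul0r addr0; have := cell (lexx a).
  by rewrite subrr expr0n mulr0.
have nd : a <= a + n%:R * d by rewrite lerDl mulr_ge0.
have nd1 : a + n%:R * d <= a + n.+1%:R * d by rewrite lerD2l ler_wpM2r// ler_nat.
have [sB _] := inB_superpos sigma0 (measurable_itv _) (ic a (a + n%:R * d)).
have [sB' _] := inB_superpos sigma0 (measurable_itv _) (ic (a + n%:R * d) (a + n.+1%:R * d)).
have [sB'' _] := inB_superpos sigma0 (measurable_itv _) (ic a (a + n.+1%:R * d)).
have H : p (superpos sigma `[a, a + n.+1%:R * d] c) <=
  p (fun l => superpos sigma `[a, a + n%:R * d] c l +
     superpos sigma `[a + n%:R * d, a + n.+1%:R * d] c l).
  apply: (p_le_ext sB'') => w w0; apply: cint_itv_split => //.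
  exact: superpos_integrable.
apply: le_trans H _; apply: le_trans (pD sB sB') _.
rewrite -natr1 [leRHS]mulrDl mul1r; apply: lerD; first exact: IH.
have := cell nd1; rewrite -natr1 mulrDl mul1r.
by rewrite (_ : a + (n%:R * d + d) - (a + n%:R * d) = d)//; ring.
Qed.

(** On [n] cells of length [2 N / n] the samples are multiples of resolvent functions, where [p]
    vanishes; the [n] errors of order [1 / n^2] that remain sum to something arbitrarily small. *)
Let sym N : p (superpos sigma `[- N%:R, N%:R] c) <= 0.
Proof.
apply/ler_addgt0Pl => e e0; rewrite addr0.
pose B := K * C1 * (2 * N%:R) ^+ 2.
have C10 : 0 <= C1.
  by rewrite /C1 addr_ge0// divr_ge0 ?mulr_ge0 ?sqr_ge0// ltW.
have B0 : 0 <= B by rewrite !mulr_ge0// sqr_ge0.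
pose n := (Num.bound (B / e)).+1.
have n0 : 0 < n%:R :> R by rewrite ltr0n.
have := @cells (- N%:R) (2 * N%:R / n%:R) n (divr_ge0 (mulr_ge0 (ler0n _ 2) (ler0n _ N)) (ltW n0)).
have -> : - N%:R + n%:R * (2 * N%:R / n%:R) = N%:R :> R by field; rewrite gt_eqF.
move=> /le_trans; apply.
have -> : n%:R * (K * C1 * (2 * N%:R / n%:R) ^+ 2) = B / n%:R.
  by rewrite /B; move: (C1) => C2; field; rewrite gt_eqF.
rewrite ler_pdivrMr// mulrC -ler_pdivrMr// ltW//.
apply: lt_trans (archi_boundP (divr_ge0 B0 (ltW e0))) _.
by rewrite ltr_nat.
Qed.

Hypothesis icT : cintegrable setT c.

(** The B-norm of a superposition is at most [2 / sigma] times the [L^1] norm of its coefficient, so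
    the part of [c] outside [[-N, N]] is negligible. Inside, the domain is cut rather than [c],
    which keeps the Lipschitz bound needed by the cells. *)
Lemma superpos_null : p (superpos sigma setT c) <= 0.
Proof.
apply/ler_addgt0Pl => e e0; rewrite addr0.
pose cN (N : nat) t := if t \in (`[- N%:R, N%:R] : set R) then c t else 0.
have mc := cmeas_of_cintegrable icT.
have mcN N : cmeas setT (cN N) by apply: cmeas_restrict => //; exact: cmeas_setT.
have bN N t : cabs (c t - cN N t) <= cabs (c t).
  by rewrite /cN; case: ifP => _; rewrite ?subr0// subrr cabs0 cabs_ge0.
have ica := cintegrable_cabs measurableT icT.
have B0 : 0 < K * (2 / sigma) + 1 by rewrite ltr_wpDl// mulr_ge0// divr_ge0// ltW.
have [|n t _|t _ r r0|N HN] := @Rintegral_dominated0 R setT (fun N t => cabs (c t - cN N t))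
  (fun t => cabs (c t)) measurableT _ ica _ _ (e / (K * (2 / sigma) + 1)) (divr_gt0 e0 B0).
- by move=> N; apply: cmeas_cabs; exact: cmeasB.
- by rewrite cabs_ge0 bN.
- exists (Num.bound `|t|) => n tn.
  rewrite /cN ifT ?subrr ?cabs0// inE /= in_itv/= -ler_norml.
  by rewrite (le_trans (ltW (archi_boundP (normr_ge0 t))))// ler_nat.
have icN : cintegrable setT (fun t => c t - cN N t).
  exact: (cintegrable_dom _ (cmeasB mc (mcN N)) ica).
have [sB _] := inB_superpos sigma0 measurableT icT.
have [tB tN] := inB_superpos sigma0 measurableT icN.
have [nB _] := inB_superpos sigma0 (measurable_itv _) (ic (- N%:R) N%:R).
have H : p (superpos sigma setT c) <= p (fun l => superpos sigma `[- N%:R, N%:R] c l +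
    superpos sigma setT (fun t => c t - cN N t) l).
  apply: (p_le_ext sB) => w w0.
  have -> : superpos sigma `[- N%:R, N%:R] c w = superpos sigma setT (cN N) w.
    rewrite /superpos cint_mkcond; apply: eq_cint => t _; rewrite /cN.
    by case: ifP => // _; rewrite mul0r.
  have icN' : cintegrable setT (cN N).
    apply: (cintegrable_dom _ (mcN N) ica) => // t _.
    by rewrite /cN; case: ifP => // _; rewrite cabs0 cabs_ge0.
  rewrite /superpos -cintD//; [|exact: superpos_integrable..].
  by apply: eq_cint => t _; ring.
apply: le_trans H _; apply: le_trans (pD nB tB) _.
rewrite -[leRHS]add0r; apply: lerD; first exact: sym.
apply: le_trans (pB tB) _; apply: le_trans (ler_wpM2l K0 tN) _.
rewrite mulrA.
apply: (@le_trans _ _ ((K * (2 / sigma) + 1) * (e / (K * (2 / sigma) + 1)))); last first.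
  by rewrite mulrC divfK ?gt_eqF.
apply: ler_pM; rewrite ?mulr_ge0 ?divr_ge0 ?invr_ge0 ?(ltW sigma0)//.
- by apply: Rintegral_ge0 => t _; exact: cabs_ge0.
- by rewrite lerDl.
- exact: ltW (HN N (leqnn N)).
Qed.

End Coefficients.

Section Decaying.
Variables (G : R[i] -> R[i]) (C : R).
Hypothesis GB : inB G.
Hypothesis GC : forall w, 0 < complex.Re w -> cabs (G w) <= C / cabs (1 + w) ^+ 2.

Let C0 : 0 <= C.
Proof.
have := GC (w := Complex 1 0) ltr01.
have h : 0 < cabs (1 + Complex 1 0 : R[i]) ^+ 2.
  by rewrite exprn_gt0// cabs_gt0 rz_neq0 //= ltr01.
by rewrite ler_pdivlMr// => /(le_trans _)-> //; rewrite mulr_ge0 ?cabs_ge0 ?sqr_ge0.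
Qed.

Let one_lower (w : R[i]) : 0 < complex.Re w -> 1 <= cabs (1 + w).
Proof.
move=> w0; apply: le_trans (rz_lower (z := 1) ltr01 w0); rewrite /= lerDl ltW//.
Qed.

(** The decay of [G] makes [F w = G w * (w + 1)] bounded; in [cauchy_two] with second pole [-1] the
    added factor cancels that pole and leaves the simple Cauchy kernel. *)
Lemma decaying_cauchy (s : R) z : 0 < s -> s < complex.Re z ->
  vint s (fun w => G w / (w - z)) = - (2 * pi)%:C%C * G z.
Proof.
move=> s0 sz; have z0 := lt_trans s0 sz.
pose q : R[i] := -1; pose F w := G w * (w - q).
have FE w : w - q = 1 + w by rewrite /q opprK addrC.
have n0 w : 0 < complex.Re w -> w - q != 0.
  by move=> w0; rewrite FE; exact: (rz_neq0 (z := 1) ltr01 w0).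
have FD w : s <= complex.Re w -> exists m, hasD F w m.
  move=> sw; have w0 := lt_le_trans s0 sw.
  by have := hasDM (inB_hasD GB w0) (hasD_affine q w); eexists; eassumption.
have FK w : s <= complex.Re w -> cabs (F w) <= C.
  move=> sw; have w0 := lt_le_trans s0 sw.
  rewrite /F cabsM FE; have o := one_lower w0.
  have o0 : 0 < cabs (1 + w) by exact: lt_le_trans ltr01 o.
  apply: le_trans (ler_wpM2r (cabs_ge0 _) (GC w0)) _.
  by rewrite expr2 invfM mulrA divfK ?gt_eqF// ler_pdivrMr// ler_peMr.
have qs : complex.Re q < s by rewrite /q /= (lt_trans _ s0)// oppr_lt0.
have := cauchy_two FD FK sz qs.
have -> : vint s (kernel2 F z q) = vint s (fun w => G w / (w - z)).
  apply: eq_cint => b _; rewrite /kernel2 /F.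
  have h1 : Complex s b - q != 0 by exact: n0.
  have h2 : Complex s b - z != 0.
    by rewrite subr_eq0; apply: contraTneq sz => <-; rewrite /= ltxx.
  by move: (Complex s b) h1 h2 => w h1 h2; field; rewrite h1 h2.
rewrite /F => H; apply: (mulfI (n0 _ z0)); rewrite H.
by move: (_%:C%C) => k; ring.
Qed.

Let coef (s t : R) : R[i] := ((2 * pi)^-1)%:C%C * G (Complex s t).

(** The shift is by [2 s] because one [s] moves the line of integration into the half-plane and the
    other moves the points [s - i t] of the resolvent functions there. *)
Lemma shift_superpos (s : R) l : 0 < s -> 0 < complex.Re l ->
  G (l + (s + s)%:C%C) = superpos s setT (coef s) l.
Proof.
move=> s0 l0; have pi0 := pi_gt0 R.
have sz : s < complex.Re (l + (s + s)%:C%C) by rewrite cReD /=; lra.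
have := decaying_cauchy s0 sz; set z := l + _ in sz * => H.
have pn : (2 * pi)%:C%C != 0 :> R[i].
  by rewrite -cabs_gt0 cabs_real normr_gt0 gt_eqF// mulr_gt0.
have E : superpos s setT (coef s) l = - ((2 * pi)%:C%C)^-1 * vint s (fun w => G w / (w - z)).
  rewrite /superpos /vint -cintZ//; last first.
    pose F w := G w; have FD w : s <= complex.Re w -> exists m, hasD F w m.
      by move=> sw; eexists; apply: inB_hasD GB _; exact: lt_le_trans sw.
    have mG : cmeas setT (fun b => G (Complex s b) / (Complex s b - z)).
      apply: pcont_cmeasT => b; apply: (@pcont_vline R (fun w => G w / (w - z))).
      have h2 : Complex s b - z != 0.
        by rewrite subr_eq0; apply: contraTneq sz => <-; rewrite /= ltxx.
      apply: hasD_continuous (hasDM (inB_hasD GB _) (@hasDV R (fun w => w - z) _ _ h2 (hasD_affine z _))).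
      exact: s0.
    have il : mu.-integrable setT (EFin \o (fun b => C / (complex.Re z - s) * lineker s (-1) b)).
      apply: integrable_RZ => //; apply: integrable_lineker => /= E.
      by move: s0; rewrite -E oppr_gt0 ltNge ler01.
    apply: cintegrable_dom il _ => //= b _.
    rewrite cabsM cabsV /lineker.
    have d0 : 0 < complex.Re z - s by rewrite subr_gt0.
    have h1 : (cabs (Complex s b - z))^-1 <= (complex.Re z - s)^-1.
      have h : complex.Re z - s <= cabs (Complex s b - z).
        by rewrite cabsBC; apply: le_trans (Re_le_cabs _); rewrite !ReImE.
      by rewrite lef_pV2 ?posrE// (lt_le_trans d0).
    have h2 := GC (w := Complex s b) s0.
    rewrite (_ : Complex s b - -1 = 1 + Complex s b); last by rewrite opprK addrC.
    rewrite mulrAC; apply: ler_pM; rewrite ?cabs_ge0 ?invr_ge0 ?cabs_ge0//.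
  apply: eq_cint => t _; rewrite /coef /rz.
  have -> : pole s t + l = - (Complex s t - z).
    by rewrite /z; apply: complexP; rewrite !ReImE /=; ring.
  rewrite fmorphV invrN; move: (Complex s t - z)^-1 => u; ring.
by rewrite E H mulrA mulNr mulrN opprK mulVf// mul1r.
Qed.

Let coefL s : 0 < s -> forall t u, cabs (coef s t - coef s u) <= snorm G / s * `|t - u|.
Proof.
move=> s0 t u; rewrite /coef -mulrBr cabsM cabs_real.
have p1 : `|(2 * pi)^-1 : R| <= 1.
  have := pi_ge2 R => h; rewrite gtr0_norm ?invr_gt0 ?mulr_gt0 ?pi_gt0//.
  by rewrite invf_le1 ?mulr_gt0 ?pi_gt0//; lra.
apply: le_trans (ler_wpM2r (cabs_ge0 _) p1) _; rewrite mul1r.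
wlog tu : t u / u <= t.
  move=> H; have [ut|tu] := leP u t; first exact: H.
  by rewrite cabsBC distrC; apply: H; exact: ltW.
by rewrite ger0_norm ?subr_ge0//; exact: inB_vertical.
Qed.

Let coefM s : 0 < s -> forall t, cabs (coef s t) <= snorm G.
Proof.
move=> s0 t; rewrite /coef cabsM cabs_real.
have p1 : `|(2 * pi)^-1 : R| <= 1.
  have := pi_ge2 R => h; rewrite gtr0_norm ?invr_gt0 ?mulr_gt0 ?pi_gt0//.
  by rewrite invf_le1 ?mulr_gt0 ?pi_gt0//; lra.
apply: le_trans (ler_wpM2r (cabs_ge0 _) p1) _; rewrite mul1r.
exact: (inB_bdd GB (z := Complex s t) s0).
Qed.

Let coef_integrable s : 0 < s -> cintegrable setT (coef s).
Proof.
move=> s0; apply: cintegrableZ => //.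
have il : mu.-integrable setT (EFin \o (fun b => C * lineker s (-1) b)).
  apply: integrable_RZ => //; apply: integrable_lineker => /= E.
  by move: s0; rewrite -E oppr_gt0 ltNge ler01.
apply: cintegrable_dom il _ => //=.
  apply: pcont_cmeasT => b; apply: pcont_vline.
  exact: hasD_continuous (inB_hasD GB (z := Complex s b) s0).
move=> b _; rewrite /lineker (_ : Complex s b - -1 = 1 + Complex s b); last by rewrite opprK addrC.
exact: GC.
Qed.

Lemma shift_null (s : R) : 0 < s -> p (fun l => G (l + (s + s)%:C%C)) <= 0.
Proof.
move=> s0; have ss : 0 < s + s by exact: addr_gt0.
have := superpos_null s0 (divr_ge0 (snorm_ge0 GB) (ltW s0)) (snorm_ge0 GB)
  (coefL s0) (coefM s0) (coef_integrable s0).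
apply: le_trans; apply: p_le_ext; first exact: inB_shift.
by move=> w w0; exact: shift_superpos.
Qed.

Let GD (s : R) l := G l - G (l + s%:C%C).

Let GDB s : 0 < s -> inB (GD s).
Proof. by move=> s0; exact: (@inBB R G _ GB (inB_shift s0 GB)). Qed.

Let GD_hasD (s : R) z : 0 < s -> 0 < complex.Re z ->
  hasD (GD s) z (cderiv G z - cderiv G (z + s%:C%C)).
Proof.
move=> s0 z0; apply: hasDB; first exact: inB_hasD.
by apply: hasD_shift; apply: inB_hasD => //; rewrite cReD addr_gt0.
Qed.

Let GD_infty s : 0 < s -> finfty (GD s) = 0.
Proof.
move=> s0; apply: finfty_unique => e e0.
have e2 : 0 < e / 2 by rewrite divr_gt0.
have [M HM] := finfty_lim GB e2; exists M => z Mz; rewrite subr0 /GD.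
rewrite (le_lt_trans (cabs_triangle _ (finfty G) _))// [e]splitr ltrD ?HM//.
rewrite cabsBC HM// cReD /=; lra.
Qed.

(** The difference vanishes at infinity, so its B-norm is controlled by its [B_0] part. There
    dominated convergence applies: monotonicity of [dm] gives the majorant [2 dm G], and the
    Lipschitz bound on the derivative gives pointwise convergence. *)
Lemma shift_continuous (e : R) : 0 < e -> exists2 s : R, 0 < s & Bnorm (GD (s + s)) < e.
Proof.
move=> e0; pose s (n : nat) : R := n.+1%:R^-1.
have s0 n : 0 < s n by rewrite invr_gt0 ltr0n.
have ss0 n : 0 < s n + s n by rewrite addr_gt0.
have hG := inB_holo GB; have GK := inB_bdd GB.
have dE n t b : 0 < t -> cderiv (GD (s n + s n)) (Complex t b) =
    cderiv G (Complex t b) - cderiv G (Complex (t + (s n + s n)) b).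
  move=> t0; rewrite (hasD_cderiv (GD_hasD (z := Complex t b) (ss0 n) t0)).
  congr (_ - cderiv G _).
  by apply: complexP; rewrite !ReImE /= ?addr0.
have hD n := inB_holo (GDB (ss0 n)); have KD n := inB_bdd (GDB (ss0 n)).
have i2 : mu.-integrable Rpos (EFin \o (fun t => 2 * dm G t)).
  by apply: integrable_RZ => //; exact: inB_integrable.
have [|n t /Rpos_gt0 t0|t /Rpos_gt0 t0 r r0|N HN] := @Rintegral_dominated0 R Rpos
   (fun n => dm (GD (s n + s n))) (fun t => 2 * dm G t) (measurable_itv _) _ i2 _ _
   (e / 2) (divr_gt0 e0 (ltr0Sn _ 1)).
- by move=> n; exact: measurable_dm (hD n) (KD n).
- apply/andP; split; first exact: dm_ge0 (hD n) (KD n) t t0.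
  apply: (dm_le (hD n) (KD n)) => // b; rewrite dE//.
  apply: le_trans (cabsB _ _) _; rewrite mulr_natl mulr2n; apply: lerD.
    exact: inB_ub.
  apply: le_trans (inB_ub _ GB _) _; first exact: addr_gt0.
  by apply: (dm_nonincreasing hG GK) => //; rewrite lerDl ltW.
- pose Lp := 4 * snorm G / t ^+ 2.
  have L0 : 0 <= Lp by rewrite divr_ge0 ?sqr_ge0// mulr_ge0// snorm_ge0.
  exists (Num.bound ((Lp * 2 + 1) / r)) => n Nn.
  apply: (@le_lt_trans _ _ (Lp * (s n + s n))).
    apply: (dm_le (hD n) (KD n)) => // b; rewrite dE//.
    apply: le_trans (holo_deriv_lip hG GK t0 _ _) _ => //=.
      by rewrite lerDl ltW.
    rewrite ler_wpM2l//; apply: le_trans (hline_lip _ _ _) _.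
    by rewrite opprD addrA subrr add0r normrN gtr0_norm.
  rewrite (_ : Lp * _ = (Lp * 2) / n.+1%:R); last by rewrite /s; ring.
  rewrite ltr_pdivrMr// [ltRHS]mulrC -ltr_pdivrMr//.
  apply: (@lt_trans _ _ ((Lp * 2 + 1) / r)); first by rewrite ltr_pM2r ?invr_gt0// ltrDl.
  apply: lt_le_trans (archi_boundP _) _; first by apply: divr_ge0; [rewrite addr_ge0// mulr_ge0|exact: ltW].
  by rewrite ler_nat (leq_trans Nn).
exists (s N) => //; apply: le_lt_trans (inB_sup_le (GDB (ss0 N)) (GD_infty (ss0 N))) _.
by rewrite mulrC -ltr_pdivlMr// HN.
Qed.

Theorem seminorm_null : p G <= 0.
Proof.
apply/ler_addgt0Pl => e e0; rewrite addr0.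
have [s s0 Hs] := shift_continuous (divr_gt0 e0 (ltr_wpDl K0 ltr01)).
have ss0 : 0 < s + s by exact: addr_gt0.
apply: le_trans (p_le_diff GB (inB_shift ss0 GB)) _.
rewrite -[leRHS]add0r; apply: lerD; first exact: shift_null.
apply: (@le_trans _ _ ((K + 1) * (e / (K + 1)))); last first.
  by rewrite mulrC divfK// gt_eqF// ltr_wpDl.
apply: ler_pM => //; [exact: Bnorm_ge0 (GDB ss0)|by rewrite lerDl|exact: ltW].
Qed.

End Decaying.

End Approximation.

(** * The calculus and its uniqueness *)

Section RealNorm.
Context {R : realType} {X : completeNormedModType R[i]}.
Implicit Types (x y : X) (c : R[i]).

Definition nrm x : R := complex.Re `|x|.

Lemma nrmE x : `|x| = (nrm x)%:C%C.
Proof.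
have := normr_ge0 x; rewrite /nrm; case: (`|x|) => a b.
by rewrite lecE /= => /andP[/eqP -> _].
Qed.

Lemma nrm_ge0 x : 0 <= nrm x.
Proof. by have := normr_ge0 x; rewrite nrmE lecE /= => /andP[_]. Qed.

Lemma nrm_le x (r : R) : (`|x| <= r%:C%C) = (nrm x <= r).
Proof. by rewrite nrmE lecR. Qed.

Lemma nrm_lt x (r : R) : (`|x| < r%:C%C) = (nrm x < r).
Proof. by rewrite nrmE ltcR. Qed.

Lemma nrm0 : nrm (0 : X) = 0.
Proof. by rewrite /nrm normr0. Qed.

Lemma nrm_le0 x : nrm x <= 0 -> x = 0.
Proof. by rewrite -nrm_le => H; apply/eqP; rewrite -normr_le0. Qed.

Lemma nrmD x y : nrm (x + y) <= nrm x + nrm y.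
Proof. by rewrite -nrm_le rmorphD /= -!nrmE ler_normD. Qed.

Lemma nrmN x : nrm (- x) = nrm x.
Proof. by rewrite /nrm normrN. Qed.

Lemma nrmB x y : nrm (x - y) <= nrm x + nrm y.
Proof. by rewrite -(nrmN y); exact: nrmD. Qed.

Lemma nrmBC x y : nrm (x - y) = nrm (y - x).
Proof. by rewrite -nrmN opprB. Qed.

Lemma nrm_triangle x y z : nrm (x - z) <= nrm (x - y) + nrm (y - z).
Proof. by apply: le_trans (nrmD _ _); rewrite addrA subrK. Qed.

Lemma nrmZ c x : nrm (c *: x) = cabs c * nrm x.
Proof.
by apply: (@complexI R); rewrite -nrmE normrZ cabs_norm nrmE rmorphM.
Qed.

End RealNorm.

Section BoundedLinear.
Context {R : realType} {X : completeNormedModType R[i]}.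
Variable T : X -> X.
Hypothesis bT : bdd_linear T.

Lemma bdd_linearD x y : T (x + y) = T x + T y.
Proof. by case: bT => /(_ 1 x y); rewrite !scale1r. Qed.

Lemma bdd_linear0 : T 0 = 0.
Proof. by have := bdd_linearD 0 0; rewrite addr0 => /(congr1 (fun u => u - T 0)); rewrite addrK subrr => <-. Qed.

Lemma bdd_linearZ c x : T (c *: x) = c *: T x.
Proof. by case: bT => /(_ c x 0); rewrite !addr0 bdd_linear0 addr0. Qed.

Lemma bdd_linearB x y : T (x - y) = T x - T y.
Proof. by rewrite bdd_linearD -scaleN1r bdd_linearZ scaleN1r. Qed.

Lemma bdd_linear_le : exists2 M : R, 0 <= M & forall x, nrm (T x) <= M * nrm x.
Proof.
case: bT => _ [M HM]; exists `|M| => // x.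
have := HM x; rewrite !nrmE -rmorphM lecR => /le_trans; apply.
by rewrite ler_wpM2r ?nrm_ge0// ler_norm.
Qed.

End BoundedLinear.

Section Dual.
Context {R : realType} {X : completeNormedModType R[i]}.
Variable xs : X -> R[i]^o.
Hypothesis dxs : in_dual xs.

Lemma dualD x y : xs (x + y) = xs x + xs y.
Proof. by case: dxs => /(_ 1 x y); rewrite scale1r mul1r. Qed.

Lemma dual0 : xs 0 = 0.
Proof. by have := dualD 0 0; rewrite addr0 => /(congr1 (fun u => u - xs 0)); rewrite addrK subrr => <-. Qed.

Lemma dualZ c x : xs (c *: x) = c * xs x.
Proof. by case: dxs => /(_ c x 0) + _; rewrite addr0 dual0 addr0. Qed.

Lemma dualB x y : xs (x - y) = xs x - xs y.
Proof. by rewrite dualD -scaleN1r dualZ mulN1r. Qed.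

Lemma dual_le : exists2 L : R, 0 <= L & forall x, cabs (xs x) <= L * nrm x.
Proof.
have [_ /(_ 0)] := dxs => /cvgrPdist_lt /(_ 1 ltr01).
rewrite dual0 => /nbhs_ballP[e /= e0 He].
have [E r0] := gt0_complexE e0; set r := complex.Re e in E r0.
have H x : nrm x < r -> cabs (xs x) < 1.
  move=> xr; have /He : ball (0 : X) e x.
    by rewrite -ball_normE /= sub0r normrN E nrm_lt.
  by rewrite /= sub0r normrN cabs_norm ltcR.
exists (2 / r); first by rewrite divr_ge0// ltW.
move=> x; have [x0|x0] := leP (nrm x) 0.
  by rewrite (nrm_le0 x0) dual0 cabs0 nrm0 mulr0.
pose k : R := r / 2 / nrm x.
have k0 : 0 < k by rewrite !divr_gt0.
have := H ((k%:C%C : R[i]) *: x).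
rewrite nrmZ dualZ cabsM cabs_real gtr0_norm// /k divfK ?gt_eqF// => /(_ _)/ltW.
rewrite ltr_pdivrMr// ltr_pMr// ltr1n => /(_ isT).
rewrite -ler_pdivlMl// mulr1 => /le_trans; apply.
by rewrite le_eqVlt; apply/orP; left; apply/eqP; field; rewrite !gt_eqF.
Qed.

End Dual.

Section Calculus.
Context {R : realType} {X : completeNormedModType R[i]}.
Variables (D : set X) (A : X -> X) (Phi : (R[i] -> R[i]) -> X -> X).
Hypothesis BC : B_calculus D A Phi.
Notation res := (resolv D A).

Let Plin f : inB f -> bdd_linear (Phi f).
Proof. by case: BC => _ [[h _ _ _] _]; exact: h. Qed.

Lemma calculusD f g x : inB f -> inB g -> Phi (fun l => f l + g l) x = Phi f x + Phi g x.
Proof. by case: BC => _ [[_ h _ _] _] fB gB; rewrite h. Qed.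

Lemma calculusZ c f x : inB f -> Phi (fun l => c * f l) x = c *: Phi f x.
Proof. by case: BC => _ [[_ _ h _] _] fB; rewrite h. Qed.

Lemma calculusM f g x : inB f -> inB g -> Phi (fun l => f l * g l) x = Phi f (Phi g x).
Proof. by case: BC => _ [[_ _ _ h] _] fB gB; rewrite h. Qed.

Lemma calculus_bounded : exists2 M : R, 0 <= M &
  forall f x, inB f -> nrm (Phi f x) <= M * Bnorm f * nrm x.
Proof.
case: BC => _ [_ [[M HM] _]]; exists `|M| => // f x fB.
have := HM f fB x; rewrite !nrmE -rmorphM lecR => /le_trans; apply.
by rewrite ler_wpM2r ?nrm_ge0// ler_wpM2r ?ler_norm//; exact: Bnorm_ge0.
Qed.

Lemma calculus_rz z x : 0 < complex.Re z -> Phi (rz z) x = res z x.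
Proof. by case: BC => _ [_ [_ h]] z0; rewrite h. Qed.

Lemma calculusB f g x : inB f -> inB g -> Phi (fun l => f l - g l) x = Phi f x - Phi g x.
Proof.
move=> fB gB; have E : (fun l => f l - g l) = (fun l => f l + (-1) * g l).
  by apply/funext => l; rewrite mulN1r.
by rewrite E (calculusD x fB (inBZ (-1) gB)) (calculusZ (-1) x gB) scaleN1r.
Qed.

Lemma calculus_ext f g x : inB f -> (forall w, 0 < complex.Re w -> f w = g w) ->
  Phi f x = Phi g x.
Proof.
move=> fB fg; have gB := inB_ext fg fB.
have N w : 0 < complex.Re w -> f w - g w = 0 by move=> w0; rewrite fg// subrr.
have [dB dN] := @Bnorm_null R (fun l => f l - g l) N.
apply/eqP; rewrite -subr_eq0 -(calculusB x fB gB); apply/eqP/nrm_le0.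
have [M M0 HM] := calculus_bounded; apply: le_trans (HM _ x dB) _.
by rewrite mulr_le0_ge0 ?nrm_ge0// mulr_ge0_le0.
Qed.

(** For [Re z > 0] the point [- z] is outside the spectrum, and minus the inverse of [- z - A]
    inverts [z + A]; hence [resolv] is in its first branch and never takes its default value
    here. *)
Lemma resolvent_shift z : 0 < complex.Re z -> is_inverse_shift D A z (res z).
Proof.
move=> z0; rewrite /resolv; case: pselect => [h|[]]; first by case: cid.
case: BC => [[[D0 [DZ AZ]] _ sp] _].
have /contrapT [T [[TL _] DT T1 T2]] : ~ spectrum D A (- z).
  by move=> /sp; rewrite cReN oppr_ge0 leNgt z0.
have DN y : D y -> D (- y) by move=> Dy; rewrite -scaleN1r -[_ *: y]addr0; exact: DZ.
have A0 : A 0 = 0.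
  have := AZ 1 0 0 D0 D0; rewrite !scale1r addr0 => /(congr1 (fun u => u - A 0)).
  by rewrite addrK subrr => <-.
have AN y : D y -> A (- y) = - A y.
  by move=> Dy; have := AZ (-1) y 0 Dy D0; rewrite A0 !addr0 !scaleN1r.
have T0 : T 0 = 0.
  have := TL 1 0 0; rewrite !scale1r addr0 => /(congr1 (fun u => u - T 0)).
  by rewrite addrK subrr => <-.
have TN y : T (- y) = - T y.
  by have := TL (-1) y 0; rewrite T0 !addr0 !scaleN1r.
exists (fun y => - T y); split.
- by move=> y; exact: DN.
- by move=> y; rewrite AN// scalerN -scaleNr T1.
- by move=> y Dy; rewrite -TN opprD -scaleNr T2.
Qed.

Lemma res_bdd_linear z : 0 < complex.Re z -> bdd_linear (res z).
Proof.
move=> z0; have [rB _] := inB_rz z0; have := Plin rB.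
by rewrite (_ : Phi (rz z) = res z)//; apply/funext => x; exact: calculus_rz.
Qed.

(** The calculus transports [||r_z|| <= 2 / Re z] to operators, which bounds [t (t + A)^-1]
    uniformly in [t > 0]. *)
Lemma res_bound : exists2 M : R, 0 <= M &
  forall z x, 0 < complex.Re z -> nrm (res z x) <= M / complex.Re z * nrm x.
Proof.
have [M M0 HM] := calculus_bounded; exists (M * 2); first by rewrite mulr_ge0.
move=> z x z0; have [rB rN] := inB_rz z0; rewrite -calculus_rz//.
apply: le_trans (HM _ _ rB) _; rewrite ler_wpM2r ?nrm_ge0// -mulrA.
exact: ler_wpM2l.
Qed.

(** Inherited through the homomorphism from [r_w - r_z = (z - w) r_w r_z]. *)
Lemma res_identity z w x : 0 < complex.Re z -> 0 < complex.Re w ->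
  res w x - res z x = (z - w) *: res w (res z x).
Proof.
move=> z0 w0; have [rzB _] := inB_rz z0; have [rwB _] := inB_rz w0.
rewrite -[res w x]calculus_rz// -[res w (res z x)]calculus_rz// -!(calculus_rz _ z0).
rewrite -(calculusB x rwB rzB) -(calculusM x rwB rzB) -(calculusZ (z - w) x (inBM rwB rzB)).
apply: calculus_ext; first exact: inBB.
move=> l l0; rewrite /rz; have := rz_neq0 z0 l0; have := rz_neq0 w0 l0.
by move=> h1 h2; field; rewrite h1 h2.
Qed.

Lemma calculus_res f z x : inB f -> 0 < complex.Re z ->
  Phi f (res z x) = res z (Phi f x).
Proof.
move=> fB z0; have [rB _] := inB_rz z0; rewrite -!(calculus_rz _ z0).
rewrite -(calculusM x fB rB) -(calculusM x rB fB); congr (Phi _ x).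
by apply/funext => l; rewrite mulrC.
Qed.

Lemma res_dense x (e : R) : 0 < e -> exists y, nrm (x - res 1 y) < e.
Proof.
move=> e0; case: (BC) => [[_ dD _] _].
have cx : closure D x by rewrite dD.
have ec : 0 < (e%:C%C : R[i]) by rewrite ltcR.
have [y [Dy]] := cx _ (nbhsx_ballx x _ ec).
rewrite -ball_normE /= nrm_lt => H.
have [_ _ /(_ _ Dy) E] := resolvent_shift (z := 1) ltr01.
by exists (1 *: y + A y); rewrite E.
Qed.

Lemma res2_dense x (e : R) : 0 < e -> exists y, nrm (x - res 1 (res 1 y)) < e.
Proof.
move=> e0; have e2 : 0 < e / 2 by rewrite divr_gt0.
have [y Hy] := res_dense x e2.
have [M M0 HM] := bdd_linear_le (res_bdd_linear (z := 1) ltr01).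
have [u Hu] := res_dense y (divr_gt0 e2 (ltr_wpDl M0 ltr01)).
exists u; apply: le_lt_trans (nrm_triangle _ (res 1 y) _) _.
rewrite [e]splitr; apply: ltr_leD => //.
rewrite -(bdd_linearB (res_bdd_linear (z := 1) ltr01)); apply: le_trans (HM _) _.
apply: (@le_trans _ _ ((M + 1) * (e / 2 / (M + 1)))); last first.
  by rewrite mulrC divfK// gt_eqF// ltr_wpDl.
by apply: ler_pM; rewrite ?nrm_ge0// ?lerDl// ltW.
Qed.

Lemma eq_on_res2 (S T : X -> X) : bdd_linear S -> bdd_linear T ->
  (forall y, S (res 1 (res 1 y)) = T (res 1 (res 1 y))) -> S = T.
Proof.
move=> bS bT ST; apply/funext => x; apply/eqP; rewrite -subr_eq0; apply/eqP/nrm_le0.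
apply/ler_addgt0Pl => e e0; rewrite addr0.
have [M M0 HM] := bdd_linear_le bS; have [N N0 HN] := bdd_linear_le bT.
have MN : 0 < M + N + 1 by rewrite ltr_wpDl// addr_ge0.
have [y Hy] := res2_dense x (divr_gt0 e0 MN).
set u := res 1 (res 1 y) in Hy.
have -> : S x - T x = S (x - u) - T (x - u).
  by rewrite (bdd_linearB bS) (bdd_linearB bT) /u ST opprB addrA subrK.
apply: le_trans (nrmB _ _) _; apply: le_trans (lerD (HM _) (HN _)) _.
rewrite -mulrDl; apply: (@le_trans _ _ ((M + N + 1) * (e / (M + N + 1)))); last first.
  by rewrite mulrC divfK// gt_eqF.
by apply: ler_pM; rewrite ?nrm_ge0 ?addr_ge0// ?lerDl// ltW.
Qed.

(** Multiplicativity gives [Phi(1) Phi(r_1) = Phi(r_1)], and the range of [(1 + A)^-2] is dense. *)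
Lemma calculus1 x : Phi (fun=> 1) x = x.
Proof.
have oB := inB_cst (1 : R[i]).
have bI : bdd_linear (@id X).
  by split => //; exists 1 => y; rewrite mul1r.
have -> // : Phi (fun=> 1) = id.
apply: (eq_on_res2 (Plin oB) bI) => y.
have [rB _] := inB_rz (z := 1 : R[i]) ltr01.
rewrite -(calculus_rz (z := 1) (res 1 y) ltr01) -(calculusM _ oB rB).
by congr (Phi _ _); apply/funext => l; rewrite mul1r.
Qed.

(** On a vector [u = (1 + A)^-1 y] the error is exactly [(t + A)^-1 (u - y)], of order [1 / t].
    Density of such vectors and the uniform bound on [t (t + A)^-1] give the rest. *)
Lemma res_large x (e : R) : 0 < e -> exists2 T : R, 0 < T & forall t : R, T <= t ->
  nrm ((t%:C%C : R[i]) *: res (t%:C)%C x - x) < e.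
Proof.
move=> e0; have [M M0 HM] := res_bound.
have e2 : 0 < e / 2 by rewrite divr_gt0.
have M1 : 0 < M + 1 by rewrite ltr_wpDl.
have [y Hy] := res_dense x (divr_gt0 e2 M1).
set u := res 1 y in Hy; pose B := M * nrm (u - y).
have B0 : 0 <= B by rewrite mulr_ge0 ?nrm_ge0.
exists ((B + 1) / (e / 2)); first by rewrite divr_gt0// ltr_wpDl.
move=> t; rewrite ler_pdivrMr// => Ht.
have t0 : 0 < t by rewrite -(pmulr_lgt0 _ e2); apply: lt_le_trans Ht; rewrite ltr_wpDl.
have tL := res_bdd_linear (z := t%:C%C) t0.
have E1 : (t%:C%C : R[i]) *: res (t%:C)%C u - u = res (t%:C)%C (u - y).
  have := @res_identity 1 (t%:C)%C y ltr01 t0.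
  rewrite scalerBl scale1r -/u => /(congr1 (fun v => v - res (t%:C)%C y)).
  rewrite addrAC subrr add0r => /(congr1 (fun v => (t%:C%C : R[i]) *: res (t%:C)%C u + v)).
  by move=> ->; rewrite (bdd_linearB tL) !addrA [_ + res _ u]addrC addrK.
have E2 : (t%:C%C : R[i]) *: res (t%:C)%C x - x =
    ((t%:C%C : R[i]) *: res (t%:C)%C (x - u) - (x - u)) + res (t%:C)%C (u - y).
  rewrite -E1 (bdd_linearB tL) scalerBr opprB addrACA.
  by rewrite subrK [u - x]addrC addrK.
rewrite E2; apply: le_lt_trans (nrmD _ _) _; rewrite [e]splitr; apply: ler_ltD.
  apply: le_trans (nrmB _ _) _; rewrite nrmZ cabs_real gtr0_norm//.
  apply: (@le_trans _ _ ((M + 1) * nrm (x - u))).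
    rewrite mulrDl mul1r lerD2r mulrC -ler_pdivlMr// mulrAC; exact: HM.
  by rewrite mulrC -ler_pdivlMr// ltW.
apply: le_lt_trans (HM _ _ _) _ => //.
rewrite mulrAC -/B /= ltr_pdivrMr// mulrC; apply: lt_le_trans Ht; rewrite ltrDl//.
Qed.

End Calculus.

Section Uniqueness.
Context {R : realType} {X : completeNormedModType R[i]}.
Variables (D : set X) (A : X -> X) (Phi Psi : (R[i] -> R[i]) -> X -> X).
Hypotheses (BP : B_calculus D A Phi) (BQ : B_calculus D A Psi).

Lemma calculus_unique f : inB f -> Psi f = Phi f.
Proof.
move=> fB; case: (BP) => _ [[HP _ _ _] _]; case: (BQ) => _ [[HQ _ _ _] _].
apply: (eq_on_res2 BP (HQ f fB) (HP f fB)) => y.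
have [rB _] := inB_rz (z := 1 : R[i]) ltr01.
pose r2 (l : R[i]) := rz 1 l * rz 1 l; have r2B : inB r2 := inBM rB rB.
pose G l := f l * r2 l; have GB : inB G := inBM fB r2B.
have [M M0 HM] := calculus_bounded BP; have [N N0 HN] := calculus_bounded BQ.
pose p g := nrm (Psi g y - Phi g y).
have pB : Bseminorm p ((N + M) * nrm y).
  split.
  - move=> g h gB hB; rewrite /p (calculusD BP y gB hB) (calculusD BQ y gB hB).
    by rewrite opprD addrACA nrmD.
  - by move=> c g gB; rewrite /p (calculusZ BP c y gB) (calculusZ BQ c y gB) -scalerBr nrmZ.
  - by rewrite mulr_ge0 ?nrm_ge0 ?addr_ge0.
  - move=> g gB; apply: le_trans (nrmB _ _) _.
    apply: le_trans (lerD (HN _ _ gB) (HM _ _ gB)) _.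
    by rewrite -!mulrDl mulrAC.
have pr z : Cplus R z -> p (rz z) = 0.
  by move=> z0; rewrite /p (calculus_rz BP)// (calculus_rz BQ)// subrr nrm0.
have GC w : 0 < complex.Re w -> cabs (G w) <= snorm f / cabs (1 + w) ^+ 2.
  move=> w0; rewrite /G /r2 /rz !cabsM !cabsV -invfM -expr2 ler_wpM2r//.
    by rewrite invr_ge0 sqr_ge0.
  exact: (inB_bdd fB w0).
have /nrm_le0/eqP := seminorm_null pB pr GB GC.
rewrite subr_eq0 /G (calculusM BP y fB r2B) (calculusM BQ y fB r2B).
rewrite /r2 (calculusM BP y rB rB) (calculusM BQ y rB rB).
by rewrite !(calculus_rz BP _ (z := 1) ltr01) !(calculus_rz BQ _ (z := 1) ltr01) => /eqP.
Qed.

End Uniqueness.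

(** * The square function estimate *)

Section CellSums.
Context {R : realType}.
Notation mu := (@lebesgue_measure R).
Notation Rpos := (`]0%R, +oo[ : set R).
Variables (al A0 : R) (xi : nat -> R).
Hypothesis al0 : 0 < al.
Definition node (j : nat) : R := A0 + j%:R * al.
Hypothesis xiP : forall j, node j <= xi j <= node j.+1.

Lemma nodeS j : node j.+1 = node j + al.
Proof. by rewrite /node -natr1 mulrDl mul1r addrA. Qed.

(** A sample of the Poisson kernel is compared with its integral over the cell, an increment of
    [atan]. On a cell of size at most [d] the kernel varies by a factor at most 3: if [|b - y| <= d]
    then [b^2 <= 2 y^2 + 2 (b - y)^2] yields [d^2 + b^2 <= 3 (d^2 + y^2)]. Summed over the cells,
    the increments telescope to at most [pi]. *)
Lemma cell_atan (d t : R) j : al <= d -> al / (d ^+ 2 + (xi j - t) ^+ 2) <=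
  3 / d * (atan ((node j.+1 - t) / d) - atan ((node j - t) / d)).
Proof.
move=> ad; have d0 : 0 < d := lt_le_trans al0 ad.
have uu : (node j - t) / d <= (node j.+1 - t) / d.
  by rewrite ler_wpM2r ?invr_ge0 ?(ltW d0)// lerD2r nodeS lerDl ltW.
have [|c] := @MVT_segment R atan (fun c => (1 + c ^+ 2)^-1) _ _ uu.
  by apply: continuous_subspaceT => c; exact: continuous_atan.
rewrite in_itv /= ler_pdivrMr// ler_pdivlMr// => /andP[c1 c2] ->.
have /andP[] := xiP j; rewrite nodeS in c2 *; move: (node j) (xi j) c1 c2 => u x c1 c2 x1 x2.
have p1 : 0 < d ^+ 2 + (x - t) ^+ 2 by rewrite ltr_pwDl ?exprn_gt0 ?sqr_ge0.
have p2 : 0 < d ^+ 2 + (c * d) ^+ 2 by rewrite ltr_pwDl ?exprn_gt0 ?sqr_ge0.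
have p3 : 1 + c ^+ 2 != 0 by rewrite gt_eqF// ltr_pwDl ?sqr_ge0.
have -> : 3 / d * ((1 + c ^+ 2)^-1 * ((u + al - t) / d - (u - t) / d)) =
    3 * al / (d ^+ 2 + (c * d) ^+ 2).
  by field; rewrite p3 (gt_eqF d0) /= exprMn -[X in X + _]mul1r -mulrDl mulf_neq0// expf_neq0 ?gt_eqF.
rewrite ler_pdivrMr// mulrAC ler_pdivlMr// [3 * al]mulrC -!mulrA ler_wpM2l ?(ltW al0)//.
move: c1 c2; move: (c * d) => b b1 b2.
have h1 : 0 <= (d - (b - (x - t))) * (d + (b - (x - t))) by apply: mulr_ge0; lra.
have h2 : 0 <= (2 * (x - t) - b) ^+ 2 by exact: sqr_ge0.
by nra.
Qed.

Lemma cell_sum (d t : R) n : al <= d ->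
  \sum_(0 <= j < n) al / (d ^+ 2 + (xi j - t) ^+ 2) <= 3 * pi / d.
Proof.
move=> ad; have d0 : 0 < d := lt_le_trans al0 ad.
apply: le_trans (ler_sum _ (fun j _ => cell_atan t j ad)) _.
rewrite -mulr_sumr (telescope_sumr (fun j => atan ((node j - t) / d)))//.
rewrite [leRHS]mulrAC; apply: ler_wpM2l; first by rewrite divr_ge0// ltW.
by have := atan_gtNpi2 ((node 0 - t) / d); have := atan_ltpi2 ((node n - t) / d); lra.
Qed.

Lemma cabs_sum_le (F : nat -> R[i]) (G : nat -> R) n : (forall j, cabs (F j) <= G j) ->
  cabs (\sum_(0 <= j < n) F j) <= \sum_(0 <= j < n) G j.
Proof.
move=> FG; elim: n => [|n IH]; first by rewrite !big_geq// cabs0.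
rewrite !big_nat_recr//=; apply: le_trans (cabsD _ _) _; exact: lerD.
Qed.

Variable c : nat -> R[i].
Hypothesis c1 : forall j, cabs (c j) <= 1.

Let z j : R[i] := Complex al (- xi j).
(** One factor [al] is the cell length of a Riemann sum, the other the weight in front of the square
    function integral. *)
Let k j : R[i] := (al ^+ 2)%:C%C * c j.
Definition cell_term j (l : R[i]) : R[i] := k j * (rz (z j) l * rz (z j) l).
Definition cell_fun n (l : R[i]) : R[i] := \sum_(0 <= j < n) cell_term j l.

Let d j (l : R[i]) : R[i] := k j * (rz (z j) l * - (z j + l) ^- 2 + rz (z j) l * - (z j + l) ^- 2).

Let term_hasD j l : 0 < complex.Re l -> hasD (cell_term j) l (d j l).
Proof.
move=> l0; have h := rz_hasD (@rz_neq0 R (z j) l al0 l0).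
exact: hasDZ (hasDM h h).
Qed.

Let fun_hasD n l : 0 < complex.Re l -> hasD (cell_fun n) l (\sum_(0 <= j < n) d j l).
Proof.
move=> l0; elim: n => [|n IH].
  rewrite big_geq//; have -> : cell_fun 0 = fun=> 0.
    by apply/funext => w; rewrite /cell_fun big_geq.
  exact: hasD_cst.
rewrite big_nat_recr//=; have -> : cell_fun n.+1 = fun w => cell_fun n w + cell_term n w.
  by apply/funext => w; rewrite /cell_fun big_nat_recr.
exact: (hasDD IH (term_hasD n l0)).
Qed.

Let rz_sqr j (s t : R) : cabs (rz (z j) (Complex s t)) ^+ 2 = ((al + s) ^+ 2 + (xi j - t) ^+ 2)^-1.
Proof.
rewrite /rz cabsV exprVn cabs_sqr /=; congr (_ + _)^-1.
by ring.
Qed.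

Let cabs_k j : cabs (k j) <= al ^+ 2.
Proof.
rewrite /k cabsM cabs_real ger0_norm ?sqr_ge0// -[leRHS]mulr1 ler_wpM2l ?sqr_ge0//.
Qed.

Let term_le (s t : R) j : cabs (cell_term j (Complex s t)) <=
  al * (al / ((al + s) ^+ 2 + (xi j - t) ^+ 2)).
Proof.
rewrite /cell_term cabsM cabsM -expr2 rz_sqr mulrA -expr2 ler_wpM2r//.
by rewrite invr_ge0 addr_ge0 ?sqr_ge0.
Qed.

Let d_le (s t : R) j : 0 < s -> cabs (d j (Complex s t)) <=
  2 * al / (al + s) * (al / ((al + s) ^+ 2 + (xi j - t) ^+ 2)).
Proof.
move=> s0; have as0 : 0 < al + s by rewrite addr_gt0.
have -> : d j (Complex s t) = - 2 * k j * (rz (z j) (Complex s t) * rz (z j) (Complex s t) ^+ 2).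
  by rewrite /d /rz exprVn; ring.
rewrite !cabsM -expr2 rz_sqr cabsN cabs_natr.
have h : cabs (rz (z j) (Complex s t)) <= (al + s)^-1.
  rewrite /rz cabsV lef_pV2 ?posrE//.
    exact: (@rz_lower R (z j) (Complex s t) al0 s0).
  by apply: lt_le_trans as0 (@rz_lower R (z j) (Complex s t) al0 s0).
rewrite [leRHS](_ : _ = 2 * al ^+ 2 * ((al + s)^-1 * ((al + s) ^+ 2 + (xi j - t) ^+ 2)^-1)); last ring.
have q0 : 0 <= ((al + s) ^+ 2 + (xi j - t) ^+ 2)^-1 by rewrite invr_ge0 addr_ge0 ?sqr_ge0.
apply: ler_pM; rewrite ?mulr_ge0 ?cabs_ge0//.
  by rewrite -cabsM ler_wpM2l// cabs_k.
by rewrite ler_wpM2r.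
Qed.

(** The bound does not depend on the size or number of the cells, on the sample points, or on the
    phases. At abscissa [s], [cell_sum] with [d = al + s] bounds the function by
    [3 pi al / (al + s)] and its derivative by [6 pi] times [hker al s], of mass one; hence
    [9 = 3 + 6]. *)
Lemma inB_cell_fun n : inB (cell_fun n) /\ Bnorm (cell_fun n) <= 9 * pi.
Proof.
have pi0 := pi_gt0 R.
have al1 s : 0 < s -> al <= al + s by move=> s0; rewrite lerDl ltW.
have i6 : mu.-integrable Rpos (EFin \o (fun s => 6 * pi * hker al s)).
  by apply: integrable_RZ => //; exact: integrable_hker.
have [||//||gB gN] := @inB_intro R (cell_fun n) (3 * pi) (fun s => 6 * pi * hker al s).
- exact: holo_intro (fun_hasD n).
- move=> [s t] /= s0; apply: le_trans (cabs_sum_le _ (term_le s t)) _.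
  rewrite -mulr_sumr; apply: le_trans (ler_wpM2l (ltW al0) (cell_sum t n (al1 s s0))) _.
  have as0 : 0 < al + s by rewrite addr_gt0.
  rewrite mulrA ler_pdivrMr// [leRHS]mulrC ler_wpM2r ?al1// mulr_ge0// ltW//.
- move=> s t s0; rewrite (hasD_cderiv (fun_hasD n (l := Complex s t) s0)).
  apply: le_trans (cabs_sum_le _ (fun j => d_le t j s0)) _.
  have as0 : 0 < al + s by rewrite addr_gt0.
  have k0 : 0 <= 2 * al / (al + s) by rewrite divr_ge0 ?mulr_ge0 ?(ltW al0)// ltW.
  rewrite -mulr_sumr; apply: le_trans (ler_wpM2l k0 (cell_sum t n (al1 s s0))) _.
  rewrite /hker le_eqVlt; apply/orP; left; apply/eqP.
  by move: (pi : R) => p; field; rewrite gt_eqF.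
split=> //; apply: le_trans gN _; rewrite RintegralZl//; last exact: integrable_hker.
by rewrite Rintegral_hker// mulr1; lra.
Qed.

End CellSums.

Section CellIntegral.
Context {R : realType}.
Notation mu := (@lebesgue_measure R).
Variables (phi : R -> R) (al A0 : R).
Hypotheses (al0 : 0 < al) (phic : forall t, {for t, continuous phi}).

(** Sampling at a maximum in each cell makes the Riemann sum an upper sum, so it dominates the
    integral exactly, with no error term. *)
Lemma cell_max j : exists x, node al A0 j <= x <= node al A0 j.+1 /\
  forall t, node al A0 j <= t <= node al A0 j.+1 -> phi t <= phi x.
Proof.
have jj : node al A0 j <= node al A0 j.+1 by rewrite nodeS lerDl ltW.
have [|x] := @EVT_max R phi _ _ jj.
  by apply: continuous_subspaceT => t; exact: phic.
rewrite in_itv /= => xj Hx; exists x; split => // t tj; exact: Hx.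
Qed.

Let integ (a b : R) : cintegrable `[a, b] (fun t => (phi t)%:C%C : R[i]).
Proof.
apply: cintegrable_itv => t _ e e0.
have H : phi s @[s --> t] --> phi t by exact: phic.
move: H => /cvgrPdist_lt/(_ e e0)/nbhs_ballP[d d0 Hd].
exists d => // s sd; rewrite -rmorphB cabs_real distrC; apply: Hd.
by rewrite -ball_normE /= distrC.
Qed.

Lemma integrable_continuous_itv (a b : R) : mu.-integrable `[a, b] (EFin \o phi).
Proof. by case: (integ a b). Qed.

Lemma cell_integral (xi : nat -> R) n :
  (forall j t, node al A0 j <= t <= node al A0 j.+1 -> phi t <= phi (xi j)) ->
  Rintegral mu `[A0, node al A0 n] phi <= \sum_(0 <= j < n) al * phi (xi j).
Proof.
move=> H; elim: n => [|n IH].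
  rewrite big_geq// /node mul0r addr0.
  by rewrite set_itv1 Rintegral_set1.
have n0 : A0 <= node al A0 n by rewrite /node lerDl mulr_ge0// ltW.
have nn : node al A0 n <= node al A0 n.+1 by rewrite nodeS lerDl ltW.
have /(congr1 (@complex.Re R)) := cint_itv_split n0 nn (integ A0 (node al A0 n.+1)).
rewrite cReD /= => ->; rewrite big_nat_recr//=; apply: lerD => //.
have -> : al * phi (xi n) = Rintegral mu `[node al A0 n, node al A0 n.+1] (fun=> phi (xi n)).
  by rewrite Rintegral_itv_cst// nodeS addrAC subrr add0r.
apply: le_Rintegral => //.
- exact: integrable_continuous_itv.
- exact: integrable_itv_cst.
- by move=> t; rewrite /= in_itv /=; exact: H.
Qed.

End CellIntegral.

Section IntegrableLimit.
Context {R : realType}.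
Notation mu := (@lebesgue_measure R).
Variables (phi : R -> R) (C : R).
Hypotheses (phic : forall t, {for t, continuous phi}) (phi0 : forall t, 0 <= phi t).
Hypothesis bound : forall n : nat, Rintegral mu `[- n%:R, n%:R] phi <= C.

Lemma integrable_of_bounded : mu.-integrable setT (EFin \o phi) /\ Rintegral mu setT phi <= C.
Proof.
have mphi : measurable_fun setT phi by apply: continuous_measurable_fun => t; exact: phic.
pose S (n : nat) : set R := `[- n%:R, n%:R]%classic.
have US : \bigcup_i S i = setT.
  apply/seteqP; split => // t _; exists (Num.bound t) => //.
  rewrite /S /= in_itv/= -ler_norml.
  apply: ltW; have := archi_boundP (normr_ge0 t).
  by rewrite /Num.bound normr_id.
have cv := @ge0_nondecreasing_set_cvg_integral _ (measurableTypeR R) R S (EFin \o phi) mu.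
have le : (\int[mu]_t (phi t)%:E <= C%:E)%E.
  have {}cv : (\int[mu]_(x in S i) (EFin \o phi) x)%E @[i --> \oo] --> (\int[mu]_t (phi t)%:E)%E.
    rewrite -US; apply: cv.
    - move=> n m nm; apply/subsetPset => t; rewrite /S /= !in_itv/= => /andP[a b].
      have nmR : n%:R <= m%:R :> R by rewrite ler_nat.
      by apply/andP; split; lra.
    - by move=> i; exact: measurable_itv.
    - move=> i; apply/measurable_EFinP; exact: measurable_funTS.
    - by move=> i t _; rewrite lee_fin.
  apply: cvge_to_le cv _; apply: nearW => n.
  have := bound n; rewrite -lee_fin; apply: le_trans.
  rewrite /Rintegral fineK//; apply: integrable_fin_num => //.
  exact: integrable_continuous_itv.
have ip : mu.-integrable setT (EFin \o phi).
  apply/integrableP; split; first exact/measurable_EFinP.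
  apply: le_lt_trans (ltry C); apply: le_trans le; apply: ge0_le_integral => //.
  - by apply/measurable_EFinP; apply: measurableT_comp.
  - exact/measurable_EFinP.
  - by move=> t _; rewrite lee_fin ger0_norm.
split=> //; rewrite -lee_fin /Rintegral fineK//; exact: integrable_fin_num.
Qed.

End IntegrableLimit.

Section SquareFunction.
Context {R : realType} {X : completeNormedModType R[i]}.
Notation mu := (@lebesgue_measure R).
Variables (D : set X) (A : X -> X) (Phi : (R[i] -> R[i]) -> X -> X).
Hypothesis BC : B_calculus D A Phi.
Variables (x : X) (xs : X -> R[i]^o).
Hypothesis dxs : in_dual xs.
Notation res := (resolv D A).

Lemma hasD_quadratic (f : R[i] -> R[i]) z l (d C : R) : 0 < d -> 0 <= C ->
  (forall w, cabs (w - z) < d -> cabs (f w - f z - l * (w - z)) <= C * cabs (w - z) ^+ 2) ->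
  hasD f z l.
Proof.
move=> d0 C0 H e e0; exists (Num.min d (e / (C + 1))).
  by rewrite lt_min d0 divr_gt0// ltr_wpDl.
move=> h; rewrite lt_min => /andP[hd he].
have E : z + h - z = h by rewrite addrAC subrr add0r.
have := H (z + h); rewrite E => /(_ hd)/le_trans; apply.
rewrite expr2 mulrA ler_wpM2r ?cabs_ge0//.
move: he; rewrite ltr_pdivlMr ?ltr_wpDl// => /ltW; apply: le_trans.
by rewrite mulrC ler_wpM2l ?cabs_ge0// lerDl.
Qed.

(** The resolvent identity as a Taylor step from [v] to [w]. Applied repeatedly it produces explicit
    remainders with the factor [(v - w) ^+ 2], from which the derivatives of the first and second
    powers of the resolvent are read off. *)
Lemma dual_resS v w y : 0 < complex.Re v -> 0 < complex.Re w ->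
  xs (res v y) = xs (res w y) - (v - w) * xs (res v (res w y)).
Proof.
move=> v0 w0; rewrite -(dualZ dxs) -(dualB dxs); congr xs.
by rewrite -[(v - w) *: _]opprK -scaleNr opprB -(res_identity BC)// opprK addrC subrK.
Qed.

Lemma res_comm v w y : 0 < complex.Re v -> 0 < complex.Re w -> res v (res w y) = res w (res v y).
Proof.
move=> v0 w0; have [rB _] := inB_rz v0.
by have := calculus_res BC y rB w0; rewrite !(calculus_rz BC).
Qed.

Lemma res_norm_le : exists2 M : R, 0 <= M & forall (s : R) z y, 0 < s -> s <= complex.Re z ->
  nrm (res z y) <= M / s * nrm y.
Proof.
have [M M0 HM] := res_bound BC; exists M => // s z y s0 sz.
have z0 := lt_le_trans s0 sz.
apply: le_trans (HM z y z0) _; rewrite ler_wpM2r ?nrm_ge0// ler_wpM2l//.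
by rewrite lef_pV2 ?posrE.
Qed.

Let Re_half (v w : R[i]) : cabs (v - w) < complex.Re w / 2 -> complex.Re w / 2 <= complex.Re v.
Proof.
move=> h; have := Re_le_cabs (w - v); rewrite cabsBC !ReImE => h'; lra.
Qed.

Lemma dual_res_hasD w : 0 < complex.Re w ->
  hasD (fun w => xs (res w x)) w (- xs (res w (res w x))).
Proof.
move=> w0; have [M M0 HM] := res_norm_le; have [L L0 HL] := dual_le dxs.
have s0 : 0 < complex.Re w / 2 by rewrite divr_gt0.
set s := complex.Re w / 2 in s0.
have sw : s <= complex.Re w by rewrite /s; lra.
pose q := M / s; have q0 : 0 <= q by rewrite divr_ge0// ltW.
apply: (@hasD_quadratic _ w _ s (L * (q * (q * (q * nrm x))))) => //.
  by move: (q) q0 => r r0; rewrite !mulr_ge0 ?nrm_ge0.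
move=> v hv; have sv : s <= complex.Re v by exact: Re_half.
have v0 := lt_le_trans s0 sv.
have E1 := dual_resS x v0 w0; have E2 := dual_resS (res w x) v0 w0.
rewrite E1 E2; set c := xs (res w (res w x)); set d := xs (res v _).
rewrite (_ : _ - _ = d * (v - w) ^+ 2); last by ring.
rewrite cabsM cabsX ler_wpM2r ?sqr_ge0//; apply: le_trans (HL _) _.
rewrite ler_wpM2l//; apply: le_trans (HM s _ _ s0 sv) _.
rewrite ler_wpM2l//; apply: le_trans (HM s _ _ s0 sw) _.
rewrite ler_wpM2l//; exact: (HM s _ _ s0 sw).
Qed.

Lemma dual_res2_hasD w : 0 < complex.Re w ->
  hasD (fun w => xs (res w (res w x))) w (- 2 * xs (res w (res w (res w x)))).
Proof.
move=> w0; have [M M0 HM] := res_norm_le; have [L L0 HL] := dual_le dxs.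
have s0 : 0 < complex.Re w / 2 by rewrite divr_gt0.
set s := complex.Re w / 2 in s0.
have sw : s <= complex.Re w by rewrite /s; lra.
pose q := M / s; have q0 : 0 <= q by rewrite divr_ge0// ltW.
pose K := L * (q * (q * (q * (q * nrm x)))).
have K0 : 0 <= K by rewrite /K; move: (q) q0 => r r0; rewrite !mulr_ge0 ?nrm_ge0.
apply: (@hasD_quadratic _ w _ s (2 * K + K)) => //.
  by rewrite addr_ge0// mulr_ge0.
move=> v hv; have sv : s <= complex.Re v by exact: Re_half.
have v0 := lt_le_trans s0 sv.
have sq y : xs (res v (res v y)) = xs (res v (res w y)) - (v - w) * xs (res v (res v (res w y))).
  by rewrite (dual_resS (res v y) v0 w0) !(res_comm _ w0 v0).
rewrite (sq x) (sq (res w x)) (dual_resS (res w x) v0 w0) (dual_resS (res w (res w x)) v0 w0).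
set c := xs (res w (res w (res w x))); set d2 := xs (res v (res v _)); set d1 := xs (res v (res w _)).
rewrite (_ : _ - _ = (2 * d1 + d2) * (v - w) ^+ 2); last by ring.
rewrite cabsM cabsX ler_wpM2r ?sqr_ge0//; apply: le_trans (cabsD _ _) _.
have H4 u1 u2 u3 u4 : s <= complex.Re u1 -> s <= complex.Re u2 -> s <= complex.Re u3 ->
    s <= complex.Re u4 -> cabs (xs (res u1 (res u2 (res u3 (res u4 x))))) <= K.
  move=> h1 h2 h3 h4; apply: le_trans (HL _) _; rewrite ler_wpM2l//.
  apply: le_trans (HM s _ _ s0 h1) _; rewrite ler_wpM2l//.
  apply: le_trans (HM s _ _ s0 h2) _; rewrite ler_wpM2l//.
  apply: le_trans (HM s _ _ s0 h3) _; rewrite ler_wpM2l//.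
  exact: (HM s _ _ s0 h4).
apply: lerD; last exact: H4.
rewrite cabsM cabs_natr.
by rewrite ler_wpM2l//; exact: H4.
Qed.

Definition resq (a b : R) : R[i] := xs (res (Complex a (- b)) (res (Complex a (- b)) x)).

Lemma resq_pcont (a b : R) : 0 < a -> pcont (resq a) b.
Proof.
move=> a0; apply: (@ccontinuous_path R (fun w => xs (res w (res w x))) (fun b => Complex a (- b))).
  by move=> s t; apply: le_trans (vline_lip _ _ _) _; rewrite opprK addrC distrC.
exact: hasD_continuous (dual_res2_hasD (w := Complex a (- b)) a0).
Qed.

Lemma calculus_cell_fun (al : R) (A0 : R) (xi : nat -> R) (c : nat -> R[i]) n : 0 < al ->
  (forall j, node al A0 j <= xi j <= node al A0 j.+1) ->
  (forall j, cabs (c j) = 1) -> (forall j, c j * resq al (xi j) = (cabs (resq al (xi j)))%:C%C) ->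
  xs (Phi (cell_fun al xi c n) x) = (\sum_(0 <= j < n) al ^+ 2 * cabs (resq al (xi j)))%:C%C.
Proof.
move=> al0 xiP c1 cr; have c1' j : cabs (c j) <= 1 by rewrite c1.
elim: n => [|n IH].
  rewrite big_geq//; have -> : cell_fun al xi c 0 = fun l => 0 * (fun=> 0) l.
    by apply/funext => w; rewrite /cell_fun big_geq// mul0r.
  by rewrite (calculusZ BC 0 x (inB_cst 0)) scale0r dual0.
rewrite big_nat_recr//=; have -> : cell_fun al xi c n.+1 =
    fun w => cell_fun al xi c n w + cell_term al xi c n w.
  by apply/funext => w; rewrite /cell_fun big_nat_recr.
have [nB _] := inB_cell_fun al0 xiP c1' n.
have z0 : 0 < complex.Re (Complex al (- xi n)) by [].
have [rB _] := inB_rz z0; have r2B := inBM rB rB.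
have tB : inB (cell_term al xi c n) := inBZ _ r2B.
rewrite (calculusD BC x nB tB) (dualD dxs) IH rmorphD; congr (_ + _).
rewrite /cell_term (calculusZ BC _ x r2B) (calculusM BC x rB rB) !(calculus_rz BC)//.
rewrite (dualZ dxs) -mulrA.
transitivity (((al ^+ 2)%:C%C : R[i]) * (cabs (resq al (xi n)))%:C%C); first by rewrite -cr.
by rewrite -rmorphM.
Qed.

Lemma square_function : exists2 C : R, 0 <= C & forall a : R, 0 < a ->
  mu.-integrable setT (EFin \o (fun b => cabs (resq a b))) /\
  Rintegral mu setT (fun b => cabs (resq a b)) <= C / a.
Proof.
have [M M0 HM] := calculus_bounded BC; have [L L0 HL] := dual_le dxs.
have pi0 := pi_gt0 R.
pose C := L * (M * (9 * pi) * nrm x).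
have C0 : 0 <= C by rewrite /C !mulr_ge0 ?nrm_ge0// ltW.
exists C => // a a0.
have phic t : {for t, continuous (fun b => cabs (resq a b))}.
  by apply: pcont_cabs; exact: resq_pcont.
apply: integrable_of_bounded => //; first by move=> t; exact: cabs_ge0.
move=> n; pose A0 : R := - n%:R.
have [xi Hxi] := choice (cell_max A0 a0 phic).
have xiP j : node a A0 j <= xi j <= node a A0 j.+1 by case: (Hxi j).
have [c Hc] : {c : nat -> R[i] & forall j, cabs (c j) = 1 /\
    c j * resq a (xi j) = (cabs (resq a (xi j)))%:C%C}.
  apply: (@choice nat R[i] (fun j c => cabs c = 1 /\ c * resq a (xi j) = (cabs (resq a (xi j)))%:C%C)).
  by move=> j; have [c0 h1 h2] := cabs_rotation (resq a (xi j)); exists c0.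
have c1 j : cabs (c j) = 1 by case: (Hc j).
have c1' j : cabs (c j) <= 1 by rewrite c1.
have cr j : c j * resq a (xi j) = (cabs (resq a (xi j)))%:C%C by case: (Hc j).
(* Enough cells of length [a], starting from [- n], to cover [[-n, n]]. Their number grows with [n],
   but the B-norm of the test function does not. *)
pose m := Num.bound (2 * n%:R / a).
have nm : n%:R <= node a A0 m.
  have : 2 * n%:R / a < m%:R by apply: archi_boundP; rewrite divr_ge0 ?mulr_ge0// ltW.
  by rewrite ltr_pdivrMr// /node /A0 => h; lra.
have S1 : Rintegral mu `[- n%:R, n%:R] (fun b => cabs (resq a b)) <=
    Rintegral mu `[A0, node a A0 m] (fun b => cabs (resq a b)).
  have i1 := integrable_continuous_itv phic (- n%:R) n%:R.
  have i2 := integrable_continuous_itv phic A0 (node a A0 m).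
  rewrite -lee_fin /Rintegral !fineK; [|exact: integrable_fin_num..].
  apply: ge0_subset_integral => //.
  - exact: (measurable_int mu i2).
  - by move=> t _; rewrite lee_fin cabs_ge0.
  - move=> t /=; rewrite !in_itv /= => /andP[-> h]; exact: le_trans h nm.
have S2 := @cell_integral R _ a A0 a0 phic xi m (fun j => (Hxi j).2).
have [gB gN] := inB_cell_fun a0 xiP c1' m.
have E := calculus_cell_fun m a0 xiP c1 cr.
have S3 : \sum_(0 <= j < m) a ^+ 2 * cabs (resq a (xi j)) <= C.
  apply: le_trans (ler_norm _) _; rewrite -cabs_real -E.
  apply: le_trans (HL _) _; rewrite /C ler_wpM2l//.
  apply: le_trans (HM _ _ gB) _; rewrite ler_wpM2r ?nrm_ge0// ler_wpM2l//.
rewrite ler_pdivlMr//; apply: le_trans S3.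
apply: le_trans (ler_wpM2r (ltW a0) (le_trans S1 S2)) _.
rewrite le_eqVlt; apply/orP; left; apply/eqP.
by rewrite mulr_suml; apply: eq_bigr => j _; ring.
Qed.

End SquareFunction.

(** * The double integral *)

Section IntegralLimits.
Context {R : realType}.
Notation mu := (@lebesgue_measure R).
Notation Rpos := (`]0%R, +oo[ : set R).

Lemma cabs_small_eq (z w : R[i]) : (forall e : R, 0 < e -> cabs (z - w) < e) -> z = w.
Proof.
move=> H; apply/eqP; rewrite -subr_eq0 -cabs_eq0 eq_le cabs_ge0 andbT.
by apply/ler_addgt0Pl => e e0; rewrite addr0; exact/ltW/H.
Qed.

Lemma cint_opp (g : R -> R[i]) : (forall t, pcont g t) -> cintegrable setT g ->
  cintegrable setT (fun t => g (- t)) -> cint setT (fun t => g (- t)) = cint setT g.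
Proof.
move=> gc ig ig'.
have E (n : nat) : cint `[- n%:R, n%:R] (fun t => g (- t)) = cint `[- n%:R, n%:R] g.
  have nn : - n%:R <= n%:R :> R by rewrite ge0_cp.
  have H (u : R -> R) : (forall t, {for t, continuous u}) ->
      Rintegral mu `[- n%:R, n%:R] (fun t => u (- t)) = Rintegral mu `[- n%:R, n%:R] u.
    move=> uc; rewrite /Rintegral; congr fine; symmetry.
    have := @integration_by_substitution_oppr R u (- n%:R) n%:R nn.
    by rewrite opprK; apply; apply: continuous_subspaceT => t; exact: uc.
  apply: complexP; rewrite /=.
    by apply: (H (fun t => complex.Re (g t))) => t; exact: pcont_Re.
  by apply: (H (fun t => complex.Im (g t))) => t; exact: pcont_Im.
apply: cabs_small_eq => e e0; have e2 : 0 < e / 2 by rewrite divr_gt0.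
have [N1 H1] := cint_trunc ig e2; have [N2 H2] := cint_trunc ig' e2.
have := H1 (maxn N1 N2) (leq_maxl _ _); have := H2 (maxn N1 N2) (leq_maxr _ _).
rewrite E cabsBC => h1 h2; apply: le_lt_trans (cabs_triangle _ _ _) _.
by rewrite [e]splitr; exact: ltrD h1 h2.
Qed.

Lemma cint_Rpos_trunc (h : R -> R[i]) : cintegrable Rpos h -> forall e : R, 0 < e ->
  exists N, forall n, (N <= n)%N -> cabs (cint `[0, n%:R] h - cint Rpos h) < e.
Proof.
move=> ih e e0; have mh := cmeas_of_cintegrable ih.
have sub (n : nat) : `]0%R, n%:R] `<=` Rpos.
  by move=> t /=; rewrite !in_itv /= andbT => /andP[].
have ihn (n : nat) : cintegrable `]0%R, n%:R] h by exact: cintegrableS (sub n) ih.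
have E (n : nat) : cint `[0, n%:R] h = cint `]0, n%:R] h.
  have [i1 i2] := ihn n.
  by apply: complexP; rewrite /= Rintegral_itv_obnd_cbnd.
have [||||||N HN] := @cint_dominated R Rpos
  (fun n t => if t \in (`]0%R, n%:R] : set R) then h t else 0) h
  (fun t => cabs (h t)) _ _ mh (cintegrable_cabs _ ih) _ _ _ e e0 => //.
- move=> n; apply: cmeas_setT => //; apply: cmeas_restrict => //.
  exact: cmeas_of_cintegrable.
- by move=> n t _; case: ifP => // _; rewrite cabs0 cabs_ge0.
- move=> t /Rpos_gt0 t0 r r0; exists (Num.bound t) => n tn.
  rewrite ifT ?subrr ?cabs0// inE /= in_itv/= t0 /=.
  by rewrite (le_trans (ltW (archi_boundP (ltW t0))))// ler_nat.
exists N => n Nn; rewrite E; have := HN n Nn.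
rewrite (_ : cint Rpos (fun t => if _ then _ else _) = cint `]0, n%:R] h)//.
rewrite cint_mkcond [RHS]cint_mkcond; apply: eq_cint => t _.
case: (boolP (t \in (`]0%R, n%:R] : set R))) => [/set_mem tn|_]; last by case: ifP.
by rewrite ifT//; apply/mem_set; exact: sub tn.
Qed.

Lemma pcont_path (f : R[i] -> R[i]) (p v : R[i]) t : ccontinuous_at f (p + t%:C%C * v) ->
  pcont (fun s => f (p + s%:C%C * v)) t.
Proof.
move=> fc e e0; have [d d0 Hd] := fc e e0.
have v0 : 0 < cabs v + 1 by rewrite ltr_wpDl ?cabs_ge0.
exists (d / (cabs v + 1)); first by rewrite divr_gt0.
move=> s; rewrite ltr_pdivlMr// => sd; apply: Hd.
rewrite (_ : _ - _ = (s - t)%:C%C * v); last by rewrite rmorphB; ring.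
rewrite cabsM cabs_real; apply: le_lt_trans sd.
by rewrite ler_wpM2l// lerDl.
Qed.

End IntegralLimits.

(** Bounded and Lipschitz on each half-plane [Re u >= s]. The class contains the elements of B and
    their derivatives and is stable under products, so it contains each term of the Leibniz rule;
    the integral estimates are stated for it. *)
Definition llip (R : realType) (psi : R[i] -> R[i]) : Prop :=
  forall s : R, 0 < s -> exists M L : R, [/\ 0 <= M, 0 <= L,
    forall u, s <= complex.Re u -> cabs (psi u) <= M &
    forall u v, s <= complex.Re u -> s <= complex.Re v ->
      cabs (psi u - psi v) <= L * cabs (u - v)].

Section LocallyLipschitz.
Context {R : realType}.
Implicit Types (f g : R[i] -> R[i]).

Lemma llip_hasD (f d : R[i] -> R[i]) : (forall w, 0 < complex.Re w -> hasD f w (d w)) ->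
  (forall s : R, 0 < s -> exists M L : R, [/\ 0 <= M, 0 <= L,
    forall u, s <= complex.Re u -> cabs (f u) <= M &
    forall u, s <= complex.Re u -> cabs (d u) <= L]) -> llip f.
Proof.
move=> fd H s s0; have [M [L [M0 L0 HM HL]]] := H s s0; exists M, L; split => // u v su sv.
have Re_ge t : 0 <= t <= 1 -> s <= complex.Re (v + t%:C%C * (u - v)).
  by move=> /andP[t0 t1]; rewrite !ReImE /=; nra.
have := @path_mvt R f v (u - v) (fun t => d (v + t%:C%C * (u - v))) 1 (L * cabs (u - v)) ler01.
rewrite (_ : v + 1%:C%C * (u - v) = u) ?mulr1; last by rewrite mul1r addrC subrK.
apply.
- by move=> t /Re_ge h; apply: fd; exact: lt_le_trans h.
- by move=> t /Re_ge h; rewrite cabsM ler_wpM2r ?cabs_ge0// HL.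
Qed.

Lemma llip_inB f : inB f -> llip f.
Proof.
move=> fB; apply: (llip_hasD (d := cderiv f)); first by move=> w; exact: inB_hasD.
move=> s s0; have K0 := snorm_ge0 fB; exists (snorm f), (snorm f / s); split => //.
- by rewrite divr_ge0// ltW.
- move=> u su; apply: (inB_bdd fB); exact: lt_le_trans su.
- move=> u su; have u0 := lt_le_trans s0 su.
  apply: le_trans (holo_deriv_le (inB_holo fB) (inB_bdd fB) u0) _.
  by rewrite ler_wpM2l// lef_pV2 ?posrE.
Qed.

Lemma llip_cderiv f : inB f -> llip (cderiv f).
Proof.
move=> fB s s0; have K0 := snorm_ge0 fB.
exists (snorm f / s), (4 * snorm f / s ^+ 2); split.
- by rewrite divr_ge0// ltW.
- by rewrite divr_ge0 ?sqr_ge0// mulr_ge0.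
- move=> u su; have u0 := lt_le_trans s0 su.
  apply: le_trans (holo_deriv_le (inB_holo fB) (inB_bdd fB) u0) _.
  by rewrite ler_wpM2l// lef_pV2 ?posrE.
- move=> u v su sv; exact: (holo_deriv_lip (inB_holo fB) (inB_bdd fB) s0 su sv).
Qed.

Lemma llipM f g : llip f -> llip g -> llip (fun w => f w * g w).
Proof.
move=> hf hg s s0; have [M [L [M0 L0 HM HL]]] := hf s s0.
have [N [K [N0 K0 HN HK]]] := hg s s0.
exists (M * N), (M * K + L * N); split.
- exact: mulr_ge0.
- by rewrite addr_ge0 ?mulr_ge0.
- by move=> u su; rewrite cabsM ler_pM ?cabs_ge0 ?HM ?HN.
- move=> u v su sv; rewrite (_ : _ - _ = f u * (g u - g v) + (f u - f v) * g v); last by ring.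
  apply: le_trans (cabsD _ _) _; rewrite !cabsM mulrDl; apply: lerD.
    by rewrite -mulrA ler_pM ?cabs_ge0 ?HM ?HK.
  by rewrite mulrAC ler_pM ?cabs_ge0 ?HN ?HL.
Qed.

Lemma llip_continuous f w : llip f -> 0 < complex.Re w -> ccontinuous_at f w.
Proof.
move=> hf w0 e e0; have s0 : 0 < complex.Re w / 2 by rewrite divr_gt0.
set s := complex.Re w / 2 in s0.
have [M [L [_ L0 _ HL]]] := hf s s0.
exists (Num.min s (e / (L + 1))); first by rewrite lt_min s0 divr_gt0// ltr_wpDl.
move=> v; rewrite lt_min => /andP[vs ve].
have sv : s <= complex.Re v.
  have := Re_le_cabs (w - v); rewrite cabsBC !ReImE => h; move: vs; rewrite /s in h *; lra.
have sw : s <= complex.Re w by rewrite /s; lra.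
apply: le_lt_trans (HL _ _ sv sw) _; move: ve; rewrite ltr_pdivlMr ?ltr_wpDl// mulrC.
by apply: le_lt_trans; rewrite ler_wpM2r ?cabs_ge0// lerDl.
Qed.

Lemma cmeas_limit (D : set R) (h_ : nat -> R -> R[i]) h : (forall n, cmeas D (h_ n)) ->
  (forall t, D t -> forall e : R, 0 < e -> exists N, forall n, (N <= n)%N ->
    cabs (h_ n t - h t) < e) -> cmeas D h.
Proof.
move=> mh H; split.
- apply: (@measurable_fun_cvg _ _ _ D (fun n t => complex.Re (h_ n t))).
    by move=> n; case: (mh n).
  move=> t Dt; apply/cvgrPdist_lt => e e0; have [N HN] := H t Dt e e0.
  exists N => // n /= Nn; apply: le_lt_trans (HN n Nn).
  by rewrite cabsBC; apply: le_trans (cabs_Re _); rewrite !ReImE.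
- apply: (@measurable_fun_cvg _ _ _ D (fun n t => complex.Im (h_ n t))).
    by move=> n; case: (mh n).
  move=> t Dt; apply/cvgrPdist_lt => e e0; have [N HN] := H t Dt e e0.
  exists N => // n /= Nn; apply: le_lt_trans (HN n Nn).
  by rewrite cabsBC; apply: le_trans (cabs_Im _); rewrite !ReImE.
Qed.

End LocallyLipschitz.

Section InnerIntegral.
Context {R : realType} {X : completeNormedModType R[i]}.
Notation mu := (@lebesgue_measure R).
Notation Rpos := (`]0%R, +oo[ : set R).
Variables (D : set X) (A : X -> X) (Phi : (R[i] -> R[i]) -> X -> X).
Hypothesis BC : B_calculus D A Phi.
Variables (x : X) (xs : X -> R[i]^o).
Hypothesis dxs : in_dual xs.
Notation res := (resolv D A).
Notation rq := (resq D A x xs).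
Implicit Types (psi : R[i] -> R[i]) (a : R).

Definition lineint psi (a : R) : R[i] := cint setT (fun b => rq a b * psi (Complex a b)).

Lemma dual_res_le : exists2 K : R, 0 <= K & forall w, 0 < complex.Re w ->
  [/\ cabs (xs (res w x)) <= K / complex.Re w,
      cabs (xs (res w (res w x))) <= K / complex.Re w ^+ 2 &
      cabs (xs (res w (res w (res w x)))) <= K / complex.Re w ^+ 3].
Proof.
have [M M0 HM] := res_bound BC; have [L L0 HL] := dual_le dxs.
(* With [M1 >= 1] the single constant [M1 ^+ 3] serves all three powers of the resolvent. *)
pose M1 := M + 1; have M11 : 1 <= M1 by rewrite lerDr.
have M10 : 0 <= M1 by exact: le_trans M11.
have n0 := nrm_ge0 x.
exists (L * (M1 ^+ 3 * nrm x)); first by rewrite !mulr_ge0// exprn_ge0.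
move=> w w0; set s := complex.Re w in w0 *.
have H y : nrm (res w y) <= M1 / s * nrm y.
  apply: le_trans (HM w y w0) _; rewrite ler_wpM2r ?nrm_ge0// ler_wpM2r ?invr_ge0 ?(ltW w0)//.
  by rewrite lerDl.
have q0 : 0 <= M1 / s by rewrite divr_ge0// ltW.
have h1 := H x; have h2 := le_trans (H (res w x)) (ler_wpM2l q0 h1).
have h3 := le_trans (H (res w (res w x))) (ler_wpM2l q0 h2).
have MM (k : nat) : (k <= 3)%N -> M1 ^+ k <= M1 ^+ 3 by move=> k3; rewrite ler_weXn2l.
have fin y (k : nat) : (k <= 3)%N -> nrm y <= (M1 / s) ^+ k * nrm x ->
    cabs (xs y) <= L * (M1 ^+ 3 * nrm x) / s ^+ k.
  move=> k3 hy; apply: le_trans (HL _) _; rewrite -mulrA ler_wpM2l//.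
  apply: le_trans hy _; rewrite expr_div_n [leRHS]mulrAC ler_wpM2r// ler_wpM2r ?MM//.
  by rewrite invr_ge0 exprn_ge0// ltW.
split; first by have := fin _ 1%N isT; rewrite !expr1; apply.
- by apply: fin => //; rewrite expr2 -mulrA.
- by apply: fin => //; rewrite exprS expr2 -!mulrA; rewrite -!mulrA in h3.
Qed.

Lemma llip_dual_res2 : llip (fun w => xs (res w (res w x))).
Proof.
apply: (llip_hasD (d := fun w => - 2 * xs (res w (res w (res w x))))).
  by move=> w w0; exact: (dual_res2_hasD BC x dxs w0).
move=> s s0; have [K K0 HK] := dual_res_le.
exists (K / s ^+ 2), (2 * (K / s ^+ 3)); split.
- by rewrite divr_ge0 ?sqr_ge0.
- by rewrite mulr_ge0 ?divr_ge0 ?exprn_ge0// ltW.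
- move=> u su; have u0 := lt_le_trans s0 su; have [_ h _] := HK u u0.
  apply: le_trans h _; rewrite ler_wpM2l// lef_pV2 ?posrE ?exprn_gt0//.
  by rewrite lerXn2r ?nnegrE ?(ltW s0) ?(ltW u0).
- move=> u su; have u0 := lt_le_trans s0 su; have [_ _ h] := HK u u0.
  rewrite cabsM cabsN cabs_natr.
  rewrite ler_wpM2l//; apply: le_trans h _; rewrite ler_wpM2l// lef_pV2 ?posrE ?exprn_gt0//.
  by rewrite lerXn2r ?nnegrE ?(ltW s0) ?(ltW u0).
Qed.

Lemma lineint_meas1 psi a : llip psi -> 0 < a -> cmeas setT (fun b => rq a b * psi (Complex a b)).
Proof.
move=> hp a0; apply: cmeasM; apply: pcont_cmeasT => b; first exact: (resq_pcont BC x dxs b a0).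
apply: pcont_vline; exact: llip_continuous.
Qed.

Lemma lineint_integrable psi a : llip psi -> 0 < a ->
  cintegrable setT (fun b => rq a b * psi (Complex a b)).
Proof.
move=> hp a0; have [C C0 HC] := square_function BC x dxs; have [i1 _] := HC a a0.
have [M [L [M0 L0 HM _]]] := hp a a0.
apply: (@cintegrable_dom R setT _ (fun b => M * cabs (rq a b))) => //.
- exact: lineint_meas1.
- exact: integrable_RZ.
- by move=> b _; rewrite cabsM mulrC ler_wpM2r ?cabs_ge0//; exact: HM.
Qed.

Lemma lineint_le : exists2 C : R, 0 <= C & forall psi a (m : R), llip psi -> 0 < a ->
  (forall b, cabs (psi (Complex a b)) <= m) -> cabs (lineint psi a) <= C / a * m.
Proof.
have [C C0 HC] := square_function BC x dxs; exists C => // psi a m hp a0 Hm.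
have [i1 i2] := HC a a0.
have m0 : 0 <= m by exact: le_trans (cabs_ge0 _) (Hm 0).
apply: (@le_trans _ _ (Rintegral mu setT (fun b => m * cabs (rq a b)))).
  apply: cint_le => //; [exact: lineint_integrable|exact: integrable_RZ|].
  by move=> b _; rewrite cabsM mulrC ler_wpM2r ?cabs_ge0.
by rewrite RintegralZl// mulrC ler_wpM2r.
Qed.

(** Measurability in the abscissa: the integral truncated to [[-n, n]] is continuous in [a], by the
    Lipschitz bounds on both factors, and the full integral is the pointwise limit of the
    truncations. *)
Lemma lineint_meas psi : llip psi -> cmeas Rpos (lineint psi).
Proof.
move=> hp.
apply: (@cmeas_limit R Rpos (fun n a => cint `[- n%:R, n%:R] (fun b => rq a b * psi (Complex a b)))); last first.
  by move=> a /Rpos_gt0 a0; apply: cint_trunc; exact: lineint_integrable.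
move=> n; apply: pcont_cmeas_open => // a /Rpos_gt0 a0.
have s0 : 0 < a / 2 by rewrite divr_gt0.
set s := a / 2 in s0; have sa : s <= a by rewrite /s; lra.
have [M [L [M0 L0 HM HL]]] := llip_dual_res2 s0.
have [N [K [N0 K0 HN HK]]] := hp s s0.
pose Q := M * K + L * N; have Q0 : 0 <= Q by rewrite addr_ge0 ?mulr_ge0.
have nn : - n%:R <= n%:R :> R by rewrite ge0_cp.
have V0 : 0 < (n%:R - - n%:R) * Q + 1 :> R by rewrite ltr_wpDl// mulr_ge0// subr_ge0.
move=> e e0; exists (Num.min s (e / ((n%:R - - n%:R) * Q + 1))).
  by rewrite lt_min s0 divr_gt0.
move=> a'; rewrite lt_min => /andP[as' ae].
have sa' : s <= a'.
  by move: as'; rewrite ltr_norml => /andP[h _]; rewrite /s in h *; lra.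
have a'0 := lt_le_trans s0 sa'.
have int1 u : 0 < u -> cintegrable `[- n%:R, n%:R] (fun b => rq u b * psi (Complex u b)).
  by move=> u0; apply: (@cintegrableS R _ setT) => //; exact: lineint_integrable.
rewrite -cintB; [|exact: measurable_itv|exact: int1..].
apply: (@le_lt_trans _ _ ((n%:R - - n%:R) * (Q * `|a' - a|))).
  apply: cint_itv_le => //.
    by apply: cintegrableB; [exact: measurable_itv|exact: int1..].
  move=> b _.
  have E1 (r r' p p' : R[i]) : r * p - r' * p' = r * (p - p') + (r - r') * p' by ring.
  rewrite E1; apply: le_trans (cabsD _ _) _; rewrite !cabsM /Q mulrDl; apply: lerD.
    rewrite -mulrA ler_pM ?cabs_ge0//; first exact: HM.
    apply: le_trans (HK _ _ _ _) _ => //; rewrite ler_wpM2l//; exact: hline_lip.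
  rewrite [leRHS]mulrAC ler_pM ?cabs_ge0//; last exact: HN.
  apply: le_trans (HL _ _ _ _) _ => //; rewrite ler_wpM2l//; exact: hline_lip.
move: ae; rewrite ltr_pdivlMr// [ltLHS]mulrC => ae; apply: le_lt_trans ae.
by rewrite mulrA ler_wpM2r// lerDl.
Qed.

Definition areaint psi : R[i] := cint Rpos (fun a => Complex a 0 * lineint psi a).

Lemma areaint_ext psi psi' : (forall w, 0 < complex.Re w -> psi w = psi' w) ->
  areaint psi = areaint psi'.
Proof.
move=> H; apply: eq_cint => a /Rpos_gt0 a0.
have -> // : lineint psi a = lineint psi' a.
by apply: eq_cint => b _; rewrite H.
Qed.

Let real_meas : cmeas Rpos (fun a : R => Complex a 0 : R[i]).
Proof.
by split; [exact: measurable_id|exact: measurable_cst].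
Qed.

Lemma areaint_meas psi : llip psi -> cmeas Rpos (fun a => Complex a 0 * lineint psi a).
Proof. by move=> hp; apply: cmeasM => //; exact: lineint_meas. Qed.

(** The weight [a] cancels the [C / a] of the square function estimate, so a majorant of [psi] on
    vertical lines integrates with no weight left. *)
Lemma areaint_le : exists2 C : R, 0 <= C & forall psi (m : R -> R), llip psi ->
  (forall a b, 0 < a -> cabs (psi (Complex a b)) <= m a) ->
  (forall a, 0 < a -> cabs (Complex a 0 * lineint psi a) <= C * m a) /\
  (mu.-integrable Rpos (EFin \o m) ->
   cintegrable Rpos (fun a => Complex a 0 * lineint psi a) /\
   cabs (areaint psi) <= C * Rintegral mu Rpos m).
Proof.
have [C C0 HC] := lineint_le; exists C => // psi m hp Hm.
have H1 a : 0 < a -> cabs (Complex a 0 * lineint psi a) <= C * m a.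
  move=> a0; rewrite cabsM cabs_complex0 gtr0_norm//.
  apply: le_trans (ler_wpM2l (ltW a0) (HC psi a (m a) hp a0 (fun b => Hm a b a0))) _.
  by rewrite mulrA mulrCA divff ?gt_eqF// mulr1.
split=> // im; have im' := integrable_RZ C (measurable_itv _) im.
have ic : cintegrable Rpos (fun a => Complex a 0 * lineint psi a).
  apply: (cintegrable_dom _ (areaint_meas hp) im') => // a /Rpos_gt0; exact: H1.
split=> //; rewrite -RintegralZl//; apply: cint_le => // a /Rpos_gt0; exact: H1.
Qed.

End InnerIntegral.

(** * The formula for resolvent functions *)

Section ResolventIntegral.
Context {R : realType} {X : completeNormedModType R[i]}.
Notation mu := (@lebesgue_measure R).
Notation Rpos := (`]0%R, +oo[ : set R).
Variables (D : set X) (A : X -> X) (Phi : (R[i] -> R[i]) -> X -> X).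
Hypothesis BC : B_calculus D A Phi.
Variables (x : X) (xs : X -> R[i]^o).
Hypothesis dxs : in_dual xs.
Notation res := (resolv D A).
Notation rq := (resq D A x xs).

Let H2 (w : R[i]) : R[i] := xs (res w (res w x)).
Let H3 (w : R[i]) : R[i] := xs (res w (res w (res w x))).

(** The substitution [b |-> - b] puts the resolvent variable on the line [Re w = a] and turns
    [z + a + i b] into [zeta - w], with [zeta = z + 2 a] to the right of that line. The integrand
    becomes the double-pole kernel, and [cauchy_deriv] returns the derivative [-2 (zeta + A)^-3]
    times [2 pi], up to sign. *)
Lemma lineint_rz (z : R[i]) (a : R) : 0 < complex.Re z -> 0 < a ->
  lineint D A x xs (cderiv (rz z)) a = - (4 * pi)%:C%C * H3 (z + (a + a)%:C%C).
Proof.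
move=> z0 a0; set zeta := z + _; have [K K0 HK] := dual_res_le BC x dxs.
have za : a < complex.Re zeta by rewrite /zeta cReD /=; lra.
have FD w : a <= complex.Re w -> exists m, hasD H2 w m.
  by move=> aw; eexists; apply: (dual_res2_hasD BC x dxs); exact: lt_le_trans aw.
have FK w : a <= complex.Re w -> cabs (H2 w) <= K / a ^+ 2.
  move=> aw; have w0 := lt_le_trans a0 aw; have [_ h _] := HK w w0.
  apply: le_trans h _; rewrite ler_wpM2l// lef_pV2 ?posrE ?exprn_gt0//.
  by rewrite ler_sqr ?nnegrE ?(ltW a0)// ltW.
have z1 : 0 < complex.Re zeta by exact: lt_trans za.
have := cauchy_deriv FD FK za (dual_res2_hasD BC x dxs z1); rewrite -/(H3 zeta) => E.
have [rB _] := inB_rz z0; have ii := lineint_integrable BC x dxs (llip_cderiv rB) a0.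
pose g b := kernel2 H2 zeta zeta (Complex a b).
have aneq : complex.Re zeta <> a by move=> e; move: za; rewrite e ltxx.
have ptw b : rq a b * cderiv (rz z) (Complex a b) = - g (- b).
  have n0 : z + Complex a b != 0 by exact: rz_neq0.
  rewrite (hasD_cderiv (rz_hasD n0)) /g /kernel2 /H2 -/(rq a b).
  have -> : Complex a (- b) - zeta = - (z + Complex a b).
    by rewrite /zeta; apply: complexP; rewrite !ReImE /=; ring.
  by rewrite mulrNN -expr2 mulrN.
have ig : cintegrable setT g by exact: (kernel2_integrable FD FK aneq aneq).
have ig' : cintegrable setT (fun b => g (- b)).
  have := cintegrableN measurableT ii; apply: eq_cintegrable => // b _.
  by rewrite ptw opprK.
have gc b : pcont g b.
  apply: (@pcont_vline R (kernel2 H2 zeta zeta)).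
  have nb := lineP b aneq.
  have [m hm] := kernel2_hasD FD (u := zeta) (v := zeta) (w := Complex a b) (lexx a) nb nb.
  exact: hasD_continuous hm.
rewrite /lineint (eq_cint (k := fun b => - g (- b))); last by move=> b _; exact: ptw.
rewrite cintN// cint_opp// -[cint setT g]/(vint a (kernel2 H2 zeta zeta)) E.
rewrite (_ : (4 * pi)%:C%C = 2 * (2 * pi)%:C%C :> R[i]); last first.
  move: (pi : R) => p; rewrite (_ : 4 * p = 2 * p + 2 * p); last by ring.
  by rewrite [RHS]mulr_natl mulr2n [LHS]rmorphD.
by move: ((2 * pi)%:C%C) => q; ring.
Qed.

Let H1 (w : R[i]) : R[i] := xs (res w x).

(** Up to the factor [-2] this is the derivative of a holomorphic function that is bounded on
    [Re v >= s], so the Cauchy bound on derivatives makes it Lipschitz near [w]. *)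
Lemma dual_res3_continuous w : 0 < complex.Re w -> ccontinuous_at H3 w.
Proof.
move=> w0; have [K K0 HK] := dual_res_le BC x dxs.
pose s := complex.Re w / 4; have s0 : 0 < s by rewrite divr_gt0.
have FD v : s <= complex.Re v -> exists m, hasD H2 v m.
  by move=> aw; eexists; apply: (dual_res2_hasD BC x dxs); exact: lt_le_trans aw.
have FK v : s <= complex.Re v -> cabs (H2 v) <= K / s ^+ 2.
  move=> aw; have v0 := lt_le_trans s0 aw; have [_ h _] := HK v v0.
  apply: le_trans h _; rewrite ler_wpM2l// lef_pV2 ?posrE ?exprn_gt0//.
  by rewrite ler_sqr ?nnegrE ?(ltW s0)// ltW.
pose C := K / s ^+ 2 / s ^+ 2; have C0 : 0 <= C by rewrite !divr_ge0 ?sqr_ge0.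
move=> e e0; exists (Num.min s (e / (C + 1))).
  by rewrite lt_min s0 divr_gt0// ltr_wpDl.
move=> v; rewrite lt_min => /andP[vs ve].
have sv : s + s <= complex.Re v.
  have := Re_le_cabs (w - v); rewrite cabsBC !ReImE => h; move: vs; rewrite /s in h *; lra.
have sw : s + s <= complex.Re w by rewrite /s; lra.
have v0 : 0 < complex.Re v by apply: lt_le_trans sv; rewrite addr_gt0.
have := cauchy_deriv_lip FD FK s0 sv sw (dual_res2_hasD BC x dxs v0) (dual_res2_hasD BC x dxs w0).
rewrite -mulrBr cabsM cabsN cabs_natr.
rewrite -/(H3 v) -/(H3 w) -/C => h; move: ve; rewrite ltr_pdivlMr ?ltr_wpDl// => ve.
have := cabs_ge0 (H3 v - H3 w); have := cabs_ge0 (v - w); nra.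
Qed.

(* Along w = z + 2a, P is a primitive of a |-> a * H3 w, vanishing at infinity. *)
Let P (z w : R[i]) : R[i] := - ((w - z) * H2 w + H1 w) / 8.

Let P_hasD z w : 0 < complex.Re w -> hasD (P z) w ((w - z) * H3 w / 4).
Proof.
move=> w0.
have h := hasDZ (- 8^-1) (hasDD (hasDM (hasD_affine z w) (dual_res2_hasD BC x dxs w0))
  (dual_res_hasD BC x dxs w0)).
have -> : (w - z) * H3 w / 4 = - 8^-1 * ((w - z) * (- 2 * xs (res w (res w (res w x)))) +
    xs (res w (res w x)) * 1 + - xs (res w (res w x))).
  by rewrite /H3; field.
have -> : P z = fun w0 => - 8^-1 * ((w0 - z) * xs (res w0 (res w0 x)) + xs (res w0 x)).
  by apply/funext => v; rewrite /P /H2 /H1; ring.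
exact: h.
Qed.

Lemma resolvent_cube_integral z : 0 < complex.Re z ->
  cintegrable Rpos (fun a => a%:C%C * H3 (z + (a + a)%:C%C)) /\
  cint Rpos (fun a => a%:C%C * H3 (z + (a + a)%:C%C)) = H1 z / 8.
Proof.
move=> z0; have [K K0 HK] := dual_res_le BC x dxs.
pose d (t : R) : R[i] := (z + t%:C%C * 2 - z) * H3 (z + t%:C%C * 2) / 4.
have hd t : d t * 2 = t%:C%C * H3 (z + (t + t)%:C%C).
  rewrite /d rmorphD (_ : t%:C%C + t%:C%C = t%:C%C * 2 :> R[i]); last by ring.
  by move: (H3 _) => u; field.
have Re2 (t : R) : complex.Re (z + t%:C%C * 2) = complex.Re z + (t + t).
  by rewrite cReD; congr (_ + _); rewrite (_ : t%:C%C * 2 = (t + t)%:C%C) // rmorphD; ring.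
have dc t : 0 <= t -> pcont d t.
  move=> t0; have w0 : 0 < complex.Re (z + t%:C%C * 2) by rewrite Re2; lra.
  apply: (@pcont_path R (fun w => (w - z) * H3 w / 4)).
  apply: ccontinuousM; last exact: hasD_continuous (hasD_cst _ _).
  apply: ccontinuousM; first exact: hasD_continuous (hasD_affine _ _).
  exact: dual_res3_continuous.
have ii : cintegrable Rpos (fun t => d t * 2).
  (* Since [Re (z + 2 t) = 2 (c + t)], the cubic decay bounds the integrand by
     [K t / (8 (c + t)^3)], hence by [K / (c + t)^2], a multiple of [hker c]. *)
  pose c := complex.Re z / 2; have c0 : 0 < c by rewrite divr_gt0.
  apply: (@cintegrable_dom R Rpos _ (fun t => K / c * hker c t)) => //.
  - apply: cmeasM; last exact: cmeas_cst.
    apply: pcont_cmeas_open => // t /Rpos_gt0 t0; exact: dc (ltW t0).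
  - by apply: integrable_RZ => //; exact: integrable_hker.
  - move=> t /Rpos_gt0 t0; rewrite hd cabsM cabs_real gtr0_norm//.
    have w0 : 0 < complex.Re (z + (t + t)%:C%C) by rewrite cReD /=; lra.
    have [_ _ h] := HK _ w0; apply: le_trans (ler_wpM2l (ltW t0) h) _.
    rewrite cReD /= /hker mulrA divfK ?gt_eqF//.
    have ct : 0 < c + t by rewrite addr_gt0.
    rewrite (_ : complex.Re z + (t + t) = 2 * (c + t)); last by rewrite /c; field.
    rewrite mulrCA ler_wpM2l// ler_pdivrMr ?exprn_gt0 ?mulr_gt0//.
    rewrite ler_pdivlMl ?exprn_gt0//.
    by nra.
have L1 : cint Rpos (fun t => d t * 2) = H1 z / 8.
  apply: cabs_small_eq => e e0; have e2 : 0 < e / 2 by rewrite divr_gt0.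
  have [N HN] := cint_Rpos_trunc ii e2.
  pose n := (maxn N (Num.bound (K / (e / 2)))).+1.
  have n0 : 0 < n%:R :> R by rewrite ltr0n.
  have := HN n (leq_trans (leq_maxl _ _) (leqnSn _)).
  rewrite (@path_cint R (P z) z 2 d 0 n%:R)//; last 2 first.
  - move=> t /andP[t0 _]; apply: P_hasD; rewrite Re2; lra.
  - by move=> t /andP[t0 _]; exact: dc.
  rewrite mul0r addr0 cabsBC => h.
  have EP : P z z = - (H1 z / 8) by rewrite /P subrr mul0r add0r mulNr.
  rewrite EP opprK in h; apply: le_lt_trans (cabs_triangle _ _ _) _.
  rewrite [e]splitr; apply: ltr_leD h _; rewrite addrK /P.
  have w0 : 0 < complex.Re (z + n%:R%:C%C * 2) by rewrite Re2; lra.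
  have [h1 h2 _] := HK _ w0.
  have wn : n%:R <= complex.Re (z + n%:R%:C%C * 2) by rewrite Re2; lra.
  set w := z + n%:R%:C%C * 2 in w0 h1 h2 wn *.
  have Ew : w - z = (n%:R + n%:R)%:C%C.
    by rewrite /w addrAC subrr add0r rmorphD; ring.
  have Kn : K / n%:R <= e / 2.
    rewrite ler_pdivrMr// mulrC -ler_pdivrMr//.
    have h0 : 0 <= K / (e / 2) by rewrite divr_ge0// ltW.
    apply: le_trans (ltW (archi_boundP h0)) _; rewrite ler_nat.
    exact: leq_trans (leq_maxr _ _) (leqnSn _).
  have r1 : K / complex.Re w <= K / n%:R by rewrite ler_wpM2l// lef_pV2 ?posrE.
  have r2 : K / complex.Re w ^+ 2 <= K / n%:R ^+ 2.
    rewrite ler_wpM2l// lef_pV2 ?posrE ?exprn_gt0//.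
    by rewrite ler_sqr ?nnegrE// ltW.
  rewrite cabsM cabsN cabsV cabs_natr.
  rewrite ler_pdivrMr//; apply: le_trans (cabsD _ _) _; rewrite Ew cabsM cabs_real.
  rewrite ger0_norm ?addr_ge0 ?(ltW n0)//.
  have r3 : (n%:R + n%:R) * cabs (H2 w) <= 2 * (K / n%:R).
    apply: le_trans (ler_wpM2l _ (le_trans h2 r2)) _; first by rewrite addr_ge0// ltW.
    rewrite le_eqVlt; apply/orP; left; apply/eqP; field; by rewrite gt_eqF.
  have r4 := le_trans h1 r1; rewrite -/(H1 w) in r4.
  by move: r3 r4 Kn; move: (K / n%:R) => q; lra.
by split; [apply: eq_cintegrable ii => // t _; exact: hd|rewrite -L1; apply: eq_cint => t _; rewrite hd].
Qed.

(** Origin of the constant [2 / pi]: the line integrals contribute [4 pi], the integral of the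
    resolvent cube contributes [1 / 8], and [(2 / pi) (4 pi) / 8 = 1]. *)
Lemma formula_rz z : 0 < complex.Re z ->
  - Complex (2 / pi) 0 * cint Rpos (fun a => Complex a 0 * lineint D A x xs (cderiv (rz z)) a) = xs (res z x).
Proof.
move=> z0; have [ii E] := resolvent_cube_integral z0.
rewrite (eq_cint (k := fun a => - (4 * pi)%:C%C * (a%:C%C * H3 (z + (a + a)%:C%C)))); last first.
  by move=> a /Rpos_gt0 a0; rewrite lineint_rz// -[Complex a 0]/(a%:C%C) mulrCA.
rewrite cintZ// E -[Complex (2 / pi) 0]/((2 / pi)%:C%C) -/(H1 z).
have E8 : (2 / pi)%:C%C * (4 * pi)%:C%C = 8 :> R[i].
  rewrite -rmorphM (_ : 2 / pi * (4 * pi) = 8); first by rewrite rmorph_nat.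
  by have := pi_gt0 R; move: (pi : R) => p p0; field; rewrite gt_eqF.
by rewrite !mulNr mulrN opprK !mulrA E8 mulrC mulrA mulVf ?mul1r// pnatr_eq0.
Qed.

End ResolventIntegral.

(** * The formula in general *)

Section Linearity.
Context {R : realType} {X : completeNormedModType R[i]}.
Notation mu := (@lebesgue_measure R).
Notation Rpos := (`]0%R, +oo[ : set R).
Variables (D : set X) (A : X -> X) (Phi : (R[i] -> R[i]) -> X -> X).
Hypothesis BC : B_calculus D A Phi.
Variables (x : X) (xs : X -> R[i]^o).
Hypothesis dxs : in_dual xs.
Notation res := (resolv D A).
Notation rq := (resq D A x xs).
Notation lint := (lineint D A x xs).
Notation aint := (areaint D A x xs).
Implicit Types (psi f g : R[i] -> R[i]) (a : R).

Lemma lineintD psi psi1 psi2 a : llip psi1 -> llip psi2 ->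
  (forall w, 0 < complex.Re w -> psi w = psi1 w + psi2 w) -> 0 < a ->
  lint psi a = lint psi1 a + lint psi2 a.
Proof.
move=> h1 h2 E a0; rewrite /lineint -cintD//; [|exact: (lineint_integrable BC)..].
by apply: eq_cint => b _; rewrite E// mulrDr.
Qed.

Lemma lineintZ psi psi1 c a : llip psi1 ->
  (forall w, 0 < complex.Re w -> psi w = c * psi1 w) -> 0 < a ->
  lint psi a = c * lint psi1 a.
Proof.
move=> h1 E a0; rewrite /lineint -cintZ//; last exact: (lineint_integrable BC).
by apply: eq_cint => b _; rewrite E// mulrCA.
Qed.

Lemma areaint_inB : exists2 C : R, 0 <= C & forall f, inB f ->
  cintegrable Rpos (fun a => Complex a 0 * lint (cderiv f) a) /\
  cabs (aint (cderiv f)) <= C * Rintegral mu Rpos (dm f).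
Proof.
have [C C0 HC] := areaint_le BC x dxs; exists C => // f fB.
have [_ H] := HC (cderiv f) (dm f) (llip_cderiv fB) (fun a b ha => inB_ub b fB ha).
exact: H (inB_integrable fB).
Qed.

Lemma areaint_cderivD f g : inB f -> inB g ->
  aint (cderiv (fun l => f l + g l)) = aint (cderiv f) + aint (cderiv g).
Proof.
move=> fB gB; have [C C0 HC] := areaint_inB.
have [i1 _] := HC f fB; have [i2 _] := HC g gB.
rewrite /areaint -cintD//; apply: eq_cint => a /Rpos_gt0 a0.
rewrite -mulrDr; congr (_ * _); apply: (lineintD (llip_cderiv fB) (llip_cderiv gB)) => // w w0.
exact: hasD_cderiv (hasDD (inB_hasD fB w0) (inB_hasD gB w0)).
Qed.

Lemma areaint_cderivZ c f : inB f -> aint (cderiv (fun l => c * f l)) = c * aint (cderiv f).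
Proof.
move=> fB; have [C C0 HC] := areaint_inB; have [i1 _] := HC f fB.
rewrite /areaint -cintZ//; apply: eq_cint => a /Rpos_gt0 a0.
rewrite mulrCA; congr (_ * _); apply: (lineintZ (llip_cderiv fB)) => // w w0.
exact: hasD_cderiv (hasDZ c (inB_hasD fB w0)).
Qed.

Local Opaque areaint.

Let k : R[i] := Complex (2 / pi) 0.

Lemma two_over_pi_le1 : cabs k <= 1.
Proof.
have pi0 := pi_gt0 R; have pi2 := pi_ge2 R.
by rewrite /k cabs_complex0 gtr0_norm ?divr_gt0// ler_pdivrMr// mul1r.
Qed.

Lemma formula_decaying f (C : R) : inB f ->
  (forall w, 0 < complex.Re w -> cabs (f w) <= C / cabs (1 + w) ^+ 2) ->
  xs (Phi f x) = - k * aint (cderiv f).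
Proof.
move=> fB fC; have [M M0 HM] := calculus_bounded BC; have [L L0 HL] := dual_le dxs.
have [N N0 HN] := areaint_inB.
have addH (q a b c d u v : R[i]) : u = a + b -> v = c + d ->
    cabs (u + q * v) <= cabs (a + q * c) + cabs (b + q * d).
  by move=> -> ->; apply: le_trans (cabsD _ _); rewrite mulrDr addrACA.
have scaleH (c q a b u v : R[i]) : u = c * a -> v = c * b ->
    cabs (u + q * v) <= cabs c * cabs (a + q * b).
  by move=> -> ->; rewrite -cabsM mulrDr mulrCA.
pose p g := cabs (xs (Phi g x) + k * aint (cderiv g)).
have pB : Bseminorm p (L * (M * nrm x) + N).
  split.
  - move=> g h gB hB.
    have E : xs (Phi (fun l => g l + h l) x) = xs (Phi g x) + xs (Phi h x).
      by rewrite (calculusD BC x gB hB) (dualD dxs).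
    exact: (addH k _ _ _ _ _ _ E (areaint_cderivD gB hB)).
  - move=> c g gB.
    have E : xs (Phi (fun l => c * g l) x) = c * xs (Phi g x).
      by rewrite (calculusZ BC c x gB) (dualZ dxs).
    exact: (scaleH c k _ _ _ _ E (areaint_cderivZ c gB)).
  - by rewrite addr_ge0 ?mulr_ge0 ?nrm_ge0.
  - move=> g gB; apply: le_trans (cabsD _ _) _; rewrite mulrDl; apply: lerD.
      apply: le_trans (HL _) _; rewrite -mulrA ler_wpM2l// mulrAC; exact: HM.
    rewrite cabsM; have [_ h] := HN g gB.
    apply: le_trans (ler_wpM2r (cabs_ge0 _) two_over_pi_le1) _; rewrite mul1r.
    by apply: le_trans h _; rewrite ler_wpM2l//; exact: Rintegral_dm_le.
have pr z : Cplus R z -> p (rz z) = 0.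
  move=> z0; rewrite /p (calculus_rz BC)// -(formula_rz BC x dxs z0) -/k.
  by rewrite mulNr addNr cabs0.
have := seminorm_null pB pr fB fC; rewrite /p => h.
have H (q a b : R[i]) : cabs (a + q * b) <= 0 -> a = - q * b.
  move=> h0; have : cabs (a + q * b) == 0 by rewrite eq_le h0 cabs_ge0.
  by rewrite cabs_eq0 addr_eq0 mulNr => /eqP.
exact: H.
Qed.

End Linearity.

(** * Cutoffs built from resolvent functions *)

Section Regularization.
Context {R : realType}.
Notation mu := (@lebesgue_measure R).
Notation Rpos := (`]0%R, +oo[ : set R).
Implicit Types (t : R) (w : R[i]).

(** The scalar counterpart of [t (t + A)^-1]. Its square decays quadratically, so multiplying a
    bounded function by [cutoff] meets the hypothesis of [formula_decaying]. *)
Definition tau t w : R[i] := t%:C%C * rz (t%:C%C) w.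
Definition cutoff t w : R[i] := tau t w * tau t w.
Definition cocutoff t w : R[i] := 1 - cutoff t w.

Lemma inB_tau t : 0 < t -> inB (tau t).
Proof. by move=> t0; apply: inBZ; case: (@inB_rz R t%:C%C t0). Qed.

Lemma inB_cutoff t : 0 < t -> inB (cutoff t).
Proof. by move=> t0; exact: (inBM (inB_tau t0) (inB_tau t0)). Qed.

Lemma inB_cocutoff t : 0 < t -> inB (cocutoff t).
Proof. by move=> t0; exact: (inBB (inB_cst 1) (inB_cutoff t0)). Qed.

Lemma tau_le t w : 0 < t -> 0 < complex.Re w -> cabs (tau t w) <= t / (t + complex.Re w).
Proof.
move=> t0 w0; rewrite /tau /rz cabsM cabs_real gtr0_norm// cabsV ler_pM2l//.
have h := @rz_lower R t%:C%C w t0 w0.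
have h0 : 0 < t + complex.Re w by rewrite addr_gt0.
by rewrite lef_pV2 ?posrE// (lt_le_trans h0 h).
Qed.

Lemma tau_le1 t w : 0 < t -> 0 < complex.Re w -> cabs (tau t w) <= 1.
Proof.
move=> t0 w0; apply: le_trans (tau_le t0 w0) _.
by rewrite ler_pdivrMr ?addr_gt0// mul1r lerDl ltW.
Qed.

Lemma cutoff_decay t w : 1 <= t -> 0 < complex.Re w ->
  cabs (cutoff t w) <= t ^+ 2 / cabs (1 + w) ^+ 2.
Proof.
move=> t1 w0; have t0 : 0 < t := lt_le_trans ltr01 t1.
have h1 : 0 < cabs (1 + w) by rewrite cabs_gt0; exact: (@rz_neq0 R 1 w ltr01 w0).
have h2 : cabs (1 + w) <= cabs (t%:C%C + w).
  rewrite -ler_sqr ?nnegrE ?cabs_ge0// !cabs_sqr !ReImE /= lerD2r.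
  by rewrite ler_sqr ?nnegrE ?addr_ge0 ?(ltW w0) ?ler01 ?(ltW t0)// lerD2r.
have h : cabs (tau t w) <= t / cabs (1 + w).
  by rewrite /tau /rz cabsM cabs_real gtr0_norm// cabsV ler_pM2l// lef_pV2 ?posrE// (lt_le_trans h1).
rewrite /cutoff cabsM -expr_div_n expr2; apply: ler_pM => //; exact: cabs_ge0.
Qed.

Lemma cocutoff_le2 t w : 0 < t -> 0 < complex.Re w -> cabs (cocutoff t w) <= 2.
Proof.
move=> t0 w0; apply: le_trans (cabsB _ _) _; rewrite cabs1 (_ : 2 = 1 + 1)// lerD2l.
by rewrite /cutoff cabsM -[1]mulr1 ler_pM ?cabs_ge0 ?tau_le1.
Qed.

(** From [1 - tau^2 = (1 - tau) (1 + tau)] and [1 - tau = w r_t(w)]. The bound is pointwise, not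
    uniform on vertical lines. *)
Lemma cocutoff_small t w : 0 < t -> 0 < complex.Re w ->
  cabs (cocutoff t w) <= 2 * cabs w / t.
Proof.
move=> t0 w0; have n0 := @rz_neq0 R t%:C%C w t0 w0.
have -> : cocutoff t w = (w * rz t%:C%C w) * (1 + tau t w).
  rewrite /cocutoff /cutoff /tau /rz; move: n0; move: (t%:C%C) => T n0; field; exact: n0.
rewrite !cabsM (_ : 2 * cabs w / t = cabs w * t^-1 * 2); last by rewrite [RHS]mulrC mulrA.
have a1 : cabs (1 + tau t w) <= 2.
  by apply: le_trans (cabsD _ _) _; rewrite cabs1 (_ : 2 = 1 + 1)// lerD2l tau_le1.
have a2 : cabs (rz t%:C%C w) <= t^-1.
  have h := @rz_lower R t%:C%C w t0 w0.
  have h' : t <= cabs (t%:C%C + w) by apply: le_trans h; rewrite lerDl ltW.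
  by rewrite /rz cabsV lef_pV2 ?posrE// (lt_le_trans t0).
by apply: ler_pM; rewrite ?mulr_ge0 ?cabs_ge0// ler_wpM2l ?cabs_ge0.
Qed.

Lemma cocutoff_deriv t w : 0 < t -> 0 < complex.Re w ->
  cabs (cderiv (cocutoff t) w) <= 2 * t ^+ 2 / (t + complex.Re w) ^+ 3.
Proof.
move=> t0 w0; have n0 := @rz_neq0 R t%:C%C w t0 w0.
have h1 : hasD (tau t) w (t%:C%C * - (t%:C%C + w) ^- 2) by exact: hasDZ (rz_hasD n0).
have h2 := hasDB (hasD_cst 1 w) (hasDM h1 h1).
rewrite (hasD_cderiv h2).
set d := t%:C%C * - _; rewrite (_ : _ - _ = - 2 * tau t w * d); last by ring.
rewrite cabsM [cabs (- 2 * _)]cabsM cabsN cabs_natr.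
have h0 : 0 < t + complex.Re w by rewrite addr_gt0.
have hd : cabs d <= t / (t + complex.Re w) ^+ 2.
  rewrite /d cabsM cabsN cabsV cabsX cabs_real gtr0_norm// ler_pM2l//.
  have h := @rz_lower R t%:C%C w t0 w0.
  rewrite lef_pV2 ?posrE ?exprn_gt0//; last exact: lt_le_trans h0 h.
  by rewrite ler_sqr ?nnegrE ?cabs_ge0 ?(ltW h0).
rewrite (_ : 2 * t ^+ 2 / _ = 2 * (t / (t + complex.Re w)) * (t / (t + complex.Re w) ^+ 2)); last first.
  by field; rewrite gt_eqF.
by apply: ler_pM; rewrite ?mulr_ge0 ?cabs_ge0// ler_wpM2l// tau_le.
Qed.

Lemma inv_nat_small (B e : R) : 0 <= B -> 0 < e -> exists N : nat, forall n, (N <= n)%N ->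
  B / n.+1%:R < e.
Proof.
move=> B0 e0; exists (Num.bound (B / e)) => n Nn.
rewrite ltr_pdivrMr// mulrC -ltr_pdivrMr//.
apply: lt_le_trans (archi_boundP _) _; first by rewrite divr_ge0// ltW.
by rewrite ler_nat (leq_trans Nn).
Qed.

End Regularization.

Lemma cint0 (R : realType) (D : set R) : cint D (fun=> 0) = 0.
Proof. by apply: complexP; rewrite /= /Rintegral integral0. Qed.

Section Representation.
Context {R : realType} {X : completeNormedModType R[i]}.
Notation mu := (@lebesgue_measure R).
Notation Rpos := (`]0%R, +oo[ : set R).
Variables (D : set X) (A : X -> X) (Phi : (R[i] -> R[i]) -> X -> X).
Hypothesis BC : B_calculus D A Phi.
Variables (x : X) (xs : X -> R[i]^o).
Hypothesis dxs : in_dual xs.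
Notation res := (resolv D A).
Notation rq := (resq D A x xs).
Notation lint := (lineint D A x xs).
Notation aint := (areaint D A x xs).
Variable F : R[i] -> R[i].
Hypotheses (FB : inB F) (F0 : finfty F = 0).

Let T (n : nat) : R := n.+1%:R.
Let T0 n : 0 < T n. Proof. by rewrite ltr0n. Qed.
Let qB n : inB (cocutoff (T n)) := inB_cocutoff (T0 n).

(** [psi1] and [psi2] are the Leibniz terms of the derivative of [F * cocutoff]. The first is small
    at each point but perhaps not in supremum over a vertical line, so it goes through dominated
    convergence; the second is estimated directly by an integrable majorant. *)
Let psi1 n w : R[i] := cocutoff (T n) w * cderiv F w.
Let psi2 n w : R[i] := F w * cderiv (cocutoff (T n)) w.

Let llip1 n : llip (psi1 n).
Proof. exact: (llipM (llip_inB (qB n)) (llip_cderiv FB)). Qed.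

Let llip2 n : llip (psi2 n).
Proof. exact: (llipM (llip_inB FB) (llip_cderiv (qB n))). Qed.

Let psi1_le n a b : 0 < a -> cabs (psi1 n (Complex a b)) <= 2 * dm F a.
Proof.
move=> a0; rewrite /psi1 cabsM; apply: ler_pM; rewrite ?cabs_ge0//.
  exact: cocutoff_le2.
exact: inB_ub.
Qed.

(** Dominated convergence on a fixed line: the square function estimate makes [rq a] integrable, and
    [psi1] is bounded there by [2 dm F a]. A second passage to the limit, in [a] with majorant a
    multiple of [dm F], follows in [areaint_psi1_cvg]. *)
Lemma lineint_psi1_cvg a : 0 < a -> forall e : R, 0 < e -> exists N, forall n, (N <= n)%N ->
  cabs (lint (psi1 n) a) < e.
Proof.
move=> a0 e e0; have [C C0 HC] := square_function BC x dxs; have [i1 _] := HC a a0.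
have ig : mu.-integrable setT (EFin \o (fun b => (2 * dm F a) * cabs (rq a b))).
  exact: integrable_RZ.
have m0 : 0 <= dm F a by exact: (dm_ge0 (inB_holo FB) (inB_bdd FB) a0).
have [||||N HN] := @cint_dominated R setT (fun n b => rq a b * psi1 n (Complex a b)) (fun=> 0)
   (fun b => (2 * dm F a) * cabs (rq a b)) measurableT _ (cmeas_cst _ _) ig _ _ _ e e0.
- by move=> n; exact: (lineint_meas1 BC x dxs (llip1 n) a0).
- move=> n b _; rewrite cabsM mulrC ler_wpM2r ?cabs_ge0//; exact: psi1_le.
- by move=> b _; rewrite cabs0 !mulr_ge0 ?cabs_ge0.
- move=> b _ r r0.
  pose B := cabs (rq a b) * (2 * cabs (Complex a b) * dm F a).
  have B0 : 0 <= B by rewrite !mulr_ge0 ?cabs_ge0.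
  have [N HN] := inv_nat_small B0 r0; exists N => n Nn; apply: le_lt_trans (HN n Nn).
  rewrite subr0 cabsM /B -mulrA ler_wpM2l ?cabs_ge0// /psi1 cabsM mulrAC.
  apply: ler_pM; rewrite ?cabs_ge0//; [exact: cocutoff_small|exact: inB_ub].
exists N => n Nn; have := HN n Nn.
by rewrite cint0 subr0.
Qed.

Lemma areaint_psi1_cvg (e : R) : 0 < e -> exists N, forall n, (N <= n)%N ->
  cabs (aint (psi1 n)) < e.
Proof.
move=> e0; have [C C0 HC] := areaint_le BC x dxs.
have H1 n a : 0 < a -> cabs (Complex a 0 * lint (psi1 n) a) <= C * (2 * dm F a).
  move=> a0; have [h _] := HC (psi1 n) (fun a => 2 * dm F a) (llip1 n) (fun a b ha => psi1_le n b ha).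
  exact: h.
have ig : mu.-integrable Rpos (EFin \o (fun a => (C * 2) * dm F a)).
  by apply: integrable_RZ => //; exact: inB_integrable.
have [||||N HN] := @cint_dominated R Rpos (fun n a => Complex a 0 * lint (psi1 n) a) (fun=> 0)
   (fun a => (C * 2) * dm F a) (measurable_itv _) _ (cmeas_cst _ _) ig _ _ _ e e0.
- by move=> n; exact: (areaint_meas BC x dxs (llip1 n)).
- by move=> n a /Rpos_gt0 a0; rewrite -mulrA; exact: H1.
- move=> a /Rpos_gt0 a0; rewrite cabs0 -mulrA; apply: le_trans (H1 0%N a a0); exact: cabs_ge0.
- move=> a /Rpos_gt0 a0 r r0; have [N HN] := lineint_psi1_cvg a0 (divr_gt0 r0 a0).
  exists N => n Nn; have := HN n Nn; rewrite subr0 cabsM cabs_complex0 gtr0_norm//.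
  by rewrite ltr_pdivlMr// mulrC.
exists N => n Nn; have := HN n Nn.
by rewrite cint0 subr0.
Qed.

(* Beyond [t0] the oscillation of [F] is small, before [t0] the derivative of the
   cutoff is [O(1/n)]; both bounds are phrased with kernels of integral one. *)
Lemma areaint_psi2_cvg (e : R) : 0 < e -> exists N, forall n, (N <= n)%N ->
  cabs (aint (psi2 n)) < e.
Proof.
move=> e0; have [C C0 HC] := areaint_le BC x dxs.
have e2 : 0 < e / 2 by rewrite divr_gt0.
(* The far part of the majorant has mass [2 eta], which after multiplication by [C] must be at most
   [e / 2]; the [+ 1] guards against [C = 0]. *)
pose eta := e / 2 / (2 * (C + 1)).
have C1 : 0 < 2 * (C + 1) by rewrite mulr_gt0// ltr_wpDl.
have eta0 : 0 < eta by rewrite divr_gt0.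
have [N0 HN0] := om_small FB eta0.
pose t0 : R := N0.+1%:R; have t00 : 0 < t0 by rewrite ltr0n.
pose K := Rintegral mu Rpos (dm F); have K0 : 0 <= K by exact: Rintegral_dm_ge0.
have om_K s : om F s <= K by exact: om_le.
pose m n a := 2 * eta * hker (T n) a + (8 * t0 * K / T n) * hker t0 a.
have k8 n : 0 <= 8 * t0 * K / T n by rewrite divr_ge0 ?(ltW (T0 n))// !mulr_ge0// ltW.
have im1 n : mu.-integrable Rpos (EFin \o (fun a => 2 * eta * hker (T n) a)).
  by apply: integrable_RZ => //; exact: integrable_hker.
have im2 n : mu.-integrable Rpos (EFin \o (fun a => (8 * t0 * K / T n) * hker t0 a)).
  by apply: integrable_RZ => //; exact: integrable_hker.
have Im n : Rintegral mu Rpos (m n) = 2 * eta + 8 * t0 * K / T n.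
  have E c d : 0 < d -> Rintegral mu Rpos (fun a => c * hker d a) = c.
    by move=> d0; rewrite RintegralZl ?Rintegral_hker ?mulr1//; exact: integrable_hker.
  by rewrite /m RintegralD// !E.
have Hm n a b : 0 < a -> cabs (psi2 n (Complex a b)) <= m n a.
  move=> a0; rewrite /psi2 cabsM.
  have h1 : cabs (F (Complex a b)) <= om F a.
    by have := @finfty_le R F (Complex a b) FB a0; rewrite F0 subr0.
  have h2 := @cocutoff_deriv R (T n) (Complex a b) (T0 n) a0; rewrite /= in h2.
  have Ta : 0 < T n + a by rewrite addr_gt0.
  have o0 : 0 <= om F a by exact: le_trans (cabs_ge0 _) h1.
  apply: le_trans (ler_pM (cabs_ge0 _) (cabs_ge0 _) h1 h2) _.
  have hk1 : 0 <= hker (T n) a by rewrite hker_ge0// ltW.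
  have hk2 : 0 <= hker t0 a by rewrite hker_ge0// ltW.
  have d0 : 0 <= 2 * T n ^+ 2 / (T n + a) ^+ 3.
    by rewrite divr_ge0 ?mulr_ge0 ?exprn_ge0// ltW.
  have [ta|ta] := leP t0 a.
    have oe : om F a <= eta.
      by apply/ltW/HN0; apply: le_trans ta; rewrite ler_nat.
    rewrite -[leLHS]addr0; apply: lerD; last by rewrite mulr_ge0.
    have b0 : 2 * T n ^+ 2 / (T n + a) ^+ 3 <= 2 * hker (T n) a.
      have -> : 2 * T n ^+ 2 / (T n + a) ^+ 3 = 2 * (hker (T n) a * (T n / (T n + a))).
        by rewrite /hker; move: (T n) Ta => u ua; field; rewrite gt_eqF.
      rewrite ler_wpM2l// -[leRHS]mulr1 ler_wpM2l// ler_pdivrMr// mul1r lerDl ltW//.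
    by apply: le_trans (ler_pM o0 d0 oe b0) _; rewrite mulrCA mulrA.
  rewrite -[leLHS]add0r; apply: lerD; first exact: mulr_ge0 (mulr_ge0 (ler0n _ 2) (ltW eta0)) hk1.
  have b1 : 2 * T n ^+ 2 / (T n + a) ^+ 3 <= 2 / T n.
    rewrite -[2 * _ / _]mulrA ler_wpM2l// ler_pdivrMr ?exprn_gt0// ler_pdivlMl//.
    by rewrite -exprS lerXn2r ?nnegrE ?(ltW Ta) ?(ltW (T0 n))// lerDl ltW.
  (* For [a < t0] one has [(t0 + a)^2 <= 4 t0^2], so this multiple of the kernel dominates the
     indicator of the near part. *)
  have b2 : 1 <= 4 * t0 * hker t0 a.
    rewrite /hker mulrA ler_pdivlMr ?exprn_gt0 ?addr_gt0// mul1r; nra.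
  apply: le_trans (ler_pM o0 d0 (om_K a) b1) _.
  have E : 8 * t0 * K / T n * hker t0 a = K * (2 / T n) * (4 * t0 * hker t0 a).
    by move: (hker t0 a) (K) (T n) (t0) => p q u v; ring.
  rewrite E -[leLHS]mulr1; apply: ler_wpM2l b2.
  exact: mulr_ge0 K0 (divr_ge0 (ler0n _ 2) (ltW (T0 n))).
have B0 : 0 <= C * (8 * t0 * K) by rewrite !mulr_ge0// ltW.
have [N HN] := inv_nat_small B0 e2; exists N => n Nn.
have [_ H] := HC (psi2 n) (m n) (llip2 n) (Hm n).
have [_ H'] := H (integrable_RD (measurable_itv _) (im1 n) (im2 n)).
apply: le_lt_trans H' _; rewrite Im mulrDr [e]splitr; apply: ler_ltD; last first.
  by rewrite mulrA; exact: HN.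
apply: (@le_trans _ _ ((2 * (C + 1)) * eta)); last by rewrite /eta mulrC divfK// gt_eqF.
by rewrite mulrA ler_wpM2r ?(ltW eta0)// mulrC ler_wpM2l// lerDl.
Qed.

Lemma areaint_cocutoff_cvg (e : R) : 0 < e -> exists N, forall n, (N <= n)%N ->
  cabs (aint (cderiv (fun w => F w * cocutoff (T n) w))) < e.
Proof.
move=> e0; have e2 : 0 < e / 2 by rewrite divr_gt0.
have [N1 H1] := areaint_psi1_cvg e2; have [N2 H2] := areaint_psi2_cvg e2.
exists (maxn N1 N2) => n; rewrite geq_max => /andP[n1 n2].
have [C C0 HC] := areaint_le BC x dxs.
have i1 : cintegrable Rpos (fun a => Complex a 0 * lint (psi1 n) a).
  have [_ h] := HC (psi1 n) (fun a => 2 * dm F a) (llip1 n) (fun a b ha => psi1_le n b ha).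
  have ig : mu.-integrable Rpos (EFin \o (fun a => 2 * dm F a)).
    by apply: integrable_RZ => //; exact: inB_integrable.
  by case: (h ig).
have uB := inBM FB (qB n).
have dE w : 0 < complex.Re w -> cderiv (fun w => F w * cocutoff (T n) w) w = psi2 n w + psi1 n w.
  move=> w0; exact: hasD_cderiv (hasDM (inB_hasD FB w0) (inB_hasD (qB n) w0)).
have [C' _ HC'] := areaint_inB BC x dxs; have [iu _] := HC' _ uB.
have E a : 0 < a -> lint (cderiv (fun w => F w * cocutoff (T n) w)) a = lint (psi2 n) a + lint (psi1 n) a.
  by move=> a0; exact: (lineintD BC x dxs (llip2 n) (llip1 n) dE a0).
(* Obtained by difference: the whole derivative is covered by the bound for B, the first Leibniz
   term by its own majorant. *)
have i2 : cintegrable Rpos (fun a => Complex a 0 * lint (psi2 n) a).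
  have := cintegrableB (measurable_itv _) iu i1; apply: eq_cintegrable => // a /Rpos_gt0 a0.
  by rewrite E// mulrDr addrK.
have -> : aint (cderiv (fun w => F w * cocutoff (T n) w)) = aint (psi2 n) + aint (psi1 n).
  by rewrite /areaint -cintD//; apply: eq_cint => a /Rpos_gt0 a0; rewrite E// mulrDr.
apply: le_lt_trans (cabsD _ _) _; rewrite [e]splitr.
exact: ltrD (H2 n n2) (H1 n n1).
Qed.

(** With [S = t (t + A)^-1] the second value is that of [Phi(F) S^2 x], and
    [x - S^2 x = (x - S x) + S (x - S x)] is small because [S x] tends to [x] while [S] stays
    bounded. *)
Lemma calculus_cutoff_cvg (e : R) : 0 < e -> exists N, forall n, (N <= n)%N ->
  cabs (xs (Phi F x) - xs (Phi (fun w => F w * cutoff (T n) w) x)) < e.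
Proof.
move=> e0; have [L L0 HL] := dual_le dxs; have [M M0 HM] := res_bound BC.
have bF : bdd_linear (Phi F) by case: BC => _ [[h _ _ _] _]; exact: h.
have [MF MF0 HMF] := bdd_linear_le bF.
pose Q := L * (MF * (M + 1)).
have Q0 : 0 <= Q by rewrite !mulr_ge0// addr_ge0.
have Q1 : 0 < Q + 1 by rewrite ltr_wpDl.
have [T1 T10 HT] := res_large BC x (divr_gt0 e0 Q1).
exists (Num.bound T1) => n Nn; pose t := T n; have t0 : 0 < t := T0 n.
have tT : T1 <= t.
  by apply: le_trans (ltW (archi_boundP (ltW T10))) _; rewrite ler_nat (leq_trans Nn).
have tB := inB_tau t0; have cB := inB_cutoff t0; have [rB _] := @inB_rz R t%:C%C t0.
have Ptau y : Phi (tau t) y = (t%:C%C : R[i]) *: res (t%:C)%C y.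
  rewrite -(calculus_rz BC (z := (t%:C)%C))//; exact: (calculusZ BC _ y rB).
rewrite -(dualB dxs) (calculusM BC x FB cB) (calculusM BC x tB tB) -(bdd_linearB bF).
rewrite !Ptau; set S := fun y => (t%:C%C : R[i]) *: res (t%:C)%C y.
have SM y : nrm (S y) <= M * nrm y.
  have := HM (t%:C)%C y t0; rewrite /S nrmZ cabs_real gtr0_norm// mulrAC ler_pdivlMr//.
  by rewrite mulrC.
have rL := res_bdd_linear BC (z := (t%:C)%C) t0.
have SB y z : S (y - z) = S y - S z by rewrite /S (bdd_linearB rL) scalerBr.
have small := HT t tT; rewrite -/(S x) in small.
have h : nrm (x - S (S x)) <= (M + 1) * nrm (S x - x).
  rewrite nrmBC; apply: le_trans (nrm_triangle _ (S x) _) _.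
  by rewrite mulrDl mul1r lerD2r -SB; exact: SM.
rewrite -[(_ *: res _ x)]/(S x) -/(S (S x)).
apply: le_lt_trans (HL _) _.
apply: (@le_lt_trans _ _ (Q * nrm (S x - x))).
  rewrite /Q -mulrA ler_wpM2l//; apply: le_trans (HMF _) _.
  by rewrite -mulrA ler_wpM2l.
apply: (@le_lt_trans _ _ ((Q + 1) * nrm (S x - x))).
  by rewrite ler_wpM2r ?nrm_ge0// lerDl.
by move: small; rewrite ltr_pdivlMr// mulrC.
Qed.

Let k : R[i] := Complex (2 / pi) 0.

Lemma formula_vanishing : xs (Phi F x) = - k * aint (cderiv F).
Proof.
apply: cabs_small_eq => e e0; have e2 : 0 < e / 2 by rewrite divr_gt0.
have [N1 H1] := calculus_cutoff_cvg e2; have [N2 H2] := areaint_cocutoff_cvg e2.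
pose n := maxn N1 N2; have h1 := H1 n (leq_maxl _ _); have h2 := H2 n (leq_maxr _ _).
have cB := inB_cutoff (T0 n); have GB := inBM FB cB; have uB := inBM FB (qB n).
have T1 : 1 <= T n by rewrite ler1n.
have GC w : 0 < complex.Re w -> cabs (F w * cutoff (T n) w) <= (snorm F * T n ^+ 2) / cabs (1 + w) ^+ 2.
  move=> w0; rewrite cabsM -mulrA; apply: ler_pM; rewrite ?cabs_ge0//.
    exact: (inB_bdd FB w0).
  exact: cutoff_decay.
have EG := formula_decaying BC x dxs GB GC; rewrite -/k in EG.
have EF : aint (cderiv F) = aint (cderiv (fun w => F w * cutoff (T n) w)) +
    aint (cderiv (fun w => F w * cocutoff (T n) w)).
  rewrite -(areaint_cderivD BC x dxs GB uB); congr (aint (cderiv _)); apply/funext => w.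
  by rewrite -mulrDr /cocutoff addrC subrK mulr1.
have fin (q a b c d : R[i]) : cabs q <= 1 -> cabs (a - b) < e / 2 -> cabs d < e / 2 -> b = - q * c ->
    cabs (a - - q * (c + d)) < e.
  move=> q1 ab dd bc; rewrite (_ : a - - q * (c + d) = (a - b) + q * d); last by rewrite bc; ring.
  apply: le_lt_trans (cabsD _ _) _; rewrite [e]splitr; apply: ltrD => //.
  by apply: le_lt_trans dd; rewrite cabsM -[leRHS]mul1r ler_wpM2r ?cabs_ge0.
rewrite EF; apply: (fin k _ _ _ _ _ h1 h2 EG); exact: two_over_pi_le1.
Qed.

End Representation.

Theorem mainTheorem12 (R : realType) (X : completeNormedModType R[i])
    (D : set X) (A : X -> X) (Phi : (R[i] -> R[i]) -> X -> X) :
  B_calculus D A Phi ->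
  (* uniqueness *)
  (forall Psi, B_calculus D A Psi -> forall f, inB f -> Psi f = Phi f) /\
  (* representation formula *)
  (forall f, inB f -> forall (x : X) (xs : X -> R[i]^o), in_dual xs ->
     xs (Phi f x) =
       finfty f * xs x
       - (Complex (2 / pi) 0) *
         cint `]0, +oo[ (fun a : R =>
           Complex a 0 *
           cint [set: R] (fun b : R =>
             xs (resolv D A (Complex a (- b)) (resolv D A (Complex a (- b)) x))
             * cderiv f (Complex a b)))).
Proof.
move=> BC; split=> [Psi BQ f fB|f fB x xs dxs]; first exact: (calculus_unique BC BQ fB).
(* The cutoff argument requires a function vanishing at infinity. Removing the constant leaves the
   derivative unchanged, and [Phi] sends it to [c] times the identity, which is the first term of
   the formula. *)
pose c := finfty f; pose F l := f l - c.
have cB := inB_cst c; have FB : inB F := inBB fB cB.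
have F0 : finfty F = 0.
  apply: finfty_unique => e e0; have [M HM] := finfty_lim fB e0.
  by exists M => z /HM; rewrite subr0.
have EP : xs (Phi f x) = c * xs x + xs (Phi F x).
  have E : Phi F x = Phi f x - Phi (fun=> c) x by exact: (calculusB BC x fB cB).
  have E1 : Phi (fun=> c) x = c *: x.
    have := calculusZ BC c x (inB_cst 1); rewrite (calculus1 BC) => <-.
    by congr (Phi _ x); apply/funext => l; rewrite mulr1.
  by rewrite E E1 (dualB dxs) (dualZ dxs) addrC subrK.
have EA : areaint D A x xs (cderiv F) = areaint D A x xs (cderiv f).
  apply: areaint_ext => w w0.
  have := hasDB (inB_hasD fB w0) (hasD_cst c w).
  by rewrite subr0 => /hasD_cderiv.
have combine (q u v w o o' : R[i]) : u = w + v -> v = - q * o -> o = o' -> u = w - q * o'.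
  by move=> -> -> ->; rewrite mulNr.
exact: (combine _ _ _ _ _ _ EP (formula_vanishing BC x dxs FB F0) EA).
Qed.
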